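(* Let $D_{n,i}\in\mathrm{VRep}(S_n)$ be the coefficient of $t^i$ in the equivariant Kazhdan-Lusztig polynomial $P_{B_n}^{S_n}(t)$ of the braid matroid $B_n$. Then: $D_{6,2} = V[2,2,2]\oplus V[4,2]\oplus V[6]$; $D_{7,2} = V[2,2,2,1]\oplus V[3,2,2]\oplus V[4,2,1]^{\oplus 2}\oplus V[4,3]^{\oplus 2}\oplus V[5,2]^{\oplus 2}\oplus V[6,1]^{\oplus 2}\oplus V[7]^{\oplus 2}$; $D_{8,2} = V[2,2,2,2]\oplus V[3,2,2,1]\oplus V[4,2,1,1]\oplus V[4,2,2]^{\oplus 4}\oplus V[4,3,1]^{\oplus 3}\oplus V[4,4]^{\oplus 4}\oplus V[5,2,1]^{\oplus 4}\oplus V[5,3]^{\oplus 4}\oplus V[6,1,1]\oplus V[6,2]^{\oplus 7}\oplus V[7,1]^{\oplus 4}\oplus V[8]^{\oplus 4}$; $D_{9,2} = V[3,2,2,2]\oplus V[4,2,2,1]^{\oplus 3}\oplus V[4,3,1,1]\oplus V[4,3,2]^{\oplus 4}\oplus V[4,4,1]^{\oplus 6}\oplus V[5,2,1,1]^{\oplus 2} \oplus V[5,2,2]^{\oplus 7}\oplus V[5,3,1]^{\oplus 7}\oplus V[5,4]^{\oplus 7}\oplus V[6,2,1]^{\oplus 9}\oplus V[6,3]^{\oplus 12}\oplus V[7,1,1]^{\oplus 3}\oplus V[7,2]^{\oplus 12}\oplus V[8,1]^{\oplus 8}\oplus V[9]^{\oplus 6}$; $D_{8,3} = V[2,2,2,2]\oplus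 V[3,2,2,1]\oplus V[3,3,1,1]\oplus V[4,1,1,1,1]\oplus V[4,2,1,1]\oplus V[4,2,2]^{\oplus 3}\oplus V[4,3,1] \oplus V[4,4]^{\oplus 2}\oplus V[5,2,1]^{\oplus 2}\oplus V[5,3]\oplus V[6,2]^{\oplus 2}\oplus V[7,1]\oplus V[8]$; $D_{9,3} = V[2,2,2,2,1]\oplus V[3,2,2,1,1]^{\oplus 2}\oplus V[3,2,2,2]^{\oplus 4}\oplus V[3,3,1,1,1]^{\oplus 2}\oplus V[3,3,2,1]^{\oplus 4}\oplus V[3,3,3]^{\oplus 2}\oplus V[4,1,1,1,1,1]\oplus V[4,2,1,1,1]^{\oplus 3}\oplus V[4,2,2,1]^{\oplus 10}\oplus V[4,3,1,1]^{\oplus 7}\oplus V[4,3,2]^{\oplus 10}\oplus V[4,4,1]^{\oplus 8}\oplus V[5,1,1,1,1]\oplus V[5,2,1,1]^{\oplus 8}\oplus V[5,2,2]^{\oplus 12}\oplus V[5,3,1]^{\oplus 13}\oplus V[5,4]^{\oplus 7}\oplus V[6,1,1,1]^{\oplus 2}\oplus V[6,2,1]^{\oplus 12}\oplus V[6,3]^{\oplus 11}\oplus V[7,1,1]^{\oplus 4}\oplus V[7,2]^{\oplus 9}\oplus V[8,1]^{\oplus 5}\oplus V[9]^{\oplus 3}$.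
   Context: $B_n$ is the matroid of the complete graph on $n$ vertices: its ground set is the set of 2-element subsets of $[n]$, its lattice of flats is the lattice of set partitions of $[n]$, the rank of a flat is $n$ minus the number of parts, and $S_n$ acts in the obvious way. For a partition $\lambda$ of $n$, $V[\lambda]$ is the irreducible complex representation of $S_n$ indexed by $\lambda$ (with $V[n]$ trivial). An equivariant matroid $W\curvearrowright M$ is a matroid $M$ on a finite ground set $\mathcal I$ together with a finite group $W$ acting on $\mathcal I$ and preserving $M$. $\mathrm{VRep}(W)$ is the Grothendieck ring of finite-dimensional complex representations and $\mathrm{grVRep}(W)=\mathrm{VRep}(W)\otimes_{\mathbb Z}\mathbb Z[t]$. The Orlik-Solomon algebra of $M$ is the quotient of the exterior algebra over $\mathbb C$ on generators $e_i$ ($i\in\mathcal I$) by the ideal generated by $\partial e_C$ for all circuits $C$ ($\partial$ the derivation with $\partial e_i=1$); $W$ acts by permuting generators, and the degree $p$ part is $OS^W_{M,p}$. The equivariant characteristic polynomial is $H^W_M(t)=\sum_{p=0}^{\operatorname{rk}M}(-1)^p t^{\operatorname{rk}M-p}OS^W_{M,p}$. For a flat $F$ in the lattice of flats $L$, $W_F$ is its stabilizer, $M_F$ is the matroid on $F$ with lattice of flats $\{G\le F\}$ (usual restriction $M|F$), and $M^F$ is the matroid on $\mathcal I\smallsetminus F$ with lattice of flats $\{G\ge F\}$ (usual contraction $M/F$). The equivariant Kazhdan-Lusztig polynomial is the unique assignment to each equivariant (loopless) matroid $W\curvearrowright M$ of an element $P^W_M(t)\in\mathrm{grVRep}(W)$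 such that: (1) if $\operatorname{rk}M=0$, $P^W_M(t)$ is the trivial representation in degree $0$; (2) if $\operatorname{rk}M>0$, $\deg P_M^W(t)<\frac12\operatorname{rk}M$; (3) $t^{\operatorname{rk}M}P^W_M(t^{-1})=\sum_{[F]\in L/W}\operatorname{Ind}_{W_F}^W\big(H^{W_F}_{M_F}(t)\otimes P^{W_F}_{M^F}(t)\big)$ (sum over orbit representatives); (4) $P^{W'}_M(t)=\varphi^*P^W_M(t)$ for every homomorphism $\varphi:W'\to W$. *)

(* Defs.v *)
From HB Require Import structures.
From mathcomp Require Import all_boot all_order all_algebra.
From mathcomp Require Import all_fingroup all_solvable all_field all_character.

Set Implicit Arguments.
Unset Strict Implicit.
Unset Printing Implicit Defensive.

Import GroupScope GRing.Theory.
Local Open Scope ring_scope.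

(* The ground set is a subset of an ambient finType, so that restrictions     *)
(* and contractions live over the same ambient type.                          *)
Record matroid (I : finType) := Matroid {
  ground : {set I};
  indep : {set {set I}};
  indep_sub : forall A : {set I}, A \in indep -> A \subset ground;
  indep_set0 : set0 \in indep;
  indep_hered : forall A B : {set I}, B \in indep -> A \subset B -> A \in indep;
  indep_aug : forall A B : {set I},
    A \in indep -> B \in indep -> (#|A| < #|B|)%N ->
    exists2 x, x \in B :\: A & x |: A \in indep }.

Section MatroidTheory.
Variables (I : finType) (M : matroid I).
Implicit Types A B C F : {set I}.

Definition rank A := \max_(B in indep M | B \subset A) #|B|.

Definition rk := rank (ground M).

Definition loopless := forall i, i \in ground M -> [set i] \in indep M.

Definition circuits : {set {set I}} :=
  [set C : {set I} | (C \subset ground M)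
                     && minset [pred A | A \notin indep M] C].

Definition flats : {set {set I}} :=
  [set F : {set I} | (F \subset ground M)
                     && [forall i in ground M :\: F, (rank F < rank (i |: F))%N]].

Lemma rank_leq A B : B \in indep M -> B \subset A -> (#|B| <= rank A)%N.
Proof.
move=> iB sBA.
by apply: (leq_bigmax_cond (F := fun B : {set I} => #|B|)); rewrite iB.
Qed.

Lemma rank_basis A :
  exists B, [/\ B \in indep M, B \subset A & #|B| = rank A].
Proof.
have : (0 < #|[pred B | (B \in indep M) && (B \subset A)]|)%N.
  by apply/card_gt0P; exists set0; rewrite inE indep_set0 sub0set.
case/(eq_bigmax_cond (fun B : {set I} => #|B|)) => B /[!inE] /andP[iB sBA] e.
by exists B; split; rewrite // -e; apply: eq_bigl => C; rewrite !inE.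
Qed.

Lemma indep_extend A B : A \in indep M -> B \in indep M -> (#|A| <= #|B|)%N ->
  exists C, [/\ C \in indep M, A \subset C, C \subset A :|: B & #|C| = #|B|].
Proof.
move eqk: (#|B| - #|A|)%N => k.
elim: k A eqk => [|k IHk] A eqk iA iB leAB.
  exists A; split; rewrite ?subsetUl //.
  by apply/eqP; rewrite eqn_leq leAB /= -subn_eq0 eqk.
have ltAB : (#|A| < #|B|)%N by rewrite -subn_gt0 eqk.
have [x /setDP[xB xA] iAx] := indep_aug iA iB ltAB.
have [||C [iC sC sCu cC]] := IHk (x |: A) _ iAx iB.
- by rewrite cardsU1 xA add1n subnS eqk.
- by rewrite cardsU1 xA add1n.
exists C; split => //; first exact: subset_trans (subsetUr _ _) sC.
apply: subset_trans sCu _; rewrite !subUset sub1set inE xB orbT subsetUl.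
by rewrite subsetUr.
Qed.

Section Restriction.
Variable F : {set I}.

Definition restr_indep := [set A in indep M | A \subset F].

Lemma restr_sub A : A \in restr_indep -> A \subset ground M :&: F.
Proof. by rewrite inE subsetI => /andP[/indep_sub-> ->]. Qed.

Lemma restr_set0 : set0 \in restr_indep.
Proof. by rewrite inE indep_set0 sub0set. Qed.

Lemma restr_hered A B : B \in restr_indep -> A \subset B -> A \in restr_indep.
Proof.
rewrite !inE => /andP[iB sBF] sAB.
by rewrite (indep_hered iB sAB) (subset_trans sAB sBF).
Qed.

Lemma restr_aug A B : A \in restr_indep -> B \in restr_indep ->
  (#|A| < #|B|)%N -> exists2 x, x \in B :\: A & x |: A \in restr_indep.
Proof.
rewrite !inE => /andP[iA sAF] /andP[iB sBF] ltAB.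
have [x xBA iAx] := indep_aug iA iB ltAB; exists x => //.
rewrite inE iAx subUset sub1set sAF andbT.
by case/setDP: xBA => xB _; apply: (subsetP sBF).
Qed.

Definition restr := Matroid restr_sub restr_set0 restr_hered restr_aug.

End Restriction.

Section Contraction.
Variable F : {set I}.

Definition contr_indep :=
  [set A : {set I} | (A \subset ground M :\: F)
                     && (rank (A :|: F) == #|A| + rank F)%N].

Lemma contr_indepP B : B \in indep M -> B \subset F -> #|B| = rank F ->
  forall A, A \subset ground M :\: F ->
    (A \in contr_indep) = (A :|: B \in indep M).
Proof.
move=> iB sBF cB A sA; rewrite inE sA /=.
have dAF : [disjoint A & F] by move: sA; rewrite subsetD => /andP[].
have dAB : A :&: B = set0.
  by apply: disjoint_setI0; apply: disjointWr dAF.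
have cAB : #|A :|: B| = (#|A| + rank F)%N by rewrite cardsU dAB cards0 subn0 cB.
apply/eqP/idP => [rAF | iAB].
  have [C [iC sC cC]] := rank_basis (A :|: F).
  have [|D [iD sBD sD cD]] := indep_extend iB iC.
    by rewrite cB cC rAF leq_addl.
  have sDAF : D \subset A :|: F.
    by rewrite (subset_trans sD) // subUset sC (subset_trans sBF) ?subsetUr.
  have eDF : D :&: F = B.
    apply/eqP; rewrite eq_sym eqEcard subsetI sBD sBF /= cB.
    by apply: rank_leq; rewrite ?subsetIr // (indep_hered iD) // subsetIl.
  have sDAB : D \subset A :|: B.
    apply/subsetP=> x xD; rewrite inE; have := subsetP sDAF x xD.
    by rewrite inE => /orP[->//|xF]; rewrite -eDF inE xD xF orbT.
  suff -> : A :|: B = D by [].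
  by apply/eqP; rewrite eq_sym eqEcard sDAB cAB cD cC rAF leqnn.
apply/eqP; rewrite eqn_leq; apply/andP; split; last first.
  by rewrite -cAB; apply: rank_leq => //; rewrite setUS.
have [C [iC sC <-]] := rank_basis (A :|: F).
have -> : C = (C :&: A) :|: (C :&: F) by rewrite -setIUr; apply/esym/setIidPl.
rewrite (leq_trans (leq_card_setU _ _)) // leq_add //.
  by rewrite subset_leq_card // subsetIr.
by apply: rank_leq; rewrite ?subsetIr // (indep_hered iC) // subsetIl.
Qed.

Lemma contr_sub A : A \in contr_indep -> A \subset ground M :\: F.
Proof. by rewrite inE => /andP[]. Qed.

Lemma contr_set0 : set0 \in contr_indep.
Proof. by rewrite inE sub0set set0U cards0 add0n /=. Qed.

Lemma contr_hered A B : B \in contr_indep -> A \subset B -> A \in contr_indep.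
Proof.
have [C [iC sC cC]] := rank_basis F.
move=> cB sAB; have sB := contr_sub cB; have sA := subset_trans sAB sB.
move: cB; rewrite !(contr_indepP iC sC cC) // => iBC.
by apply: indep_hered iBC _; rewrite setSU.
Qed.

Lemma contr_aug A B : A \in contr_indep -> B \in contr_indep ->
  (#|A| < #|B|)%N -> exists2 x, x \in B :\: A & x |: A \in contr_indep.
Proof.
have [C [iC sC cC]] := rank_basis F.
move=> cA cB ltAB; have sA := contr_sub cA; have sB := contr_sub cB.
have dC (D : {set I}) : D \subset ground M :\: F -> #|D :|: C| = (#|D| + #|C|)%N.
  rewrite subsetD => /andP[_ dDF]; rewrite cardsU.
  by rewrite disjoint_setI0 ?cards0 ?subn0 //; apply: disjointWr dDF.
move: cA cB; rewrite !(contr_indepP iC sC cC) // => iAC iBC.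
have [|x] := indep_aug iAC iBC; first by rewrite !dC // ltn_add2r.
rewrite !inE negb_or -andbA => /and3P[xA xC xBC] iAx.
have xB : x \in B by rewrite (negPf xC) orbF in xBC.
exists x; first by rewrite !inE xA.
rewrite (contr_indepP iC sC cC) -?setUA // subUset sub1set sA andbT.
exact: (subsetP sB).
Qed.

Definition contr := Matroid contr_sub contr_set0 contr_hered contr_aug.

End Contraction.
End MatroidTheory.

(* W acts on the whole ambient type, but its action outside the ground set    *)
(* plays no role.                                                             *)
Record eqMatroid (gT : finGroupType) (W : {group gT}) (I : finType) :=
  EqMatroid {
    em_matroid :> matroid I;
    em_act : action W I;
    em_ground : [acts W, on ground em_matroid | em_act];
    em_indep : forall w A, w \in W ->
      A \in indep em_matroid -> (em_act^*)%act A w \in indep em_matroid }.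

Section Equivariant.
Variables (gT : finGroupType) (W : {group gT}) (I : finType).
Variable M : eqMatroid W I.

Lemma rank_act w A : w \in W -> rank M ((em_act M)^*%act A w) = rank M A.
Proof.
have leR v B : v \in W -> (rank M B <= rank M ((em_act M)^*%act B v))%N.
  move=> Wv; have [C [iC sC <-]] := rank_basis M B.
  rewrite -(card_setact (em_act M) C v).
  by apply: rank_leq; rewrite ?em_indep // /setact imsetS.
move=> Ww; apply/eqP; rewrite eqn_leq leR // andbT.
by rewrite -{2}(actKin (em_act M)^*%act Ww A) leR ?groupV.
Qed.

Lemma em_indepE w A : w \in W ->
  ((em_act M)^*%act A w \in indep M) = (A \in indep M).
Proof.
move=> Ww; apply/idP/idP => [iA|]; last exact: em_indep.
by rewrite -(actKin (em_act M)^*%act Ww A) em_indep ?groupV.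
Qed.

Lemma ground_act w : w \in W -> (em_act M)^*%act (ground M) w = ground M.
Proof.
by move=> Ww; apply/astabs_setact/(subsetP (em_ground M)).
Qed.

Section Flat.
Variable F : {set I}.

Definition flat_stab : {group gT} := 'N_W(F | em_act M)%G.

Lemma flat_stab_sub : flat_stab \subset W. Proof. exact: subsetIl. Qed.

Definition flat_act : action flat_stab I := (em_act M \ flat_stab_sub)%act.

Lemma flat_actF w : w \in flat_stab -> (em_act M)^*%act F w = F.
Proof. by case/setIP=> _ /astabs_setact. Qed.

Lemma flat_act_subF w (A : {set I}) : w \in flat_stab ->
  A \subset F -> (em_act M)^*%act A w \subset F.
Proof. by move=> /flat_actF {2}<- sA; rewrite /setact imsetS. Qed.

Lemma restr_ground : [acts flat_stab, on ground (restr M F) | flat_act].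
Proof.
apply/subsetP=> w Fw; have Ww := subsetP flat_stab_sub w Fw.
rewrite /flat_act astabs_ract inE Fw /=.
have /setIP[_ nF] := Fw; have nE := subsetP (em_ground M) w Ww.
by rewrite (subsetP (astabsI (em_act M) _ _)) // inE nE.
Qed.

Lemma restr_indep_act w A : w \in flat_stab ->
  A \in indep (restr M F) -> (flat_act^*)%act A w \in indep (restr M F).
Proof.
move=> Fw; have Ww := subsetP flat_stab_sub w Fw.
by rewrite !inE => /andP[iA sA]; rewrite em_indep //= flat_act_subF.
Qed.

Definition eqRestr : eqMatroid flat_stab I :=
  EqMatroid restr_ground restr_indep_act.

Lemma contr_ground : [acts flat_stab, on ground (contr M F) | flat_act].
Proof.
apply/subsetP=> w Fw; have Ww := subsetP flat_stab_sub w Fw.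
rewrite /flat_act astabs_ract inE Fw /=.
have /setIP[_ nF] := Fw; have nE := subsetP (em_ground M) w Ww.
by rewrite (subsetP (astabsD (em_act M) _ _)) // inE nE.
Qed.

Lemma contr_indep_act w A : w \in flat_stab ->
  A \in indep (contr M F) -> (flat_act^*)%act A w \in indep (contr M F).
Proof.
move=> Fw; have Ww := subsetP flat_stab_sub w Fw.
rewrite !inE => /andP[sA /eqP rA].
have eA : (flat_act^*)%act A w = (em_act M)^*%act A w by [].
rewrite eA card_setact -rA -{2}(flat_actF Fw) /setact -imsetU.
rewrite -/(setact (em_act M) _ _) rank_act // eqxx andbT.
apply/subsetP=> _ /imsetP[x xA ->].
rewrite (astabs_act (to := flat_act) x (subsetP contr_ground w Fw)).
exact: (subsetP sA).
Qed.

Definition eqContr : eqMatroid flat_stab I :=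
  EqMatroid contr_ground contr_indep_act.

End Flat.

(* The degree p part of the Orlik-Solomon algebra.  It is presented as a      *)
(* quotient of the p-th tensor power of the space spanned by the e_i, whose   *)
(* basis consists of the words of length p; W permutes the letters.  The      *)
(* exterior algebra is the tensor algebra modulo e_i e_i and                  *)
(* e_i e_j + e_j e_i, so the relations in degree p are spanned by the u r v,  *)
(* with u, v words and r one of e_i e_i, e_i e_j + e_j e_i, \partial e_C, or  *)
(* a letter outside the ground set.                                           *)
Section OrlikSolomon.
Variable p : nat.

Local Notation dimT := #|{: p.-tuple I}|.

(* The basis vector of a word of length p, and 0 for other words. *)
Definition word (s : seq I) : 'rV[algC]_dimT :=
  \row_j (val (enum_val j : p.-tuple I) == s)%:R.

Definition word_mx (w : gT) : 'M[algC]_dimT :=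
  \matrix_i word [seq em_act M x w | x <- (enum_val i : p.-tuple I)].

(* u (\partial e_c) v, where e_c is the product of the letters of c *)
Definition word_bd (u c v : seq I) : 'rV[algC]_dimT :=
  \sum_(k < size c) (-1) ^+ k *: word (u ++ take k c ++ drop k.+1 c ++ v).

(* Words of length at most p (at most p.+1 for circuits) suffice, since the   *)
(* longer ones only give zero vectors in degree p.                            *)
Definition os_rel : 'M[algC]_dimT :=
  (\sum_(u : p.-bseq I) \sum_(v : p.-bseq I)
    (\sum_(i | i \notin ground M) <<word (u ++ i :: v)>>
     + \sum_(i : I) <<word (u ++ [:: i; i] ++ v)>>
     + \sum_(i : I) \sum_(j : I)
         <<(word (u ++ [:: i; j] ++ v) + word (u ++ [:: j; i] ++ v))%R>>
     + \sum_(c : p.+1.-bseq I | uniq c && ([set x in c] \in circuits M))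
         <<word_bd u c v>>))%MS.

Lemma word_tuple (t : p.-tuple I) : word t = delta_mx 0 (enum_rank t).
Proof.
apply/rowP=> j; rewrite !mxE eqxx /= val_eqE.
by rewrite -(inj_eq enum_val_inj) enum_rankK.
Qed.

Lemma word_size s : size s != p -> word s = 0.
Proof.
move=> ns; apply/rowP=> j; rewrite !mxE; case: eqP => // e.
by rewrite -e size_tuple eqxx in ns.
Qed.

Lemma word_act s w : word s *m word_mx w = word [seq em_act M x w | x <- s].
Proof.
have [sp | ns] := eqVneq (size s) p; last first.
  by rewrite !word_size ?mul0mx ?size_map.
have /eqP sp' := sp; rewrite -[s]/(val (Tuple sp')).
by rewrite word_tuple -rowE rowK enum_rankK.
Qed.

Lemma word_bd_act u c v w (f := fun x => em_act M x w) :
  word_bd u c v *m word_mx w = word_bd (map f u) (map f c) (map f v).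
Proof.
rewrite /word_bd mulmx_suml size_map; apply: eq_bigr => k _.
by rewrite -scalemxAl word_act !map_cat map_take map_drop.
Qed.

Lemma word_mx_repr : mx_repr W word_mx.
Proof.
split=> [|v w Wv Ww]; apply/row_matrixP=> i.
  rewrite rowK row1 (eq_map (act1 (em_act M))) map_id.
  by rewrite word_tuple enum_valK.
rewrite row_mul !rowK word_act -map_comp; congr word.
by apply: eq_map => x; rewrite /= actMin.
Qed.

Definition word_repr : mx_representation algC W dimT :=
  MxRepresentation word_mx_repr.

Lemma circuits_act w C : w \in W ->
  C \in circuits M -> (em_act M)^*%act C w \in circuits M.
Proof.
move=> Ww; rewrite !inE => /andP[sC /minsetP[/= dC minC]].
apply/andP; split; first by rewrite -(ground_act Ww) /setact imsetS.
apply/minsetP; split=> [|B /= dB sB]; first by rewrite /= em_indepE.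
have WVw : w^-1%g \in W by rewrite groupV.
rewrite -(minC ((em_act M)^*%act B w^-1%g)) /= ?em_indepE //.
  by rewrite (actKVin (em_act M)^*%act Ww).
by rewrite -(actKin (em_act M)^*%act Ww C) /setact imsetS.
Qed.

Lemma os_rel_module : mxmodule word_repr os_rel.
Proof.
apply/mxmoduleP=> w Ww; set f := fun x : I => em_act M x w.
have fE s : word s *m word_repr w = word (map f s) by exact: word_act.
rewrite /os_rel sumsmxMr; apply/sumsmx_subP=> u _.
rewrite sumsmxMr; apply/sumsmx_subP=> v _.
apply: (sumsmx_sup [bseq of map f u]) => //.
apply: (sumsmx_sup [bseq of map f v]) => //.
rewrite addsmxMr; apply: addsmxS; first rewrite addsmxMr; first apply: addsmxS;
  first rewrite addsmxMr; first apply: addsmxS.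
- rewrite sumsmxMr; apply/sumsmx_subP=> i iE.
  apply: (sumsmx_sup (f i)).
    by rewrite (astabs_act _ (subsetP (em_ground M) w Ww)).
  by rewrite !(eqmxMr _ (genmxE _)) !genmxE fE map_cat.
- rewrite sumsmxMr; apply/sumsmx_subP=> i _.
  apply: (sumsmx_sup (f i)) => //.
  by rewrite !(eqmxMr _ (genmxE _)) !genmxE fE !map_cat.
- rewrite sumsmxMr; apply/sumsmx_subP=> i _.
  apply: (sumsmx_sup (f i)) => //.
  rewrite sumsmxMr; apply/sumsmx_subP=> j _.
  apply: (sumsmx_sup (f j)) => //.
  by rewrite !(eqmxMr _ (genmxE _)) !genmxE mulmxDl !fE !map_cat.
rewrite sumsmxMr; apply/sumsmx_subP=> c /andP[uc cc].
have fI : injective f by move=> x y; apply: act_inj.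
apply: (sumsmx_sup [bseq of map f c]).
  rewrite /= map_inj_uniq // uc /=.
  suff <- : (em_act M)^*%act [set x in c] w = [set x in map f c].
    exact: circuits_act.
  apply/setP=> x; rewrite inE; apply/imsetP/mapP => -[y yc ->].
    by exists y; rewrite // inE in yc *.
  by exists y; rewrite ?inE.
by rewrite !(eqmxMr _ (genmxE _)) !genmxE word_bd_act.
Qed.

Definition OS : 'CF(W) := cfRepr (factmod_repr os_rel_module).

End OrlikSolomon.

(* VRep(W) is the ring 'Z[irr W] of virtual characters, and grVRep(W) is the  *)
(* ring of polynomials over it.                                               *)
Definition eq_char_poly : {poly 'CF(W)} :=
  \sum_(p < (rk M).+1) ((-1) ^+ p *: OS p) *: 'X^(rk M - p).

End Equivariant.

Definition kl_assignment :=
  forall (gT : finGroupType) (W : {group gT}) (I : finType),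
    eqMatroid W I -> {poly 'CF(W)}.

(* t^d p(1/t), for p of degree at most d *)
Definition poly_rev (R : nzRingType) (d : nat) (p : {poly R}) : {poly R} :=
  \sum_(i < d.+1) p`_i *: 'X^(d - i).

Record is_equivariant_KL (P : kl_assignment) : Prop := IsEquivariantKL {
  KL_virtual : forall (gT : finGroupType) (W : {group gT}) (I : finType)
      (M : eqMatroid W I), loopless M ->
    forall i, (P gT W I M)`_i \in 'Z[irr W];
  KL_rank0 : forall (gT : finGroupType) (W : {group gT}) (I : finType)
      (M : eqMatroid W I), loopless M ->
    rk M = 0%N -> P gT W I M = 1;
  KL_degree : forall (gT : finGroupType) (W : {group gT}) (I : finType)
      (M : eqMatroid W I), loopless M ->
    (0 < rk M)%N ->
    forall i, (P gT W I M)`_i != 0 -> (2 * i < rk M)%N;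
  KL_recursion : forall (gT : finGroupType) (W : {group gT}) (I : finType)
      (M : eqMatroid W I), loopless M ->
    poly_rev (rk M) (P gT W I M) =
      \sum_(F in orbit_transversal (em_act M)^* W (flats M))
        map_poly 'Ind[W]
          (eq_char_poly (eqRestr M F) * P gT (flat_stab M F) I (eqContr M F));
  KL_pullback : forall (gT gT' : finGroupType) (W : {group gT})
      (W' : {group gT'}) (phi : {morphism W' >-> gT}) (I : finType)
      (M : eqMatroid W I) (M' : eqMatroid W' I), loopless M ->
    phi @* W' \subset W ->
    ground M' = ground M -> indep M' = indep M ->
    {in W' & ground M, forall w i, em_act M' i w = em_act M i (phi w)} ->
    P gT' W' I M' =
      map_poly (fun chi : 'CF(W) => cfMorph ('Res[phi @* W'] chi)) (P gT W I M)
}.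

Section Braid.
Variable n : nat.
Implicit Types A B : {set {set 'I_n}}.

Definition edges : {set {set 'I_n}} := [set e : {set 'I_n} | #|e| == 2%N].

Definition adj A : rel 'I_n := fun x y => [set x; y] \in A.

Definition forests : {set {set {set 'I_n}}} :=
  [set A : {set {set 'I_n}} | (A \subset edges)
    && [forall c : n.-bseq 'I_n, (2 < size c)%N ==> ~~ ucycleb (adj A) c]].

Lemma forestP A :
  reflect (A \subset edges /\
           forall c, (2 < size c)%N -> uniq c -> ~~ path.cycle (adj A) c)
          (A \in forests).
Proof.
rewrite inE; apply: (iffP andP) => -[sA acA]; split=> //.
  move=> c c2 uc; have cn : (size c <= n)%N.
    by rewrite -[X in (_ <= X)%N]card_ord -(card_uniqP uc) max_card.
  move/forallP/(_ (Bseq cn))/implyP/(_ c2): acA.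
  by rewrite /ucycleb /= uc andbT.
apply/forallP=> c; apply/implyP=> c2; rewrite /ucycleb.
by case uc: (uniq c); rewrite ?andbF // andbT acA.
Qed.

Lemma adj_sym A : symmetric (adj A).
Proof. by move=> x y; rewrite /adj setUC. Qed.

Lemma edge2 A x y : A \in forests -> [set x; y] \in A -> x != y.
Proof.
by case/forestP=> /subsetP sA _ /sA; rewrite inE cards2; case: (x != y).
Qed.

Lemma set2_eq (p q x y : 'I_n) : [set p; q] = [set x; y] ->
  (p = x /\ q = y) \/ (p = y /\ q = x).
Proof.
move=> e; have : p \in [set x; y] by rewrite -e set21.
have : q \in [set x; y] by rewrite -e set22.
have : x \in [set p; q] by rewrite e set21.
have : y \in [set p; q] by rewrite e set22.
by do 4![case/set2P=> ?]; subst; auto.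
Qed.

Lemma forestU A x y : A \in forests -> ~~ connect (adj A) x y ->
  [set x; y] |: A \in forests.
Proof.
move=> fA ncxy; have [sA acA] := forestP _ fA.
have xNy : x != y by apply: contraNneq ncxy => ->; rewrite connect0.
apply/forestP; split; first by rewrite subUset sub1set sA inE cards2 xNy.
move=> c c2 uc; apply/negP=> cyc.
have [/allP nxy | /allPn[q qc /negPn/eqP eq]] :=
    boolP (all (fun z => [set z; next c z] != [set x; y]) c).
  suff : path.cycle (adj A) c by apply/negP/acA.
  apply: cycle_from_next => // z zc.
  have := next_cycle cyc zc; rewrite {1}/adj 2!inE.
  by rewrite (negPf (nxy z zc)).
have [i [|r s] ec] := rot_to qc.
  by rewrite -(size_rot i) ec in c2.
have er : next c q = r by rewrite -(next_rot i uc) ec /= eqxx.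
rewrite {}er in eq.
have us : uniq [:: q, r & s] by rewrite -ec rot_uniq.
have : path.cycle (adj ([set x; y] |: A)) [:: q, r & s] by rewrite -ec rot_cycle.
rewrite /= => /andP[_ pth].
have s0 : s != [::].
  by apply/eqP=> s0; rewrite -(size_rot i) ec s0 in c2.
suff cA : connect (adj A) r q.
  have [[ex ey]|[ex ey]] := set2_eq eq; move: ncxy; rewrite -ex -ey ?cA //.
  by rewrite (sym_connect_sym (adj_sym A)) cA.
case: s s0 us pth {ec} => [//|z s] _.
rewrite /= !inE !negb_or -!andbA.
case/and5P=> qr qz qs rz /and3P[rs zs us] /andP[rzA pth].
apply: (@connect_trans _ _ z).
  apply: connect1; move: rzA; rewrite /adj !inE => /orP[|//].
  rewrite -eq => /eqP/set2_eq[[e1 _]|[_ e2]].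
    by rewrite e1 eqxx in qr.
  by rewrite e2 eqxx in qz.
apply/connectP; exists (rcons s q); last by rewrite last_rcons.
apply: (sub_in_path (P := predC1 r)) pth => [a b|].
  rewrite !inE => ar br; rewrite /adj !inE => /orP[|//].
  rewrite -eq => /eqP/set2_eq[[_ e2]|[e1 _]].
    by rewrite e2 eqxx in br.
  by rewrite e1 eqxx in ar.
rewrite /= all_rcons inE qr eq_sym rz /=.
by apply/allP=> a as_; rewrite inE; apply: contraNneq rs => <-.
Qed.

Lemma forestD B x y : B \in forests -> [set x; y] \in B ->
  ~~ connect (adj (B :\ [set x; y])) x y.
Proof.
move=> fB xyB; have xNy := edge2 fB xyB; have [_ acB] := forestP _ fB.
apply/negP=> /connectP[p0 p0P p0l].
case/shortenP: p0P p0l => p pP up _ yl.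
have pB : path (adj B) x p.
  by apply: sub_path pP => a b; rewrite /adj !inE => /andP[].
have : ~~ path.cycle (adj B) (x :: p).
  apply: acB => //; case: p yl pP {up pB} => [|z [|t p]] //= yl.
    by rewrite yl eqxx in xNy.
  by rewrite /adj -yl !inE eqxx.
by rewrite /= rcons_path pB -yl adj_sym /adj xyB.
Qed.

Lemma forest_leq A B : A \in forests -> B \in forests ->
  (forall x y, [set x; y] \in B -> connect (adj A) x y) -> (#|B| <= #|A|)%N.
Proof.
move eqk: #|B :\: A| => k; elim: k B eqk => [|k IHk] B eqk fA fB cBA.
  by apply/subset_leq_card; rewrite -setD_eq0 -cards_eq0 eqk.
have : (0 < #|B :\: A|)%N by rewrite eqk.
case/card_gt0P=> b /setDP[bB bA].
have [sB _] := forestP _ fB; have [sA _] := forestP _ fA.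
have : #|b| == 2%N by have := subsetP sB b bB; rewrite inE.
case/cards2P=> x [y [_ eb]]; subst b.
have ncB := forestD fB bB; have cA := cBA x y bB.
pose B1 := B :\ [set x; y].
have fB1 : B1 \in forests.
  apply/forestP; split=> [|c c2 uc].
    exact: subset_trans (subsetDl _ _) sB.
  have [_ /(_ c c2 uc)] := forestP _ fB; apply: contra.
  by apply: sub_cycle => u v; rewrite /adj !inE => /andP[].
have [u [v [uvA ncuv]]] :
    exists u, exists v, [set u; v] \in A /\ ~~ connect (adj B1) u v.
  have [/existsP[u /existsP[v /andP[h1 h2]]]|nex] :=
      boolP [exists u, exists v, ([set u; v] \in A)
                                 && ~~ connect (adj B1) u v].
    by exists u, v.
  case/negP: ncB; apply: connect_sub cA => u v uvA.
  apply: contraNT nex => nc; apply/existsP; exists u; apply/existsP; exists v.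
  by apply/andP; split.
have uvB1 : [set u; v] \notin B1.
  by apply: contra ncuv => h; apply: connect1.
have uvNxy : [set u; v] != [set x; y].
  by apply: contraNneq bA => <-.
have -> : #|B| = #|[set u; v] |: B1|.
  by rewrite cardsU1 uvB1 (cardsD1 [set x; y] B) bB.
apply: IHk => //; last 2 first.
- exact: forestU.
- move=> a c; rewrite !inE => /orP[/eqP e|/andP[_ /cBA //]].
  by apply: connect1; rewrite /adj e.
have -> : ([set u; v] |: B1) :\: A = (B :\: A) :\ [set x; y].
  apply/setP=> e; rewrite !inE; case: (eqVneq e [set u; v]) => [->|_] /=.
    by rewrite uvA !andbF.
  by rewrite andbCA.
by move: eqk; rewrite (cardsD1 [set x; y]) inE bB bA => -[].
Qed.

Lemma forest_sub A : A \in forests -> A \subset edges.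
Proof. by case/forestP. Qed.

Lemma forest_set0 : set0 \in forests.
Proof.
apply/forestP; split=> [|[|x [|y c]]] //; first exact: sub0set.
by move=> _ _; rewrite /= {1}/adj inE.
Qed.

Lemma forest_hered A B : B \in forests -> A \subset B -> A \in forests.
Proof.
case/forestP=> sB acB sAB; apply/forestP; split=> [|c c2 uc].
  exact: subset_trans sAB sB.
apply: contra (acB c c2 uc); apply: sub_cycle => x y; exact: (subsetP sAB).
Qed.

Lemma forest_aug A B : A \in forests -> B \in forests -> (#|A| < #|B|)%N ->
  exists2 e, e \in B :\: A & e |: A \in forests.
Proof.
move=> fA fB ltAB.
have [/existsP[x /existsP[y /andP[xyB nc]]]|nex] :=
    boolP [exists x, exists y, ([set x; y] \in B) && ~~ connect (adj A) x y].
  exists [set x; y]; last exact: forestU.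
  rewrite inE xyB andbT; apply: contra nc => xyA; exact: connect1.
have : (#|B| <= #|A|)%N; last by rewrite leqNgt ltAB.
apply: forest_leq => // x y xyB; apply: contraNT nex => nc.
by apply/existsP; exists x; apply/existsP; exists y; rewrite xyB.
Qed.

Definition braid_matroid : matroid {set 'I_n} :=
  Matroid forest_sub forest_set0 forest_hered forest_aug.

Definition braid_act : action [set: 'S_n]%G {set 'I_n} := ('P^*)%act.

Lemma braid_actE (s : 'S_n) (x y : 'I_n) :
  braid_act [set x; y] s = [set s x; s y].
Proof. by rewrite /= /setact imsetU1 imset_set1. Qed.

Lemma braid_ground : [acts [set: 'S_n], on ground braid_matroid | braid_act].
Proof.
apply/subsetP=> s _; rewrite /astabs !inE /=.
by apply/subsetP=> e; rewrite !inE card_setact.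
Qed.

Lemma braid_indep (s : 'S_n) A : s \in [set: 'S_n]%G ->
  A \in indep braid_matroid -> (braid_act^*)%act A s \in indep braid_matroid.
Proof.
move=> _ /forestP[sA acA]; apply/forestP; split.
  apply/subsetP=> _ /imsetP[e eA ->]; have := subsetP sA e eA.
  by rewrite !inE card_setact.
move=> c c2 uc; apply: contra (acA (map (s^-1)%g c) _ _).
- rewrite cycle_map; apply: sub_cycle => x y.
  rewrite /adj /= => /imsetP[e eA exy].
  suff -> : [set (s^-1)%g x; (s^-1)%g y] = e by [].
  by rewrite -braid_actE exy; apply: (actK braid_act).
- by rewrite size_map.
- by rewrite map_inj_uniq //; apply: perm_inj.
Qed.

Definition braid : eqMatroid [set: 'S_n]%G {set 'I_n} :=
  EqMatroid braid_ground braid_indep.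

End Braid.

(* The Specht module V[la], for la a partition of n: the cyclic submodule of  *)
(* the regular representation generated by the Young symmetrizer of the       *)
(* tableau filled row by row with 0, ..., n - 1; the entry i lies in row      *)
(* [reshape_index la i] and column [reshape_offset la i].                     *)
Section Specht.
Variables (n : nat) (la : seq nat).

Definition row_group : {set 'S_n} :=
  [set s : 'S_n | [forall i, reshape_index la (s i) == reshape_index la i]].

Definition col_group : {set 'S_n} :=
  [set s : 'S_n | [forall i, reshape_offset la (s i) == reshape_offset la i]].

Definition young_symmetrizer : 'rV[algC]_#|[set: 'S_n]%G| :=
  \sum_(r in row_group) \sum_(c in col_group)
    (-1) ^+ odd_perm c *: delta_mx 0 (gring_index [set: 'S_n]%G (r * c)%g).

Definition specht : 'CF([set: 'S_n]%G) :=
  cfRepr (submod_repr (cyclic_mx_module (regular_repr algC [set: 'S_n]%G)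
                                        young_symmetrizer)).

End Specht.

Definition KL_braid_coef (P : kl_assignment) (n i : nat) :
  'CF([set: 'S_n]%G) := (P _ _ _ (braid n))`_i.

(* Main.v *)
(* Evaluated at a permutation g, the recursion defining the equivariant
   Kazhdan-Lusztig polynomial becomes a sum over the flats fixed by g.  By
   Brieskorn's decomposition of the Orlik-Solomon algebra and the exactness of
   its derivation, the equivariant characteristic polynomials are inverse to the
   zeta function of the poset of fixed flats; hence the polynomial
   sum_G t^(rk G - rk K) P_(M^G)(g), over the fixed flats G >= K, is palindromic
   for every fixed K, which determines the coefficients recursively.  The fixed
   flats of the braid matroid are the partitions stable under g, so the values
   only depend on the cycle type of g and can be computed.

   The character of the ideal generated by a Young symmetrizer is a common
   constituent of the permutation character of the row group and of the signed
   permutation character of the column group, and these have inner product 1.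
   A virtual character X with <X, X> = 1 and positive inner products with both
   is therefore equal to it; X is the Jacobi-Trudi combination of permutation
   characters.  The inner products are sums over cycle types, where the sizes of
   the classes are forced by the fact that each transitive permutation character
   has average 1, a triangular system. *)
From Stdlib Require Import ZArith.
From mathcomp Require Import all_boot all_order all_algebra.
From mathcomp Require Import all_fingroup all_solvable all_field all_character.
From mathcomp Require Import zify ssrZ.
Require Import Defs.

Set Implicit Arguments.
Unset Strict Implicit.
Unset Printing Implicit Defensive.

Import GroupScope GRing.Theory.
Local Open Scope ring_scope.

(** * Orlik-Solomon algebras *)

(** The Orlik-Solomon algebra is presented by words, without a basis, so it is handled through
    traces alone: a filter on words projects onto the piece of the algebra attached to a flat, and
    multiplication by a single [e_i] contracts the derivation. Up to sign, the trace of [g] on the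
    piece of a fixed flat is then a Möbius value of the poset of fixed flats, and inversion removes
    the algebra from the recursion.

    Pulling back to the cyclic group generated by [g] is what turns orbits of flats into fixed
    flats: a class function induced from a proper subgroup of a cyclic group vanishes at a
    generator.

    The numerical data are certificates. The coefficients of X and the class weights come from
    classical formulas, and the checks run by [vm_compute] verify the properties that characterise
    them: norms, inner products and averages. *)

Section QuotientTrace.
Variable F : fieldType.

(* The matrix of the map F^n1 / U1 -> F^n2 / U2 induced by A. *)
Definition quot_mx n1 n2 (U1 : 'M[F]_n1) (U2 : 'M[F]_n2) (A : 'M[F]_(n1, n2)) :=
  in_factmod U2 (val_factmod (U := U1) 1%:M *m A).

Definition quot_trace n (U A : 'M[F]_n) : F := \tr (quot_mx U U A).

(** Projecting to a quotient ([C]) and choosing representatives ([V]) are multiplications by fixed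
    matrices. The matrices are kept generic so that the statement unifies with the unfolded
    definitions. *)
Fact quot_mx_assoc k n m r l (X : 'M[F]_(k, n)) (C : 'M_(n, r)) (V : 'M_(r, n))
    (B : 'M_(n, m)) (D : 'M_(m, l)) :
  (X *m C) *m (1%:M *m V *m B *m D) = X *m C *m V *m B *m D.
Proof. by rewrite mul1mx !mulmxA. Qed.

(** Replacing a vector by its chosen representative changes it by an element of [U2], which [B]
    sends into [U3]. *)
Lemma quot_mxM n1 n2 n3 (U1 : 'M[F]_n1) (U2 : 'M[F]_n2) (U3 : 'M[F]_n3) A B :
  (U2 *m B <= U3)%MS -> quot_mx U1 U3 (A *m B) = quot_mx U1 U2 A *m quot_mx U2 U3 B.
Proof.
move=> sB; rewrite /quot_mx; set v := val_factmod 1%:M.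
have e : quot_mx U1 U2 A *m quot_mx U2 U3 B =
  in_factmod U3 (val_factmod (in_factmod U2 (v *m A)) *m B).
  exact: quot_mx_assoc.
rewrite -/(quot_mx U1 U2 A) -/(quot_mx U2 U3 B) e mulmxA.
rewrite -{1}(add_sub_fact_mod U2 (v *m A)) mulmxDl linearD /=.
suff -> : in_factmod U3 (val_submod (in_submod U2 (v *m A)) *m B) = 0 by rewrite add0r.
apply/eqP; rewrite in_factmod_eq0 (submx_trans _ sB) //.
by apply: submxMr; apply: val_submodP.
Qed.

(** The two quotients may have different dimensions: this compares traces in adjacent degrees, or on
    two presentations of one algebra. *)
Lemma quot_traceC n1 n2 (U1 : 'M[F]_n1) (U2 : 'M[F]_n2) A B :
  (U1 *m A <= U2)%MS -> (U2 *m B <= U1)%MS ->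
  quot_trace U1 (A *m B) = quot_trace U2 (B *m A).
Proof.
move=> sA sB; rewrite /quot_trace (quot_mxM U1 A sB) (quot_mxM U2 B sA).
exact: mxtrace_mulC.
Qed.

Lemma quot_traceD n (U A B : 'M[F]_n) :
  quot_trace U (A + B) = quot_trace U A + quot_trace U B.
Proof. by rewrite /quot_trace /quot_mx mulmxDr linearD linearD. Qed.

Lemma quot_trace_sum n (U : 'M[F]_n) (J : Type) (r : seq J) (P : pred J) A :
  quot_trace U (\sum_(j <- r | P j) A j) = \sum_(j <- r | P j) quot_trace U (A j).
Proof.
apply: (big_morph _ (quot_traceD U)).
by rewrite /quot_trace /quot_mx mulmx0 linear0 linear0.
Qed.

Lemma quot_trace0 n (U A : 'M[F]_n) : (A <= U)%MS -> quot_trace U A = 0.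
Proof.
move=> sA; rewrite /quot_trace /quot_mx.
suff -> : in_factmod U (val_factmod (U := U) 1%:M *m A) = 0 by rewrite mxtrace0.
by apply/eqP; rewrite in_factmod_eq0 mulmx_sub.
Qed.

Lemma quot_trace_mod n (U A B : 'M[F]_n) :
  (A - B <= U)%MS -> quot_trace U A = quot_trace U B.
Proof. by move=> s; rewrite -(subrK B A) quot_traceD quot_trace0 ?add0r. Qed.

Lemma quot_trace1 n (U : 'M[F]_n) : quot_trace U 1%:M = (n - \rank U)%:R.
Proof. by rewrite /quot_trace /quot_mx mulmx1 val_factmodK mxtrace1 mxrank_coker. Qed.

End QuotientTrace.

(** * Linear maps defined on words *)

Section Words.
Variables (I : finType) (p q : nat).
Implicit Types s u v : seq I.

Lemma word0 s : size s != p -> word p s = 0.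
Proof. by move=> h; rewrite word_size. Qed.

Lemma word_oversize_l u v : (p < size u)%N -> word p (u ++ v) = 0.
Proof.
move=> su; apply: word0; rewrite size_cat neq_ltn.
by rewrite (leq_trans su (leq_addr _ _)) orbT.
Qed.

Lemma word_oversize_r u s v : (p < size v)%N -> word p (u ++ s ++ v) = 0.
Proof.
move=> sv; apply: word0; rewrite !size_cat addnA neq_ltn.
by rewrite (leq_trans sv (leq_addl _ _)) orbT.
Qed.

Lemma words_eq k (A B : 'M[algC]_(_, k)) :
  (forall s, size s = p -> word p s *m A = word p s *m B :> 'rV__) -> A = B.
Proof.
move=> h; apply/row_matrixP=> i; have := h _ (size_tuple (enum_val i : p.-tuple I)).
by rewrite !word_tuple -!rowE enum_valK.
Qed.

Lemma words_sub k m (A : 'M[algC]_(_, k)) (S : 'M_(m, k)) :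
  (forall s, size s = p -> (word p s *m A <= S)%MS) -> (A <= S)%MS.
Proof.
move=> h; apply/row_subP=> i; have := h _ (size_tuple (enum_val i : p.-tuple I)).
by rewrite !word_tuple -!rowE enum_valK.
Qed.

Definition lift_words (f : seq I -> 'rV[algC]_(#|{: q.-tuple I}|)) :
    'M[algC]_(#|{: p.-tuple I}|, _) :=
  \matrix_i f (enum_val i : p.-tuple I).

Lemma lift_wordsE f s : size s = p -> word p s *m lift_words f = f s.
Proof.
move=> /eqP sp; rewrite -[s]/(val (Tuple sp)).
by rewrite word_tuple -rowE rowK enum_rankK.
Qed.

End Words.

(** * Generators of the Orlik-Solomon relations *)

Section Relations.
Variables (gT : finGroupType) (W : {group gT}) (I : finType) (M : eqMatroid W I).
Implicit Types (p : nat) (s u v c : seq I) (i j : I).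

(** Every map out of the algebra is shown to be well defined through these four cases, in which the
    length bounds of [os_rel] no longer appear. *)
Lemma os_rel_mul_sub p k m (B : 'M[algC]_(_, k)) (S : 'M_(m, k)) :
  (forall u v i, i \notin ground M -> (word p (u ++ i :: v) *m B <= S)%MS) ->
  (forall u v i, (word p (u ++ [:: i; i] ++ v) *m B <= S)%MS) ->
  (forall u v i j, ((word p (u ++ [:: i; j] ++ v) +
                     word p (u ++ [:: j; i] ++ v))%R *m B <= S)%MS) ->
  (forall u v c, uniq c -> [set x in c] \in circuits M ->
     (word_bd p u c v *m B <= S)%MS) ->
  (os_rel M p *m B <= S)%MS.
Proof.
move=> h1 h2 h3 h4; rewrite /os_rel sumsmxMr_gen; apply/sumsmx_subP=> u _.
rewrite genmxE sumsmxMr_gen; apply/sumsmx_subP=> v _; rewrite genmxE.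
rewrite !(addsmxMr, addsmx_sub) -!andbA; apply/and4P; split.
- rewrite sumsmxMr_gen; apply/sumsmx_subP=> i iE.
  by rewrite genmxE (eqmxMr _ (genmxE _)) h1.
- rewrite sumsmxMr_gen; apply/sumsmx_subP=> i _.
  by rewrite genmxE (eqmxMr _ (genmxE _)) h2.
- rewrite sumsmxMr_gen; apply/sumsmx_subP=> i _.
  rewrite genmxE sumsmxMr_gen; apply/sumsmx_subP=> j _.
  by rewrite genmxE (eqmxMr _ (genmxE _)) h3.
rewrite sumsmxMr_gen; apply/sumsmx_subP=> c /andP[uc cc].
by rewrite genmxE (eqmxMr _ (genmxE _)) h4.
Qed.

(** The bounds on [u] and [v] in [os_rel] cost nothing: a longer prefix or suffix gives the zero
    vector in degree [p]. The same holds for the other relations below. *)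
Lemma os_rel_ground p u v i : i \notin ground M -> (word p (u ++ i :: v) <= os_rel M p)%MS.
Proof.
move=> iE; rewrite -cat1s; have [su|su] := leqP (size u) p; last first.
  by rewrite word_oversize_l ?sub0mx.
have [sv|sv] := leqP (size v) p; last by rewrite word_oversize_r ?sub0mx.
apply: (sumsmx_sup (Bseq su)) => //; apply: (sumsmx_sup (Bseq sv)) => //.
rewrite -!addsmxA; apply: submx_trans (addsmxSl _ _).
by apply: (sumsmx_sup i) => //; rewrite genmxE.
Qed.

Lemma os_rel_sq p u v i : (word p (u ++ [:: i; i] ++ v) <= os_rel M p)%MS.
Proof.
have [su|su] := leqP (size u) p; last by rewrite word_oversize_l ?sub0mx.
have [sv|sv] := leqP (size v) p; last by rewrite word_oversize_r ?sub0mx.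
apply: (sumsmx_sup (Bseq su)) => //; apply: (sumsmx_sup (Bseq sv)) => //.
apply: submx_trans (addsmxSl _ _); apply: submx_trans (addsmxSl _ _).
apply: submx_trans (addsmxSr _ _).
by apply: (sumsmx_sup i) => //; rewrite genmxE.
Qed.

Lemma os_rel_anti p u v i j :
  ((word p (u ++ [:: i; j] ++ v) + word p (u ++ [:: j; i] ++ v))%R <= os_rel M p)%MS.
Proof.
have [su|su] := leqP (size u) p.
  have [sv|sv] := leqP (size v) p.
    apply: (sumsmx_sup (Bseq su)) => //; apply: (sumsmx_sup (Bseq sv)) => //.
    apply: submx_trans (addsmxSl _ _); apply: submx_trans (addsmxSr _ _).
    by apply: (sumsmx_sup i) => //; apply: (sumsmx_sup j) => //; rewrite genmxE.
  by rewrite !(word_oversize_r _ _ sv) addr0 sub0mx.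
by rewrite !(word_oversize_l _ su) addr0 sub0mx.
Qed.

Lemma size_bd_word u c v (k : 'I_(size c)) :
  size (u ++ take k c ++ drop k.+1 c ++ v) = (size u + (size c).-1 + size v)%N.
Proof. by rewrite !size_cat size_take size_drop ltn_ord; have := ltn_ord k; lia. Qed.

Lemma word_bd0 p u c v : (size u + (size c).-1 + size v != p)%N -> word_bd p u c v = 0.
Proof.
by move=> h; rewrite /word_bd big1 // => k _; rewrite word0 ?scaler0 ?size_bd_word.
Qed.

Lemma os_rel_circuit p u v c : uniq c -> [set x in c] \in circuits M ->
  (word_bd p u c v <= os_rel M p)%MS.
Proof.
move=> uc cc; have [sz|] := eqVneq (size u + (size c).-1 + size v)%N p; last first.
  by move/word_bd0->; rewrite sub0mx.
have su : (size u <= p)%N by rewrite -sz -addnA leq_addr.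
have sv : (size v <= p)%N by rewrite -sz leq_addl.
have sc : (size c <= p.+1)%N.
  by rewrite (leq_trans (leqSpred _)) // ltnS -sz addnAC leq_addl.
apply: (sumsmx_sup (Bseq su)) => //; apply: (sumsmx_sup (Bseq sv)) => //.
apply: submx_trans (addsmxSr _ _).
by apply: (sumsmx_sup (Bseq sc)); rewrite ?genmxE //= uc.
Qed.

End Relations.

(** * Rank, flats and circuits *)

Section Matroid.
Variables (I : finType) (M : matroid I).
Implicit Types (A B C F S T : {set I}) (i x : I).

Lemma rank_mono A B : A \subset B -> (rank M A <= rank M B)%N.
Proof.
move=> sAB; have [C [iC sC <-]] := rank_basis M A.
exact: rank_leq iC (subset_trans sC sAB).
Qed.

Lemma rank_card A : (rank M A <= #|A|)%N.
Proof. by have [C [_ sC <-]] := rank_basis M A; apply: subset_leq_card. Qed.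

Lemma indep_rankE A : (A \in indep M) = (rank M A == #|A|).
Proof.
apply/idP/eqP => [iA | eA].
  by apply/eqP; rewrite eqn_leq rank_card (rank_leq iA).
have [C [iC sC cC]] := rank_basis M A.
suff <- : C = A by []; apply/eqP.
by rewrite eqEcard sC cC eA leqnn.
Qed.

Lemma indep_rank A : A \in indep M -> rank M A = #|A|.
Proof. by rewrite indep_rankE => /eqP. Qed.

Lemma rank_aug A B : B \in indep M -> (#|B| < rank M A)%N ->
  exists x, [/\ x \in A, x \notin B & x |: B \in indep M].
Proof.
move=> iB; have [C [iC sC <-]] := rank_basis M A => ltBC.
have [x /setDP[xC xB] iBx] := indep_aug iB iC ltBC.
by exists x; split; rewrite // (subsetP sC).
Qed.

(** Extend a basis of [S] to one of [T]. If [i] raised the rank of [T], the augmenting element would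
    be [i] itself, and [i] would also be independent of the basis of [S]. *)
Lemma rank_span S T i : rank M (i |: S) = rank M S -> S \subset T ->
  rank M (i |: T) = rank M T.
Proof.
move=> eS sST; apply/eqP; rewrite eqn_leq [X in _ && X]rank_mono ?subsetUr // andbT leqNgt.
apply/negP => lt; have [B [iB sB cB]] := rank_basis M S.
have [C [iC sC cC]] := rank_basis M T.
have [|D [iD sBD sD cD]] := indep_extend iB iC; first by rewrite cB cC rank_mono.
have [|x [xT xD iDx]] := rank_aug (A := i |: T) iD; first by rewrite cD cC.
have sDT : D \subset T by rewrite (subset_trans sD) // subUset sC (subset_trans sB).
have xi : x = i.
  have [xT'|] := boolP (x \in T); last by case/setU1P: xT => // -> /negP.
  have : (#|x |: D| <= rank M T)%N by rewrite rank_leq // subUset sub1set xT'.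
  by rewrite cardsU1 xD cD cC ltnn.
have : (#|i |: B| <= rank M (i |: S))%N.
  by rewrite rank_leq ?setUS // (indep_hered iDx) // xi setUS.
rewrite eS -cB cardsU1 -xi (contra _ xD) ?ltnn //; exact: (subsetP sBD).
Qed.

Lemma flats_ground F : F \in flats M -> F \subset ground M.
Proof. by rewrite inE => /andP[]. Qed.

Lemma flat_span F S i : F \in flats M -> i \in ground M -> S \subset F ->
  rank M (i |: S) = rank M S -> i \in F.
Proof.
rewrite inE => /andP[_ /forall_inP h] iE sSF eS.
apply: contraT => iF; have := h i; rewrite inE iF iE => /(_ isT).
by rewrite (rank_span eS sSF) ltnn.
Qed.

Definition span S := [set i in ground M | rank M (i |: S) == rank M S].

Lemma sub_span S : S \subset ground M -> S \subset span S.
Proof.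
move=> sS; apply/subsetP=> i iS; rewrite inE (subsetP sS) //=.
by rewrite (setUidPr _) // sub1set.
Qed.

Lemma rank_span_eq S : S \subset ground M -> rank M (span S) = rank M S.
Proof.
move=> sS; apply/eqP; rewrite eqn_leq (rank_mono (sub_span sS)) andbT leqNgt.
have [B [iB sB cB]] := rank_basis M S.
apply/negP; rewrite -cB => /(rank_aug iB)[x [xS xB iBx]].
have /[!inE]/andP[_ /eqP ex] := xS; have : (#|x |: B| <= rank M (x |: S))%N.
  by rewrite rank_leq // setUS.
by rewrite ex cardsU1 xB cB ltnn.
Qed.

Lemma span_flat S : S \subset ground M -> span S \in flats M.
Proof.
move=> sS; rewrite inE; apply/andP; split; first by apply/subsetP=> i /[!inE]/andP[].
apply/forall_inP=> i /setDP[iE]; rewrite ltn_neqAle rank_mono ?subsetUr // andbT.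
apply: contra => /eqP e; rewrite inE iE eqn_leq (rank_mono (subsetUr _ _)) andbT.
by rewrite -(rank_span_eq sS) e rank_mono // setUS // sub_span.
Qed.

Lemma span_min S F : F \in flats M -> S \subset F -> span S \subset F.
Proof.
move=> fF sSF; apply/subsetP=> i /[!inE] /andP[iE /eqP e].
exact: flat_span fF iE sSF e.
Qed.

Lemma span_uniq S F : F \in flats M -> S \subset F -> rank M S = rank M F ->
  F = span S.
Proof.
move=> fF sSF e; apply/eqP; rewrite eqEsubset span_min // andbT.
apply/subsetP=> i iF; rewrite inE (subsetP (flats_ground fF)) //=.
rewrite eqn_leq [X in _ && X]rank_mono ?subsetUr // andbT e rank_mono //.
by rewrite subUset sub1set iF.
Qed.

(** By minimality [C :\ x] is independent while [C] is not, so both have rank one less than the size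
    of [C]. *)
Lemma circuit_rank C x : C \in circuits M -> x \in C ->
  rank M (x |: C :\ x) = rank M (C :\ x).
Proof.
rewrite inE => /andP[_ /minsetP[/= dC minC]] xC.
have iCx : C :\ x \in indep M.
  apply: contraT => d; have := minC _ d (subD1set _ _) => e.
  by move: xC; rewrite -e setD11.
apply/eqP; rewrite eqn_leq [X in _ && X]rank_mono ?subsetUr // andbT.
rewrite setD1K // (indep_rank iCx).
rewrite -ltnS; have -> : #|C :\ x|.+1 = #|C| by rewrite (cardsD1 x C) xC.
by rewrite ltn_neqAle rank_card andbT -indep_rankE.
Qed.

Lemma circuit_span C x S : C \in circuits M -> x \in C -> C :\ x \subset S ->
  rank M (x |: S) = rank M S.
Proof. by move=> cC xC; apply: rank_span; apply: circuit_rank. Qed.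

Lemma circuit_flat C x F : C \in circuits M -> F \in flats M -> x \in C ->
  C :\ x \subset F -> x \in F.
Proof.
move=> cC fF xC sC; apply: (flat_span fF _ sC); last exact: circuit_rank.
by move: cC; rewrite inE => /andP[/subsetP sE _]; apply: sE.
Qed.

Lemma dependent_circuit S : S \subset ground M -> S \notin indep M ->
  exists2 C : {set I}, C \in circuits M & C \subset S.
Proof.
move=> sS dS; have [C mC sC] := minset_exists (P := [pred A | A \notin indep M]) dS.
by exists C => //; rewrite inE (subset_trans sC sS).
Qed.

Lemma rank_loopless F : loopless M -> F \subset ground M ->
  (rank M F == 0)%N = (F == set0).
Proof.
move=> lM sF; apply/eqP/eqP => [r0|->]; last first.
  by apply/eqP; rewrite -leqn0 (leq_trans (rank_card _)) ?cards0.
apply/eqP; rewrite -subset0; apply/subsetP=> i iF.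
have := rank_leq (lM i (subsetP sF i iF)) (_ : _ \subset F).
by rewrite sub1set => /(_ iF); rewrite r0 cards1.
Qed.

End Matroid.

(** * Multiplication by a generator and the derivation *)

Section Ideal.
Variables (gT : finGroupType) (W : {group gT}) (I : finType) (M : eqMatroid W I).
Implicit Types (p : nat) (s u v c : seq I) (i j : I).

Lemma word_bd_nil p u v : word_bd p u [::] v = 0.
Proof. by rewrite /word_bd big_ord0. Qed.

Lemma word_bd_cons p u x c v :
  word_bd p u (x :: c) v = word p (u ++ c ++ v) - word_bd p (rcons u x) c v.
Proof.
rewrite /word_bd big_ord_recl expr0 scale1r /= drop0; congr (_ + _).
rewrite -sumrN; apply: eq_bigr => k _.
by rewrite -scaleN1r scalerA -exprS cat_rcons.
Qed.

(** The graded Leibniz rule. *)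
Lemma word_bd_cat p u c d v :
  word_bd p u (c ++ d) v =
    word_bd p u c (d ++ v) + (-1) ^+ size c *: word_bd p (u ++ c) d v.
Proof.
elim: c u => [|x c IHc] u /=; first by rewrite word_bd_nil add0r expr0 scale1r cats0.
rewrite !word_bd_cons IHc -catA opprD addrA; congr (_ + _).
by rewrite -scaleNr exprS mulN1r cat_rcons.
Qed.

Lemma os_rel_swap1 p u x s w :
  (word p (u ++ x :: s ++ w) <= os_rel M p)%MS ->
  (word p (u ++ s ++ x :: w) <= os_rel M p)%MS.
Proof.
elim: s u => //= y s IHs u h; rewrite -cat_rcons; apply: IHs; rewrite cat_rcons.
have := os_rel_anti M p u (s ++ w) x y => /= a.
by rewrite -[word p (u ++ y :: _)](addKr (word p (u ++ [:: x, y & s ++ w])))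
  addmx_sub ?eqmx_opp.
Qed.

Lemma os_rel_perm p s t : perm_eq s t ->
  (word p s <= os_rel M p)%MS -> (word p t <= os_rel M p)%MS.
Proof.
move: s t; apply: (catCA_perm_ind (P := fun s => (word p s <= os_rel M p)%MS)).
move=> s1 s2 s3; elim/last_ind: s1 s3 => [|s1 x IHs1] s3 //= h.
rewrite cat_rcons; apply: IHs1; apply: os_rel_swap1.
by rewrite -cat_rcons.
Qed.

Lemma os_rel_dup p s : ~~ uniq s -> (word p s <= os_rel M p)%MS.
Proof.
move=> us; have [y [t pt]] : exists y t, perm_eq [:: y, y & t] s.
  elim: s us => //= x s IHs; rewrite negb_and negbK => /orP[xs|/IHs[y [t pt]]].
    by exists x, (rem x s); rewrite perm_cons perm_sym perm_to_rem.
  exists y, (x :: t); rewrite -(perm_cons x) in pt; apply: perm_trans pt.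
  by rewrite (perm_catCA [:: y; y] [:: x] t).
apply: os_rel_perm pt _; exact: (os_rel_sq M p [::] t y).
Qed.

(** The letters of a circuit can be moved to the front, and multiplying [\partial e_C] by a letter
    of [C] gives back [e_C], because every other term repeats that letter. *)
Lemma os_rel_dep p s : (rank M [set x in s] < size s)%N ->
  (word p s <= os_rel M p)%MS.
Proof.
move=> rs; have [us|] := boolP (uniq s); last exact: os_rel_dup.
have [sE|/allPn[i iS iE]] := boolP (all [in ground M] s); last first.
  apply: (os_rel_perm (s := i :: rem i s)); first by rewrite perm_sym perm_to_rem.
  exact: (os_rel_ground p [::] _ iE).
have sS : [set x in s] \subset ground M.
  by apply/subsetP=> x; rewrite inE; apply: (allP sE).
have [|C cC sC] := dependent_circuit sS.
  by rewrite indep_rankE cardsE (card_uniqP us) ltn_eqF.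
have ps : perm_eq (enum C ++ [seq x <- s | x \notin C]) s.
  apply: perm_trans (permEl (perm_filterC (mem C) s)); rewrite perm_cat2r.
  apply: uniq_perm; rewrite ?enum_uniq ?filter_uniq // => x.
  rewrite mem_enum mem_filter /=; apply/idP/andP => [xC|[]//]; split=> //.
  by have := subsetP sC x xC; rewrite inE.
apply: os_rel_perm ps _; set v := [seq _ <- _ | _].
have : [set x in enum C] = C by apply/setP=> x; rewrite inE mem_enum.
move: (enum C) (enum_uniq C) => [|x c] uc e.
  move: cC; rewrite -e inE => /andP[_ /minsetP[/= /negP[]]].
  by rewrite (_ : [set x in [::]] = set0) ?indep_set0 //; apply/setP=> y; rewrite !inE.
have := os_rel_circuit (M := M) p [:: x] v uc; rewrite e => /(_ cC).
rewrite word_bd_cons /= => h; rewrite -[word p _](subrK (word_bd p [:: x; x] c v)).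
rewrite addmx_sub //; apply: summx_sub => k _; apply: scalemx_sub.
exact: (os_rel_sq M p [::]).
Qed.

Section Insert.
Variables (p : nat) (i : I).

Definition insert_mx : 'M[algC]_(#|{: p.-tuple I}|, #|{: p.+1.-tuple I}|) :=
  lift_words p (fun s => word p.+1 (i :: s)).

Lemma insertE s : word p s *m insert_mx = word p.+1 (i :: s).
Proof.
have [sp|sp] := eqVneq (size s) p; first by rewrite lift_wordsE.
by rewrite !word0 ?mul0mx.
Qed.

Lemma insert_bdE u c v : word_bd p u c v *m insert_mx = word_bd p.+1 (i :: u) c v.
Proof.
rewrite /word_bd mulmx_suml; apply: eq_bigr => k _.
by rewrite -scalemxAl insertE.
Qed.

Lemma os_rel_insert : (os_rel M p *m insert_mx <= os_rel M p.+1)%MS.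
Proof.
apply: os_rel_mul_sub => [u v j jE|u v j|u v j k|u v c uc cc].
- by rewrite insertE -cat_cons os_rel_ground.
- by rewrite insertE -cat_cons os_rel_sq.
- by rewrite mulmxDl !insertE -!cat_cons os_rel_anti.
by rewrite insert_bdE os_rel_circuit.
Qed.
End Insert.

Section Boundary.
Variables (p : nat).

(* Letters outside the ground set are sent to 0: they vanish in the algebra. *)
Definition bd_word s : 'rV[algC]_(#|{: p.-tuple I}|) :=
  if all [in ground M] s then word_bd p [::] s [::] else 0.

Definition bd_mx : 'M[algC]_(#|{: p.+1.-tuple I}|, #|{: p.-tuple I}|) :=
  lift_words p.+1 bd_word.

Lemma bdE s : word p.+1 s *m bd_mx = bd_word s.
Proof.
have [sp|sp] := eqVneq (size s) p.+1; first by rewrite lift_wordsE.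
rewrite word0 // mul0mx /bd_word; case: ifP => // _.
have [->|/eqP s0] := eqVneq s [::]; first by rewrite word_bd_nil.
by rewrite word_bd0 // addn0 add0n; apply: contra sp; case: (s) s0 => //= x r _ /eqP->.
Qed.

(** The derivation squares to 0: deleting two letters in either order gives opposite signs. The
    induction on [c] moves its first letter into the prefix [u]. *)
Lemma word_bd_bd u c v :
  \sum_(k < size c) (-1) ^+ k *: word_bd p u (take k c ++ drop k.+1 c) v = 0.
Proof.
elim: c u => [|x c IHc] u; first by rewrite big_ord0.
rewrite big_ord_recl /= drop0 expr0 scale1r.
under eq_bigr => k _ do rewrite /= word_bd_cons exprS mulN1r scaleNr scalerBr opprB.
rewrite sumrB (IHc (rcons u x)) sub0r; apply/eqP.
rewrite subr_eq0; apply/eqP; apply: eq_bigr => k _.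
by rewrite -catA.
Qed.

Lemma word_bd_sub u c v m (S : 'M_(m, _)) :
  (forall k, (word p (u ++ take k c ++ drop k.+1 c ++ v) <= S)%MS) ->
  (word_bd p u c v <= S)%MS.
Proof. by move=> h; apply: summx_sub => k _; apply: scalemx_sub. Qed.

(** On [u (\partial e_c) v] the Leibniz rule gives three parts: two still contain [\partial e_c],
    and the third contains the boundary of a boundary. On the quadratic relations the terms that
    delete one of the two middle letters cancel. *)
Lemma os_rel_bd : (os_rel M p.+1 *m bd_mx <= os_rel M p)%MS.
Proof.
apply: os_rel_mul_sub => [u v i iE|u v i|u v i j|u v c uc cc].
- by rewrite bdE /bd_word all_cat /= (negPf iE) andbF sub0mx.
- rewrite bdE /bd_word; case: ifP => _; last exact: sub0mx.
  rewrite 2!word_bd_cat !cat0s !cats0; apply: addmx_sub.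
    by apply: word_bd_sub => k; rewrite cat0s catA os_rel_sq.
  apply/scalemx_sub/addmx_sub; last first.
    by apply/scalemx_sub/word_bd_sub => k; rewrite -catA os_rel_sq.
  rewrite !word_bd_cons word_bd_nil subr0 -cats1 -!catA /=.
  by rewrite subrr sub0mx.
- rewrite mulmxDl !bdE /bd_word.
  have -> : all [in ground M] (u ++ [:: j; i] ++ v) = all [in ground M] (u ++ [:: i; j] ++ v).
    by rewrite !all_cat /= !andbT [(j \in _) && _]andbC.
  case: ifP => _; last by rewrite addr0 sub0mx.
  rewrite !word_bd_cat !cat0s !cats0 !scalerDr (addrACA (word_bd _ _ u _)).
  rewrite (addrACA (_ *: word_bd _ u _ _)) -!scalerDr.
  apply: addmx_sub; [|apply/scalemx_sub/addmx_sub].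
  + rewrite /word_bd -big_split; apply: summx_sub => k _ /=; rewrite -scalerDr.
    by apply: scalemx_sub; rewrite !(catA (take k u)) os_rel_anti.
  + rewrite !word_bd_cons !word_bd_nil !subr0 -!cats1 -!catA /=.
    by rewrite addrC addrA subrK subrr sub0mx.
  apply: scalemx_sub.
  rewrite /word_bd -big_split; apply: summx_sub => k _ /=; rewrite -scalerDr.
  by apply: scalemx_sub; rewrite -!catA os_rel_anti.
rewrite {1}/word_bd mulmx_suml; under eq_bigr => k _ do rewrite -scalemxAl bdE.
(* A letter of [u] or [v] outside the ground set survives in every term, and [bd_word] kills such
   words. *)
have [uvE|uvE] := boolP (all [in ground M] (u ++ v)); last first.
  rewrite big1 ?sub0mx // => k _; rewrite /bd_word ifN ?scaler0 //.
  by apply: contra uvE; rewrite !all_cat => /and4P[-> _ _ ->].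
have cE : all [in ground M] c.
  apply/allP=> x xc; move: cc; rewrite inE => /andP[/subsetP sc _].
  by apply: sc; rewrite inE.
have delE k : all [in ground M] (u ++ take k c ++ drop k.+1 c ++ v).
  move: uvE; rewrite !all_cat => /andP[-> ->]; rewrite andbT /=.
  by apply/andP; split; apply/allP=> x; [move/mem_take | move/mem_drop]; apply: (allP cE).
have -> : \sum_(k < size c) (-1) ^+ k *:
      bd_word (u ++ take k c ++ drop k.+1 c ++ v) =
    \sum_(k < size c) (-1) ^+ k *: word_bd p [::] u (take k c ++ drop k.+1 c ++ v) +
    ((-1) ^+ size u *: \sum_(k < size c) (-1) ^+ k *:
        word_bd p u (take k c ++ drop k.+1 c) v +
     (-1) ^+ size u *: \sum_(k < size c) (-1) ^+ k *: ((-1) ^+ (size c).-1 *: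
        word_bd p (u ++ take k c ++ drop k.+1 c) v [::])).
  rewrite !scaler_sumr -!big_split; apply: eq_bigr => k _ /=.
  rewrite /bd_word delE word_bd_cat [in LHS](catA (take k c)) word_bd_cat.
  rewrite cat0s !cats0 -catA (_ : size (_ ++ _) = (size c).-1).
    by rewrite !scalerDr !scalerA !(mulrC ((-1) ^+ size u) ((-1) ^+ k)).
  by have := size_bd_word [::] [::] k; rewrite !cats0 addn0 add0n.
rewrite word_bd_bd scaler0 add0r; apply: addmx_sub; last apply: scalemx_sub.
  under eq_bigr => k _ do rewrite /word_bd scaler_sumr.
  rewrite exchange_big; apply: summx_sub => j _ /=.
  suff -> : \sum_(k < size c) (-1) ^+ k *: ((-1) ^+ j *: word p
     (take j u ++ drop j.+1 u ++ take k c ++ drop k.+1 c ++ v)) =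
     (-1) ^+ j *: word_bd p (take j u ++ drop j.+1 u) c v.
    by rewrite scalemx_sub ?os_rel_circuit.
  rewrite scaler_sumr; apply: eq_bigr => k _.
  by rewrite !scalerA mulrC -catA.
under eq_bigr => k _ do rewrite /word_bd !scaler_sumr.
rewrite exchange_big; apply: summx_sub => j _ /=.
set d := (-1) ^+ (size c).-1.
suff -> : \sum_(k < size c) (-1) ^+ k *: (d *: ((-1) ^+ j *: word p
   ((u ++ take k c ++ drop k.+1 c) ++ take j v ++ drop j.+1 v ++ [::]))) =
   d *: ((-1) ^+ j *: word_bd p u c (take j v ++ drop j.+1 v)).
  by rewrite !scalemx_sub ?os_rel_circuit.
rewrite !scaler_sumr; apply: eq_bigr => k _.
by rewrite cats0 -!catA !scalerA -mulrA mulrC.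
Qed.

End Boundary.
End Ideal.

(** * Acyclicity of the derivation *)

Section Trace.
Variables (gT : finGroupType) (W : {group gT}) (I : finType) (M : eqMatroid W I).
Variables (g : gT).
Hypothesis Wg : g \in W.
Implicit Types (p : nat) (s u v c : seq I) (i j : I).

Lemma OS_trace p : OS M p g = quot_trace (os_rel M p) (word_mx M p g).
Proof. by rewrite /OS cfunE Wg mulr1n. Qed.

Lemma os_rel_act p : (os_rel M p *m word_mx M p g <= os_rel M p)%MS.
Proof. exact: (mxmoduleP (os_rel_module M p)). Qed.

Lemma act_ground i : (em_act M i g \in ground M) = (i \in ground M).
Proof. exact: (astabs_act i (subsetP (em_ground M) g Wg)). Qed.

Lemma all_act_ground s :
  all [in ground M] [seq em_act M x g | x <- s] = all [in ground M] s.
Proof. by rewrite all_map; apply: eq_all => i; apply: act_ground. Qed.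

Lemma bd_mx_act p :
  bd_mx M p *m word_mx M p g = word_mx M p.+1 g *m bd_mx M p.
Proof.
apply: (@words_eq I p.+1) => s _; rewrite !mulmxA word_act !bdE /bd_word all_act_ground.
by case: ifP => _; rewrite ?mul0mx // word_bd_act.
Qed.

Lemma os_rel_full p : (rk M < p)%N -> (1%:M <= os_rel M p)%MS.
Proof.
move=> rp; apply: (@words_sub I p) => s sp; rewrite mulmx1.
have [sE|] := boolP (all [in ground M] s); last first.
  by case/allPn=> i /splitPr[u v] iE; apply: os_rel_ground.
apply: os_rel_dep; rewrite sp (leq_ltn_trans _ rp) //; apply: rank_mono.
by apply/subsetP=> x; rewrite inE; apply: (allP sE).
Qed.

Section Homotopy.
Variable i : I.
Hypothesis iE : i \in ground M.

Lemma homotopy0 : insert_mx 0 i *m bd_mx M 0 = 1%:M.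
Proof.
apply: (@words_eq I 0) => s /size0nil->; rewrite mulmxA insertE bdE mulmx1.
by rewrite /bd_word /= iE word_bd_cons word_bd_nil subr0.
Qed.

(** The Leibniz rule with [\partial e_i = 1]. It holds only modulo the relations, since [bd_word] is
    0 on words with a letter outside the ground set. *)
Lemma homotopyS p :
  (((1%:M - (insert_mx p.+1 i *m bd_mx M p.+1 + bd_mx M p *m insert_mx p i)))%R
     <= os_rel M p.+1)%MS.
Proof.
apply: (@words_sub I p.+1) => s sp; rewrite mulmxBr mulmxDr mulmx1 !mulmxA.
rewrite insertE !bdE /bd_word /= iE /=; case: ifP => sE.
  by rewrite word_bd_cons insert_bdE cats0 subrK subrr sub0mx.
rewrite mul0mx addr0 subr0; move/allPn: (negbT sE) => [j /splitPr[u v] jE].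
exact: os_rel_ground.
Qed.

(* Multiplication by e_i is a contracting homotopy for the derivation, so the
   alternating sum of the traces telescopes. *)
Lemma OS_alternating : \sum_(p < (rk M).+1) (-1) ^+ p * OS M p g = 0.
Proof.
pose G p := word_mx M p g; pose R p := os_rel M p.
pose y p := quot_trace (R p) (insert_mx p i *m bd_mx M p *m G p).
pose z p := quot_trace (R p.+1) (bd_mx M p *m insert_mx p i *m G p.+1).
have DR p : (R p.+1 *m bd_mx M p <= R p)%MS by apply: os_rel_bd.
have ER p : (R p *m insert_mx p i <= R p.+1)%MS by apply: os_rel_insert.
have GR p : (R p *m G p <= R p)%MS by apply: os_rel_act.
(* Multiplication by [e_i] need not commute with [g], which may move [i]. Cycling the trace twice
   means that only the derivation has to be commuted past [g]. *)
have yz p : y p = z p.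
  rewrite /y /z -mulmxA [LHS](quot_traceC (ER p)); last first.
    by rewrite mulmxA (submx_trans (submxMr _ (DR p)) (GR p)).
  rewrite bd_mx_act -(mulmxA (word_mx M p.+1 g)) [LHS](quot_traceC (GR p.+1)) //.
  by rewrite mulmxA (submx_trans (submxMr _ (DR p)) (ER p)).
have t0 : OS M 0 g = y 0 by rewrite OS_trace /y homotopy0 mul1mx.
have tS p : OS M p.+1 g = y p.+1 + z p.
  rewrite OS_trace -quot_traceD -mulmxDl; apply: quot_trace_mod.
  rewrite -{1}[word_mx M p.+1 g]mul1mx -mulmxBl.
  exact: submx_trans (submxMr _ (homotopyS p)) (GR p.+1).
(* The leftover [y (rk M)] equals [z (rk M)], a trace in degree [(rk M).+1], where the algebra is
   0. *)
suff -> n : \sum_(p < n.+1) (-1) ^+ p * OS M p g = (-1) ^+ n * y n.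
  rewrite yz /z (_ : quot_trace _ _ = 0) ?mulr0 //.
  by apply: quot_trace0; rewrite (submx_trans (submx1 _)) // os_rel_full.
elim: n => [|n IHn]; first by rewrite big_ord1 t0.
by rewrite big_ord_recr /= IHn tS -yz exprS mulrDr mulN1r !mulNr addrCA subrr addr0.
Qed.

End Homotopy.
End Trace.

(** * Projections onto selected words *)

Section Filter.
Variables (I : finType) (p : nat).
Implicit Types (P Q : pred (seq I)).

Definition filter_mx P : 'M[algC]_(#|{: p.-tuple I}|) :=
  lift_words p (fun s => (P s)%:R *: word p s).

Lemma filterE P s : word p s *m filter_mx P = (P s)%:R *: word p s.
Proof.
have [sp|sp] := eqVneq (size s) p; first by rewrite lift_wordsE.
by rewrite !word0 ?mul0mx ?scaler0.
Qed.

Lemma filterM P Q : filter_mx P *m filter_mx Q = filter_mx (predI P Q).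
Proof.
apply: (@words_eq I p) => s _; rewrite mulmxA !filterE -scalemxAl filterE scalerA.
by rewrite -natrM mulnb.
Qed.

Lemma eq_filter_mx P Q : P =1 Q -> filter_mx P = filter_mx Q.
Proof. by move=> e; apply: (@words_eq I p) => s _; rewrite !filterE e. Qed.

Lemma filterK P : filter_mx P *m filter_mx P = filter_mx P.
Proof. by rewrite filterM; apply: eq_filter_mx => s /=; rewrite andbb. Qed.

Lemma filter_bd P u c v b :
  (forall k : 'I_(size c), P (u ++ take k c ++ drop k.+1 c ++ v) = b) ->
  word_bd p u c v *m filter_mx P = b%:R *: word_bd p u c v.
Proof.
move=> h; rewrite /word_bd mulmx_suml scaler_sumr; apply: eq_bigr => k _.
by rewrite -scalemxAl filterE h !scalerA mulrC.
Qed.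

End Filter.

(** * Brieskorn decomposition by flats *)

Section Brieskorn.
Variables (gT : finGroupType) (W : {group gT}) (I : finType) (M : eqMatroid W I).
Variables (g : gT).
Hypothesis Wg : g \in W.
Implicit Types (p : nat) (s u v c : seq I) (i j : I) (A Y F : {set I}).
Implicit Types (Q : pred {set I}).

Definition set_filter p Q := filter_mx p (fun s => Q [set x in s]).

(** Each word in [u (\partial e_c) v] lacks one letter of the circuit; a stable [Q] cannot tell
    these words apart, so its filter preserves the relations. *)
Definition circuit_stable Q := forall C A x, C \in circuits M -> x \in C ->
  C :\ x \subset A -> Q (x |: A) = Q A.

Lemma filter_circuit p Q u c v : circuit_stable Q -> uniq c ->
  [set x in c] \in circuits M ->
  word_bd p u c v *m set_filter p Q =
    (Q [set x in u ++ c ++ v])%:R *: word_bd p u c v.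
Proof.
move=> cQ uc cc; apply: filter_bd => k; set x := tnth (in_tuple c) k.
have xc : x \in c by apply: mem_tnth.
have ec : c = take k c ++ x :: drop k.+1 c.
  rewrite -[LHS](cat_take_drop k) (drop_nth x) //; congr (_ ++ _ :: _).
  by rewrite [in RHS]/x (tnth_nth x).
rewrite -(cQ _ _ x cc) ?[x \in [set _ in _]]inE //; last first.
  apply/subsetP=> y; rewrite !inE => /andP[yx yc]; rewrite ec in yc.
  by move: yc; rewrite !mem_cat inE (negPf yx) /= => /orP[]->; rewrite !orbT.
congr (Q _); apply/setP=> y; rewrite !inE !mem_cat [in RHS]ec mem_cat inE.
by rewrite -!orbA; case: (y == x); rewrite /= ?orbT.
Qed.

Lemma set_swap u v i j :
  [set x in u ++ [:: j; i] ++ v] = [set x in u ++ [:: i; j] ++ v].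
Proof.
by apply/setP=> x; rewrite !inE !mem_cat !inE; case: (x == i); rewrite /= ?orbT ?orbF.
Qed.

Lemma set_filter_rel p Q : circuit_stable Q ->
  (os_rel M p *m set_filter p Q <= os_rel M p)%MS.
Proof.
move=> cQ; apply: os_rel_mul_sub => [u v i iE|u v i|u v i j|u v c uc cc].
- by rewrite filterE scalemx_sub ?os_rel_ground.
- by rewrite filterE scalemx_sub ?os_rel_sq.
- rewrite mulmxDl !filterE (set_swap u v i j).
  by rewrite -scalerDr scalemx_sub ?os_rel_anti.
by rewrite filter_circuit // scalemx_sub // os_rel_circuit.
Qed.

Lemma act_word_set s : [set x in [seq em_act M x g | x <- s]] =
  (em_act M)^*%act [set x in s] g.
Proof.
apply/setP=> x; rewrite inE; apply/mapP/imsetP => -[y ys ->]; exists y => //.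
  by rewrite inE.
by rewrite inE in ys.
Qed.

Definition spanning Y A := (A \subset Y) && (rank M A == rank M Y).

Lemma spanning_stable Y : Y \in flats M -> circuit_stable (spanning Y).
Proof.
move=> fY C A x cC xC sC; rewrite /spanning (circuit_span cC xC sC).
rewrite subUset sub1set; case: (boolP (A \subset Y)) => [sA|]; rewrite ?andbF //=.
by rewrite (circuit_flat cC fY xC) //; apply: subset_trans sA.
Qed.

Lemma subset_stable F : F \in flats M -> circuit_stable (fun A => A \subset F).
Proof.
move=> fF C A x cC xC sC; rewrite subUset sub1set.
case: (boolP (A \subset F)) => [sA|]; rewrite ?andbF // andbT.
by rewrite (circuit_flat cC fF xC) //; apply: subset_trans sA.
Qed.

(** The contribution to the trace of [g] of the words whose letters span [Y], the piece of the
    algebra attached to [Y]. *)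
Definition flat_trace p Y :=
  quot_trace (os_rel M p) (set_filter p (spanning Y) *m word_mx M p g).

Lemma set_act_flat Y : Y \in flats M -> (em_act M)^*%act Y g \in flats M.
Proof.
rewrite !inE => /andP[sY /forall_inP rY].
have Vg : g^-1%g \in W by rewrite groupV.
rewrite -{1}(ground_act M Wg) /setact imsetS //=.
apply/forall_inP=> i /setDP[iE iY].
have [j ej] : exists j, i = em_act M j g.
  by exists (em_act M i g^-1%g); rewrite actKVin.
have -> : i |: (em_act M)^*%act Y g = (em_act M)^*%act (j |: Y) g.
  by rewrite /= /setact imsetU1 ej.
rewrite !rank_act // rY // inE; move: iE iY; rewrite ej act_ground // => ->.
by rewrite andbT; apply: contra => jY; apply: imset_f.
Qed.

(** A word spanning [Y] has at least as many letters as the rank of [Y], and with more it is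
    dependent, hence 0. *)
Lemma flat_trace_rank p Y : Y \in flats M -> rank M Y != p -> flat_trace p Y = 0.
Proof.
move=> fY rY; apply: quot_trace0; apply: submx_trans (os_rel_act M Wg p).
apply: submxMr; apply: (@words_sub I p) => s sp; rewrite filterE.
case: (boolP (spanning _ _)) => [/andP[_ /eqP e]|_]; last by rewrite scale0r sub0mx.
rewrite scale1r os_rel_dep // ltn_neqAle sp e rY -e -sp.
by rewrite (leq_trans (rank_card _ _)) // cardsE card_size.
Qed.

(** Doubling the idempotent filter and cycling the trace puts one copy on each side of [g]. A word
    passing both would span [Y] and have an image spanning [Y], forcing [g] to fix [Y]. *)
Lemma flat_trace_moved p Y : Y \in flats M ->
  (em_act M)^*%act Y g != Y -> flat_trace p Y = 0.
Proof.
move=> fY nY; have sR := set_filter_rel p (spanning_stable fY).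
rewrite /flat_trace /set_filter -filterK -mulmxA [LHS](quot_traceC sR); last first.
  by rewrite mulmxA (submx_trans (submxMr _ sR)) // os_rel_act.
rewrite quot_trace0 //; apply: (@words_sub I p) => s _.
rewrite !mulmxA filterE -!scalemxAl word_act filterE act_word_set.
case: (boolP (spanning Y [set x in s])) => [/andP[sY /eqP rY]|_]; last first.
  by rewrite scale0r sub0mx.
case: (boolP (spanning Y _)) => [/andP[sY' /eqP rY']|_]; last first.
  by rewrite scale0r scaler0 sub0mx.
case/eqP: nY; rewrite [RHS](span_uniq fY sY' rY').
apply: span_uniq; rewrite ?set_act_flat // ?rank_act //.
by rewrite /setact imsetS.
Qed.

Lemma circuit_restr F A :
  (A \in circuits (restr M F)) = (A \in circuits M) && (A \subset F).
Proof.
rewrite !inE /= subsetI -!andbA; congr (_ && _).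
have indepE (B : {set I}) : B \subset F -> (B \notin restr_indep M F) = (B \notin indep M).
  by move=> sB; rewrite inE sB andbT.
apply/andP/andP => [[sA /minsetP[/= dA mA]]|[/minsetP[/= dA mA] sA]]; split=> //.
  apply/minsetP; split=> [|B /= dB sBA]; first by rewrite /= -indepE.
  by apply: mA => //=; rewrite indepE // (subset_trans sBA).
apply/minsetP; split=> [|B /= dB sBA]; first by rewrite /= indepE.
by apply: mA => //=; rewrite -indepE // (subset_trans sBA).
Qed.

(** The filter on words in [F] maps the relations of [M] and those of the restriction into each
    other, which embeds the algebra of the restriction as a summand. That summand splits by the flat
    a word spans, and only fixed flats of rank [p] have a nonzero trace. *)
Lemma brieskorn F p : F \in flats M -> g \in flat_stab M F ->
  OS (eqRestr M F) p g =
  \sum_(Y in flats M | [&& Y \subset F, (em_act M)^*%act Y g == Y & rank M Y == p])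
    flat_trace p Y.
Proof.
move=> fF Fg; rewrite OS_trace //.
set G := word_mx M p g; have -> : word_mx (eqRestr M F) p g = G by [].
pose R := os_rel M p; pose RF := os_rel (eqRestr M F) p.
pose PF := set_filter p (fun A => A \subset F).
have GR : (R *m G <= R)%MS by apply: os_rel_act.
have GRF : (RF *m G <= RF)%MS by apply: os_rel_act.
have groundE : ground (eqRestr M F) = F by apply/setIidPr/flats_ground.
(* A circuit relation either survives whole, with its circuit inside [F], or disappears whole. *)
have PFR : (R *m PF <= RF)%MS.
  apply: os_rel_mul_sub => [u v i iE|u v i|u v i j|u v c uc cc].
  - by rewrite filterE scalemx_sub // os_rel_ground //= inE (negPf iE).
  - by rewrite filterE scalemx_sub ?os_rel_sq.
  - rewrite mulmxDl !filterE (set_swap u v i j).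
    by rewrite -scalerDr scalemx_sub ?os_rel_anti.
  rewrite filter_circuit //; last exact: subset_stable.
  case: (boolP (_ \subset F)) => [/subsetP s|_]; last by rewrite scale0r sub0mx.
  rewrite scale1r os_rel_circuit //.
  rewrite circuit_restr cc; apply/subsetP=> x.
  by rewrite inE => xc; apply: s; rewrite inE !mem_cat xc orbT.
have PRF : (RF *m PF <= R)%MS.
  apply: os_rel_mul_sub => [u v i iE|u v i|u v i j|u v c uc].
  - rewrite filterE; case: (boolP (_ \subset F)) => [/subsetP s|_]; last first.
      by rewrite scale0r sub0mx.
    rewrite scale1r os_rel_ground //; move: iE; rewrite groundE.
    by rewrite s // inE mem_cat mem_head orbT.
  - by rewrite filterE scalemx_sub ?os_rel_sq.
  - by rewrite mulmxDl !filterE (set_swap u v i j) -scalerDr scalemx_sub ?os_rel_anti.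
  rewrite circuit_restr => /andP[cc _].
  by rewrite filter_circuit ?scalemx_sub ?os_rel_circuit //; apply: subset_stable.
have eF : (em_act M)^*%act F g = F by apply: flat_actF.
have -> : quot_trace RF G = quot_trace RF (PF *m G).
  apply: quot_trace_mod; rewrite -{1}[G]mul1mx -mulmxBl.
  apply: submx_trans GRF; apply: submxMr; apply: (@words_sub I p) => s _.
  rewrite mulmxBr mulmx1 filterE; case: (boolP (_ \subset F)) => [_|].
    by rewrite scale1r subrr sub0mx.
  case/subsetPn=> x; rewrite inE scale0r subr0 => /splitPr[u v] xF.
  by rewrite os_rel_ground // groundE.
rewrite -[PF]filterK -mulmxA (quot_traceC PRF); last first.
  by rewrite mulmxA (submx_trans (submxMr _ PFR)).
have -> : PF *m G *m PF = PF *m G.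
  apply: (@words_eq I p) => s _; rewrite !mulmxA filterE -!scalemxAl word_act filterE.
  rewrite act_word_set; case: (boolP (_ \subset F)) => [sF|_]; last by rewrite !scale0r.
  by rewrite -eF /setact imsetS // !scale1r.
(* A word in the ground set spans exactly one flat, so the filters of the flats below [F] add up to
   the filter of [F]. *)
have -> : quot_trace R (PF *m G) =
    \sum_(Y in flats M | Y \subset F) flat_trace p Y.
  rewrite -quot_trace_sum -mulmx_suml; apply: quot_trace_mod; rewrite -mulmxBl.
  apply: submx_trans GR; apply: submxMr; apply: (@words_sub I p) => s _.
  rewrite mulmxBr mulmx_sumr filterE; under eq_bigr do rewrite filterE.
  rewrite -scaler_suml -scalerBl -natr_sum; set n := (\sum_(_ | _) _)%N.
  have [sE|] := boolP (all [in ground M] s); last first.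
    by case/allPn=> i /splitPr[u v] iE; rewrite scalemx_sub // os_rel_ground.
  suff -> : n = nat_of_bool ([set x in s] \subset F) by rewrite subrr scale0r sub0mx.
  have sS : [set x in s] \subset ground M.
    by apply/subsetP=> x; rewrite inE; apply: (allP sE).
  rewrite /n; case: (boolP (_ \subset F)) => [sF|nF]; last first.
    rewrite big1 // => Y /andP[_ YF]; case: (boolP (spanning _ _)) => // /andP[sY _].
    by case/negP: nF; apply: subset_trans YF.
  rewrite (bigD1 (span M [set x in s])) ?span_flat ?span_min //=.
  rewrite /spanning sub_span // rank_span_eq // eqxx big1 // => Y /andP[/andP[fY _]].
  by case: (boolP (_ && _)) => // /andP[sY /eqP /(span_uniq fY sY) <-]; rewrite eqxx.
apply/esym; rewrite [RHS](bigID (fun Y => ((em_act M)^*%act Y g == Y) && (rank M Y == p))) /=.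
rewrite [X in _ = _ + X]big1 ?addr0; last first.
  move=> Y /andP[/andP[fY _]]; rewrite negb_and => /orP[]; first exact: flat_trace_moved.
  exact: flat_trace_rank.
by apply: eq_bigl => Y; rewrite !andbA.
Qed.

End Brieskorn.

(** * Kazhdan-Lusztig polynomials at a group element *)

Section EvalPoly.
Variables (gT : finGroupType) (W : {group gT}).
Implicit Types p q : {poly 'CF(W)}.

Definition poly_at (g : gT) p : {poly algC} := map_poly (fun chi : 'CF(W) => chi g) p.

Lemma coef_poly_at g p i : (poly_at g p)`_i = p`_i g.
Proof. by rewrite coef_map_id0 ?cfunE. Qed.

Lemma poly_atM g p q : g \in W -> poly_at g (p * q) = poly_at g p * poly_at g q.
Proof.
move=> Wg; apply/polyP=> i; rewrite coef_poly_at !coefM sum_cfunE.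
by apply: eq_bigr => j _; rewrite cfunE !coef_poly_at.
Qed.

Lemma poly_at_sum g (J : Type) (r : seq J) (P : pred J) (F : J -> {poly 'CF(W)}) :
  poly_at g (\sum_(j <- r | P j) F j) = \sum_(j <- r | P j) poly_at g (F j).
Proof.
by apply/polyP=> i; rewrite coef_poly_at !coef_sum sum_cfunE; apply: eq_bigr => j _; rewrite coef_poly_at.
Qed.

End EvalPoly.

(** * Characteristic polynomials and Möbius values *)

Section CharPoly.
Variables (gT : finGroupType) (W : {group gT}) (I : finType) (M : eqMatroid W I).
Variable g : gT.
Hypotheses (Wg : g \in W) (lM : loopless M).
Implicit Types F Y : {set I}.

Definition fixed_flats : {set {set I}} :=
  [set F in flats M | (em_act M)^*%act F g == F].

Lemma fixed_flatsP F : reflect (F \in flats M /\ (em_act M)^*%act F g = F)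
  (F \in fixed_flats).
Proof. by rewrite [F \in fixed_flats]in_set; apply: (iffP andP) => -[? /eqP]. Qed.

Lemma fixed_flat_stab F : F \in fixed_flats -> g \in flat_stab M F.
Proof.
case/fixed_flatsP=> _ eF; rewrite inE Wg /= !inE Wg /=.
by apply/subsetP=> x xF; rewrite inE -eF mem_setact.
Qed.

Lemma rk_restr F : F \subset ground M -> rk (eqRestr M F) = rank M F.
Proof.
move=> sF; rewrite /rk /rank /= (setIidPr sF).
by apply: eq_bigl => A; rewrite inE -andbA andbb.
Qed.

Lemma loopless_restr F : loopless (eqRestr M F).
Proof.
by move=> i; rewrite !inE /= sub1set => /andP[iE iF]; rewrite lM.
Qed.

(** By [mobius_sum], on fixed flats this is the Möbius function from the empty flat to [Y] in the
    poset of flats fixed by [g]. *)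
Definition mobius Y : algC := (-1) ^+ rank M Y * flat_trace M g (rank M Y) Y.

Lemma OS_restr F p : F \in fixed_flats ->
  (-1) ^+ p * OS (eqRestr M F) p g =
    \sum_(Y in fixed_flats | (Y \subset F) && (rank M Y == p)) mobius Y.
Proof.
move=> fF; have [F1 _] := fixed_flatsP _ fF.
rewrite (brieskorn Wg p F1 (fixed_flat_stab fF)) mulr_sumr.
apply: eq_big => [Y|Y /andP[_ /and3P[_ _ /eqP <-]] //].
rewrite [Y \in fixed_flats]in_set; case: (Y \in flats M) => //=.
by rewrite andbCA.
Qed.

(** Grouped by rank, the sum is the alternating sum of traces on the algebra of the restriction to
    [F]. Any element of [F] provides a contracting homotopy; for empty [F] the algebra has dimension
    1. *)
Lemma mobius_sum F : F \in fixed_flats ->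
  \sum_(Y in fixed_flats | Y \subset F) mobius Y = (F == set0)%:R.
Proof.
move=> fF; have [fF1 eF] := fixed_flatsP _ fF; have sF := flats_ground fF1.
have <- : \sum_(p < (rk (eqRestr M F)).+1) (-1) ^+ p * OS (eqRestr M F) p g = (F == set0)%:R.
  have [F0|nF0] := eqVneq F set0; last first.
    case/set0Pn: nF0 => i iF; apply: (@OS_alternating _ _ _ (eqRestr M F) g _ i).
      exact: fixed_flat_stab.
    by rewrite !inE iF (subsetP sF).
  rewrite rk_restr // (_ : rank M F = 0%N); last first.
    by apply/eqP; rewrite rank_loopless // F0.
  rewrite big_ord1 expr0 mul1r OS_trace ?fixed_flat_stab //.
  have -> : word_mx (eqRestr M F) 0 g = 1%:M.
    by apply: (@words_eq I 0) => s /size0nil ->; rewrite mulmx1 word_act.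
  rewrite quot_trace1 (_ : os_rel _ 0 = 0) ?mxrank0 ?card_tuple ?expn0 //.
  apply/eqP; rewrite -submx0 -[os_rel _ 0]mulmx1.
  apply: os_rel_mul_sub => [u v i _|u v i|u v i j|u v c _ cc].
  - by rewrite word0 ?mul0mx ?sub0mx // size_cat addnS.
  - by rewrite word0 ?mul0mx ?sub0mx //; case: (u).
  - by rewrite !word0 ?addr0 ?mul0mx ?sub0mx //; case: (u).
  have [e|] := eqVneq (size u + (size c).-1 + size v)%N 0%N; last first.
    by move/word_bd0->; rewrite mul0mx sub0mx.
  move: cc; rewrite inE => /andP[/subsetP sc /minsetP[/= /negP[]]].
  case: c sc e => [|x [|y c]] sc e; last by move: e; rewrite /= addnS.
    have -> : [set x in [::]] = set0 :> {set I} by apply/setP=> y; rewrite !inE.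
    exact: (indep_set0 (eqRestr M F)).
  have -> : [set y in [:: x]] = [set x] by apply/setP=> y; rewrite !inE.
  by apply: (@loopless_restr F); apply: sc; rewrite !inE.
apply: esym; under eq_bigr => p _ do rewrite OS_restr //.
rewrite (exchange_big_dep (fun Y => (Y \in fixed_flats) && (Y \subset F))) /=; last first.
  by move=> p Y _ /and3P[-> ->].
apply: eq_bigr => Y /andP[fY sYF].
rewrite (eq_bigl (fun p : 'I__ => p == inord (rank M Y))) ?big_pred1_eq // => p.
rewrite fY sYF -val_eqE /= inordK //.
by rewrite ltnS rk_restr // rank_mono.
Qed.

Lemma char_poly_restr F : F \in fixed_flats ->
  poly_at g (eq_char_poly (eqRestr M F)) =
    \sum_(Y in fixed_flats | Y \subset F) mobius Y *: 'X^(rank M F - rank M Y).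
Proof.
move=> fF; have [fF1 eF] := fixed_flatsP _ fF; have sF := flats_ground fF1.
rewrite /eq_char_poly poly_at_sum.
have at_monomial p (chi : 'CF(flat_stab M F)) k : poly_at g ((-1) ^+ p *: chi *: 'X^k) =
    ((-1) ^+ p * chi g) *: 'X^k.
  by apply/polyP=> i; rewrite coef_poly_at !coefZ !coefXn; case: (i == k); rewrite ?(mulr0, mulr1) cfunE.
under eq_bigr => p _ do rewrite at_monomial OS_restr // scaler_suml.
rewrite (exchange_big_dep (fun Y => (Y \in fixed_flats) && (Y \subset F))) /=; last first.
  by move=> p Y _ /and3P[-> ->].
apply: eq_bigr => Y /andP[fY sYF].
rewrite (eq_bigl (fun p : 'I__ => p == inord (rank M Y))) => [|p].
  by rewrite big_pred1_eq rk_restr // inordK // ltnS rank_mono.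
by rewrite fY sYF -val_eqE /= inordK // ltnS rk_restr // rank_mono.
Qed.

End CharPoly.

(** * Rank and flats of contractions *)

Section Contraction.
Variables (I : finType) (M : matroid I).
Implicit Types (A B K F G : {set I}).

Lemma setDKU K G : K \subset G -> (G :\: K) :|: K = G.
Proof.
move=> sKG; apply/setP=> x; rewrite !inE.
by case: (boolP (x \in K)) => [/(subsetP sKG)->|] //=; rewrite orbF.
Qed.

Lemma rank_contr K A : A \subset ground M :\: K ->
  (rank (contr M K) A + rank M K)%N = rank M (A :|: K).
Proof.
move=> sA; apply/eqP; rewrite eqn_leq; apply/andP; split.
  have [B [/[!inE]/andP[sB /eqP rB] sBA <-]] := rank_basis (contr M K) A.
  by rewrite -rB rank_mono // setSU.
have [C [iC sC cC]] := rank_basis M K; have [D0 [iD0 sD0 cD0]] := rank_basis M (A :|: K).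
have [|D [iD sCD sD cD]] := indep_extend iC iD0; first by rewrite cC cD0 rank_mono ?subsetUr.
have DK : D :&: K = C.
  apply/eqP; rewrite eq_sym eqEcard subsetI sCD sC /= cC.
  by rewrite rank_leq ?subsetIr // (indep_hered iD) ?subsetIl.
have sDA : D :\: K \subset A.
  by rewrite subDset setUC (subset_trans sD) // subUset sD0 (subset_trans sC) ?subsetUr.
rewrite -cD0 -cD -(cardsID K D) DK cC addnC leq_add2r.
apply: rank_leq (sDA); rewrite /= (contr_indepP iC sC cC); last exact: subset_trans sDA sA.
by rewrite -DK setUC setID.
Qed.

Lemma flats_contr K F : F \subset ground M :\: K -> K \subset ground M ->
  (F \in flats (contr M K)) = (F :|: K \in flats M).
Proof.
move=> sF sK; rewrite !inE sF subUset sK andbT /=.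
have sFE : F \subset ground M by apply: subset_trans sF (subsetDl _ _).
have ltE i : i \in ground M :\: K ->
    (rank (contr M K) F < rank (contr M K) (i |: F))%N =
    (rank M (F :|: K) < rank M (i |: (F :|: K)))%N.
  move=> iE; rewrite setUA -!rank_contr ?ltn_add2r //.
  by rewrite subUset sub1set iE.
rewrite sFE /=; apply/forall_inP/forall_inP => h i.
  rewrite !inE negb_or -andbA => /and3P[iF iK iE].
  by rewrite -ltE; [apply: h; rewrite !inE iF iK | rewrite inE iK].
rewrite !inE => /and3P[iF iK iE].
by rewrite ltE; [apply: h; rewrite !inE negb_or iF iK | rewrite inE iK].
Qed.

Lemma loopless_contr K : K \in flats M -> loopless (contr M K).
Proof.
move=> fK i iE; have /[!inE]/andP[iK iE'] := iE.
have := fK; rewrite inE => /andP[sK /forall_inP/(_ i)]; rewrite inE iK iE' => /(_ isT).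
move=> lt; rewrite sub1set iE /= eqn_leq cards1 add1n lt andbT.
have [B [iB sB <-]] := rank_basis M (i |: K).
rewrite (cardsD1 i) -(add1n (rank M K)) leq_add //; first by case: (i \in B).
apply: rank_leq; first by apply: indep_hered iB _; apply: subsetDl.
by rewrite subDset.
Qed.

Lemma rk_contr K : K \subset ground M -> (rk (contr M K) + rank M K)%N = rk M.
Proof.
by move=> sK; rewrite /rk rank_contr //= setDKU.
Qed.

Lemma contr_contr K G : K \subset G -> G \subset ground M ->
  ground (contr (contr M K) (G :\: K)) = ground (contr M G) /\
  indep (contr (contr M K) (G :\: K)) = indep (contr M G).
Proof.
move=> sKG sG.
have gE : (ground M :\: K) :\: (G :\: K) = ground M :\: G.
  apply/setP=> x; rewrite !inE; case: (boolP (x \in K)) => [xK|] //=.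
  by rewrite (subsetP sKG x xK).
split=> //; apply/setP=> A; rewrite !inE [ground _]/= gE.
case: (boolP (A \subset _)) => //= sA.
have sA' : A \subset ground M :\: K by apply: subset_trans sA _; apply: setDS.
have sG' : G :\: K \subset ground M :\: K by apply: setSD.
rewrite -(eqn_add2r (rank M K)) -addnA !rank_contr //; last by rewrite subUset sA'.
by rewrite -setUA setDKU.
Qed.

End Contraction.

(** Functions of two variables on a finite type are square matrices, for which a one-sided inverse
    is two-sided. *)
Lemma sum_inverse_comm (T : finType) (R : comUnitRingType) (f h : T -> T -> R) :
  (forall x z, \sum_y f x y * h y z = (x == z)%:R) ->
  forall x z, \sum_y h x y * f y z = (x == z)%:R.
Proof.
move=> fh; pose mx (u : T -> T -> R) := \matrix_(i < #|T|, j < #|T|) u (enum_val i) (enum_val j).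
have mxM u v i j : (mx u *m mx v) i j = \sum_y u (enum_val i) y * v y (enum_val j).
  rewrite mxE [RHS](reindex_onto enum_val enum_rank) /=; last by move=> y _; rewrite enum_rankK.
  by apply: eq_big => k; rewrite ?enum_valK ?eqxx // !mxE.
have /mulmx1C hf : mx f *m mx h = 1%:M.
  by apply/matrixP=> i j; rewrite mxM fh mxE (inj_eq enum_val_inj).
move=> x z; have := mxM h f (enum_rank x) (enum_rank z).
by rewrite hf !enum_rankK => <-; rewrite mxE (inj_eq enum_rank_inj).
Qed.

(** * Restriction to a cyclic group *)

Section Cyclic.
Variables (gT : finGroupType) (W : {group gT}) (I : finType) (M : eqMatroid W I).
Variable g : gT.
Hypothesis Wg : g \in W.

Fact cycle_sub : <[g]> \subset W. Proof. by rewrite cycle_subG. Qed.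

Definition cycle_act : action <[g]> I := (em_act M \ cycle_sub)%act.

Fact cycle_ground : [acts <[g]>, on ground M | cycle_act].
Proof.
apply/subsetP=> w gw; rewrite /cycle_act astabs_ract inE gw.
exact: (subsetP (em_ground M)) (subsetP cycle_sub w gw).
Qed.

Fact cycle_indep w A : w \in <[g]> ->
  A \in indep M -> (cycle_act^*)%act A w \in indep M.
Proof. by move=> gw; apply: em_indep (subsetP cycle_sub w gw). Qed.

Definition cycle_matroid : eqMatroid <[g]> I := EqMatroid cycle_ground cycle_indep.

End Cyclic.

Lemma act_cycle_eq (gT : finGroupType) (W W' : {group gT}) (I : finType)
    (M : eqMatroid W I) (M' : eqMatroid W' I) g :
  g \in W -> g \in W' -> ground M' = ground M ->
  {in ground M, forall i, em_act M' i g = em_act M i g} ->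
  {in <[g]> & ground M, forall w i, em_act M' i w = em_act M i w}.
Proof.
move=> Wg W'g eE eg w i /cycleP[k ->] iE.
elim: k => [|k IHk]; first by rewrite expg0 !act1.
by rewrite expgSr !actMin ?groupX // IHk eg // astabs_act //
  (subsetP (em_ground M)) ?groupX.
Qed.

Section Kazhdan_Lusztig.
Variables (P : kl_assignment) (hP : is_equivariant_KL P).

Section At.
Variables (gT : finGroupType) (W : {group gT}) (I : finType) (M : eqMatroid W I).

Definition KL_at g : {poly algC} := poly_at g (P M).

End At.

(** Both equivariant matroids pull back to the same action of the cyclic group generated by [g].
    This identifies iterated contractions, which come with different stabilisers. *)
Lemma KL_at_ext (gT : finGroupType) (W W' : {group gT}) (I : finType)
    (M : eqMatroid W I) (M' : eqMatroid W' I) g :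
  loopless M -> g \in W -> g \in W' -> ground M' = ground M -> indep M' = indep M ->
  {in ground M, forall i, em_act M' i g = em_act M i g} ->
  KL_at M' g = KL_at M g.
Proof.
move=> lM Wg W'g eE eI eg.
have lM' : loopless M' by move=> i; rewrite eE eI; apply: lM.
pose M0 := cycle_matroid M' W'g.
have idE : idm <[g]> @* <[g]> = <[g]> by rewrite morphim_idm.
have at0 (W1 : {group gT}) (M1 : eqMatroid W1 I) : loopless M1 -> g \in W1 ->
    ground M' = ground M1 -> indep M' = indep M1 ->
    {in ground M1, forall i, em_act M' i g = em_act M1 i g} ->
    KL_at M1 g = KL_at M0 g.
  move=> lM1 W1g eE1 eI1 eg1; have sW : idm <[g]> @* <[g]> \subset W1.
    by rewrite idE cycle_subG.
  have := KL_pullback hP (phi := idm_morphism <[g]>) (M' := M0) lM1 sW eE1 eI1.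
  rewrite /KL_at => ->; last first.
    by move=> w i gw iE; apply: (act_cycle_eq W1g W'g eE1 eg1 gw iE).
  apply/polyP=> i; rewrite !coef_poly_at coef_map_id0; last by rewrite !linear0.
  rewrite cfMorphE ?cycle_id //= cfResE // morphim_idm ?cycle_id //.
by rewrite (at0 _ M) // -(at0 _ M').
Qed.

Lemma poly_rev_at (gT : finGroupType) (W : {group gT}) g d (p : {poly 'CF(W)}) :
  poly_at g (poly_rev d p) = poly_rev d (poly_at g p).
Proof.
rewrite /poly_rev poly_at_sum; apply: eq_bigr => k _; rewrite coef_poly_at.
apply/polyP=> j; rewrite coef_poly_at !coefZ !coefXn.
by case: (j == _); rewrite ?(mulr0, mulr1) // cfunE.
Qed.

Section Recursion.
Variables (gT : finGroupType) (W : {group gT}) (I : finType) (M : eqMatroid W I).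
Variable g : gT.
Hypotheses (Wg : W = <[g]> :> {set gT}) (lM : loopless M).

Let gW : g \in W. Proof. by rewrite Wg cycle_id. Qed.

(** Conjugation by powers of [g] fixes [g]. A subgroup containing [g] is all of [W], so the index
    factor is 1; for any other subgroup both sides vanish. *)
Lemma cfInd_cycle (H : {group gT}) (phi : 'CF(H)) : H \subset W -> 'Ind[W] phi g = phi g.
Proof.
move=> sHW; rewrite cfIndE // (eq_bigr (fun _ => phi g)) => [|y]; last first.
  rewrite Wg => /cycleP[k ->]; congr (phi _).
  by rewrite conjgE (commuteX k (commute_refl g)) mulKg.
rewrite sumr_const; have [Hg|/cfun0->] := boolP (g \in H); last by rewrite mul0rn mulr0.
have -> : W = H :> {set gT}; last by rewrite -(mulr_natl (phi g)) mulKf ?neq0CG.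
by apply/eqP; rewrite eqEsubset sHW andbT Wg cycle_subG.
Qed.

Lemma acts_flats : [acts W, on flats M | (em_act M)^*].
Proof.
apply/subsetP=> w Ww; rewrite /astabs !inE Ww /=; apply/subsetP=> F fF.
by rewrite inE; apply: set_act_flat.
Qed.

(** A representative not fixed by [g] contributes an induced value equal to 0. A fixed flat is its
    whole orbit, so the transversal must contain it. *)
Lemma KL_recursion_at :
  poly_rev (rk M) (KL_at M g) =
    \sum_(F in fixed_flats M g)
       poly_at g (eq_char_poly (eqRestr M F)) * KL_at (eqContr M F) g.
Proof.
rewrite /KL_at -poly_rev_at (KL_recursion hP lM) poly_at_sum.
have [_ /subsetP sT _ hT] := orbit_transversalP acts_flats.
rewrite (bigID (fun F => g \in flat_stab M F)) /= [X in _ + X]big1 ?addr0; last first.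
  move=> F /andP[_ Fg]; apply/polyP=> i; rewrite coef_poly_at coef0.
  by rewrite coef_map_id0 ?linear0 // cfInd_cycle ?flat_stab_sub ?cfun0.
apply: eq_big => [F|F /andP[_ Fg]]; last first.
  rewrite -poly_atM //; apply/polyP=> i; rewrite !coef_poly_at.
  by rewrite coef_map_id0 ?linear0 // cfInd_cycle ?flat_stab_sub.
apply/andP/idP => [[TF Fg]|fF].
  by apply/fixed_flatsP; split; [apply: sT | apply: flat_actF].
split; last exact: fixed_flat_stab.
case/fixed_flatsP: (fF) => fF1 eF; have [w Ww] := hT F fF1.
have /cycleP[k ->] : w \in <[g]> by rewrite -Wg.
have -> // : (em_act M)^*%act F (g ^+ k)%g = F.
elim: k => [|k IHk]; first by rewrite expg0 act1.
by rewrite expgSr actMin ?groupX // IHk.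
Qed.

End Recursion.

(** * Möbius inversion over fixed flats *)

Section Flats.
Variables (gT : finGroupType) (W : {group gT}) (I : finType) (M : eqMatroid W I).
Variable g : gT.
Hypotheses (Wg : W = <[g]> :> {set gT}) (lM : loopless M).
Implicit Types (F G K Y : {set I}).

Let gW : g \in W. Proof. by rewrite Wg cycle_id. Qed.

Notation L := (fixed_flats M g).
Notation r := (rank M).

Definition KL_flat K : {poly algC} := KL_at (eqContr M K) g.
Definition mobius_flat K Y : algC := mobius (eqContr M K) g (Y :\: K).

Lemma flat_stab_cycle K : K \in L -> flat_stab M K = <[g]> :> {set gT}.
Proof.
move=> LK; apply/eqP; rewrite eqEsubset cycle_subG fixed_flat_stab // andbT.
by rewrite -Wg flat_stab_sub.
Qed.

Lemma fixed_flats_contr K F : K \in L -> F \subset ground M :\: K ->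
  (F \in fixed_flats (eqContr M K) g) = (F :|: K \in L).
Proof.
move=> LK sF; case/fixed_flatsP: (LK) => fK eK.
rewrite [LHS]in_set [RHS]in_set flats_contr ?flats_ground //; congr (_ && _).
rewrite /= /setact imsetU -/(setact (em_act M) F g) -/(setact (em_act M) K g).
move: eK => /= ->; apply/eqP/eqP => [->//|e].
have dis (A : {set I}) : A \subset ground M :\: K -> (A :|: K) :\: K = A.
  rewrite subsetD => /andP[_ dAK]; rewrite setDUl setDv setU0.
  by apply/setDidPl.
have sA : (em_act M)^*%act F g \subset ground M :\: K.
  have gK := fixed_flat_stab gW LK.
  have /= eE := ground_act (eqContr M K) gK.
  by rewrite -[X in _ \subset pred_of_set X]eE /setact imsetS.
by rewrite -[LHS](dis _ sA) e dis.
Qed.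

Lemma sum_fixed_contr K (V : nmodType) (f : {set I} -> V) : K \in L ->
  \sum_(F in fixed_flats (eqContr M K) g) f F =
  \sum_(G in L | K \subset G) f (G :\: K).
Proof.
move=> LK; have sub F : F \in fixed_flats (eqContr M K) g -> F \subset ground M :\: K.
  by case/fixed_flatsP => /flats_ground.
rewrite (reindex_onto (fun G => G :\: K) (fun F => F :|: K)) /=; last first.
  move=> F /sub; rewrite subsetD => /andP[_ dFK].
  by rewrite setDUl setDv setU0; apply/setDidPl.
apply: eq_bigl => G; have [sKG|nKG] := boolP (K \subset G); last first.
  by rewrite andbF; apply/andP=> -[_ /eqP e]; case/negP: nKG; rewrite -e subsetUr.
rewrite setDKU // eqxx !andbT; have [sG|nG] := boolP (G \subset ground M).
  by rewrite fixed_flats_contr ?setDKU // setSD.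
have -> : (G \in L) = false by apply: contraNF nG => /fixed_flatsP[/flats_ground].
apply: contraNF nG => /sub; rewrite subsetD => /andP[sG _].
rewrite -(setDKU sKG) subUset sG flats_ground //.
by case/fixed_flatsP: LK.
Qed.

Lemma KL_flat_recursion K : K \in L ->
  poly_rev (rk M - r K) (KL_flat K) =
    \sum_(G in L | K \subset G)
      (\sum_(Y in L | (K \subset Y) && (Y \subset G))
         mobius_flat K Y *: 'X^(r G - r Y)) * KL_flat G.
Proof.
move=> LK; case/fixed_flatsP: (LK) => fK eK; have sK := flats_ground fK.
have gK := fixed_flat_stab gW LK; have lK := loopless_contr fK.
have rkE (A : {set I}) : A \subset ground M -> K \subset A -> rank (contr M K) (A :\: K) = (r A - r K)%N.
  by move=> sA sKA; rewrite -(setDKU sKA) -rank_contr ?setDKU ?addnK // setSD.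
rewrite -(rk_contr sK) addnK.
rewrite (KL_recursion_at (M := eqContr M K) (flat_stab_cycle LK) lK) sum_fixed_contr //.
apply: eq_bigr => G /andP[LG sKG]; case/fixed_flatsP: (LG) => fG eG.
have sG := flats_ground fG.
have LGK : G :\: K \in fixed_flats (eqContr M K) g.
  by rewrite fixed_flats_contr ?setDKU // setSD.
congr (_ * _).
  rewrite (char_poly_restr gK LGK) big_mkcondr sum_fixed_contr //= -big_mkcondr.
  apply: eq_big => [Y|Y /andP[/andP[LY sKY] sYG]].
    rewrite -andbA; congr (_ && _); apply: andb_id2l => sKY.
    by apply/idP/idP => [sYG|]; [rewrite -(setDKU sKY) -(setDKU sKG) setSU | apply: setSD].
  case/fixed_flatsP: LY => /flats_ground sY _.
  rewrite !rkE //; congr (_ *: 'X^ _); rewrite subnBA ?rank_mono // subnK //.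
  by rewrite rank_mono.
have [gE iE] := contr_contr sKG sG.
apply: KL_at_ext => //; first exact: loopless_contr.
- exact: fixed_flat_stab.
by rewrite (fixed_flat_stab gK LGK).
Qed.

Lemma mobius_flat_sum K G : K \in L -> G \in L -> K \subset G ->
  \sum_(Y in L | (K \subset Y) && (Y \subset G)) mobius_flat K Y = (K == G)%:R.
Proof.
move=> LK LG sKG; case/fixed_flatsP: (LK) => fK eK.
have gK := fixed_flat_stab gW LK; have lK := loopless_contr fK.
have sG : G \subset ground M by case/fixed_flatsP: LG => /flats_ground.
have LGK : G :\: K \in fixed_flats (eqContr M K) g.
  by rewrite fixed_flats_contr ?setDKU // setSD.
have -> : (K == G) = (G :\: K == set0) by rewrite setD_eq0 eqEsubset sKG.
rewrite -(mobius_sum (M := eqContr M K) gK lK LGK) [RHS]big_mkcondr sum_fixed_contr //= -big_mkcondr.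
apply: eq_bigl => Y; rewrite -andbA; congr (_ && _); apply: andb_id2l => sKY.
by apply/idP/idP => [|sYG]; [apply: setSD | rewrite -(setDKU sKY) -(setDKU sKG) setSU].
Qed.

(** Acyclicity gives one side of the inversion with the zeta function. Both functions are extended
    by the identity outside the fixed flats, as [f] and [h], so that they become inverse matrices
    over all sets. *)
Lemma mobius_flat_sum_left K Y : K \in L -> Y \in L -> K \subset Y ->
  \sum_(G in L | (K \subset G) && (G \subset Y)) mobius_flat G Y = (K == Y)%:R.
Proof.
pose f K G := if K \in L then (if (G \in L) && (K \subset G) then mobius_flat K G else 0)
  else (K == G)%:R.
pose h K G : algC := if K \in L then ((G \in L) && (K \subset G))%:R else (K == G)%:R.
have fh A C : \sum_B f A B * h B C = (A == C)%:R.
  rewrite /f; have [LA|LA] := boolP (A \in L); last first.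
    rewrite (bigD1 A) //= eqxx mul1r /h (negPf LA) big1 ?addr0 // => B.
    by rewrite eq_sym => /negPf->; rewrite mul0r.
  under eq_bigr => B _ do rewrite (fun_if (fun x => x * _)) mul0r.
  rewrite -big_mkcond /=; have [/andP[LC sAC]|nC] := boolP ((C \in L) && (A \subset C)).
    rewrite -(mobius_flat_sum LA LC sAC) [RHS]big_mkcond [LHS]big_mkcond.
    apply: eq_bigr => B _; rewrite andbA; case: ifP => //= /andP[LB sAB].
    by rewrite /h LB LC; case: (B \subset C); rewrite ?mulr1 ?mulr0.
  rewrite big1 => [|B /andP[LB sAB]].
    by case: eqP nC => // <-; rewrite LA subxx.
  rewrite /h LB; case: (boolP ((C \in L) && (B \subset C))) nC => [/andP[-> sBC]|_ _]; rewrite ?mulr0 //=.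
  by rewrite (subset_trans sAB sBC).
move=> LK LY sKY; rewrite -(sum_inverse_comm fh K Y).
rewrite big_mkcond; apply: eq_bigr => G _; rewrite /h /f LK LY.
have [LG|LG] := boolP (G \in L); last by rewrite mul0r.
by case: (K \subset G); case: (G \subset Y); rewrite ?mul0r ?mul1r.
Qed.

(* The Z-polynomial of the interval above K is palindromic. *)
Lemma KL_flat_palindromic K : K \in L ->
  \sum_(G in L | K \subset G) poly_rev (rk M - r G) (KL_flat G) =
  \sum_(G in L | K \subset G) 'X^(r G - r K) * KL_flat G.
Proof.
move=> LK.
under eq_bigr => G /andP[LG _] do rewrite KL_flat_recursion //.
rewrite (exchange_big_dep (fun H => (H \in L) && (K \subset H))) /=; last first.
  by move=> G H /andP[_ sKG] /andP[-> /(subset_trans sKG)].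
apply: eq_bigr => H /andP[LH sKH]; rewrite -mulr_suml; congr (_ * _).
rewrite (exchange_big_dep (fun Y => (Y \in L) && ((K \subset Y) && (Y \subset H)))) /=; last first.
  by move=> G Y /andP[/andP[_ sKG] _] /and3P[-> /(subset_trans sKG)->].
(* For fixed [Y], the sum over the [G] between [K] and [Y] is the left inversion formula, so only
   [Y = K] survives. *)
transitivity (\sum_(Y in L | (K \subset Y) && (Y \subset H)) (K == Y)%:R *: 'X^(r H - r Y) : {poly algC}).
  apply: eq_bigr => Y /and3P[LY sKY sYH]; rewrite -mobius_flat_sum_left // scaler_suml.
  apply: eq_bigl => G; rewrite LY LH sYH /= andbT.
  case: (boolP (G \subset Y)) => [sGY|_]; rewrite ?andbF //= (subset_trans sGY sYH).
  by rewrite !andbT.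
rewrite (bigD1 K) ?LK ?subxx //= eqxx scale1r big1 ?addr0 // => Y /andP[_].
by rewrite eq_sym => /negPf->; rewrite scale0r.
Qed.

Definition corank G := (rk M - r G)%N.

Lemma coef_poly_rev d (p : {poly algC}) m :
  (poly_rev d p)`_m = if (m <= d)%N then p`_(d - m) else 0.
Proof.
rewrite /poly_rev coef_sum; case: leqP => [md|md].
  rewrite (bigD1 (inord (d - m))) //= inordK ?ltnS ?leq_subr // coefZ coefXn subKn //.
  rewrite eqxx mulr1 big1 ?addr0 // => j nj; rewrite coefZ coefXn.
  have [e|_] := eqVneq m (d - j)%N; last by rewrite mulr0.
  case/eqP: nj; apply: val_inj; have := ltn_ord j; rewrite ltnS => jd.
  by rewrite /= inordK e subKn // ltnS.
rewrite big1 // => j _; rewrite coefZ coefXn.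
have [e|_] := eqVneq m (d - j)%N; last by rewrite mulr0.
by move: md; rewrite e ltnNge leq_subr.
Qed.

Lemma KL_flat_degree K i : K \in L -> (corank K <= 2 * i)%N ->
  (KL_flat K)`_i = ((corank K == 0) && (i == 0))%N%:R.
Proof.
move=> LK; case/fixed_flatsP: (LK) => fK eK; have lK := loopless_contr fK.
rewrite /corank -(rk_contr (flats_ground fK)) addnK coef_poly_at => ci.
have [c0|c0] := eqVneq (rk (contr M K)) 0%N.
  rewrite (KL_rank0 hP (M := eqContr M K) lK c0) coef1.
  case: (i == 0%N); rewrite ?cfunE //.
  by rewrite cfun1E fixed_flat_stab.
suff -> : (P (eqContr M K))`_i = 0 by rewrite cfunE.
have c1 : (0 < rk (eqContr M K))%N by rewrite lt0n.
apply/eqP; apply: contraTT ci => /(KL_degree hP (M := eqContr M K) lK c1).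
by rewrite -ltnNge.
Qed.

(** Compare the coefficients of degree [corank K - i] in the palindromic identity. The flat [K]
    contributes its coefficient of degree [i] on the left; on the right its contribution exceeds the
    degree bound and vanishes. *)
Lemma KL_flat_coef K i : K \in L -> (2 * i < corank K)%N ->
  (KL_flat K)`_i = \sum_(G in L | K \proper G)
    ((if (i <= corank G)%N then (KL_flat G)`_(corank G - i) else 0) -
     (if (corank K <= i + corank G)%N then (KL_flat G)`_(i + corank G - corank K) else 0)).
Proof.
move=> LK ci; have := congr1 (fun p : {poly algC} => p`_(corank K - i)) (KL_flat_palindromic LK).
have ikc : (corank K - i <= corank K)%N by rewrite leq_subr.
have ic : (i <= corank K)%N by lia.
rewrite !coef_sum (bigD1 K) ?LK ?subxx //= [in RHS](bigD1 K) ?LK ?subxx //=.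
rewrite coef_poly_rev ikc subKn // subnn expr0 mul1r [X in _ = X + _ -> _]KL_flat_degree //; last by lia.
have -> : (corank K == 0%N) = false by apply/eqP; lia.
rewrite add0r sumrB => /(canRL (addrK _))->.
have sub G : [&& G \in L, K \subset G & G != K] = (G \in L) && (K \proper G).
  by rewrite properEneq [G == K]eq_sym [(K != G) && _]andbC.
congr (_ - _); apply: eq_big => G; rewrite -?andbA ?sub // => /andP[LG /proper_sub sKG].
  have sG : G \subset ground M by case/fixed_flatsP: LG => /flats_ground.
  have rKG : (r K <= r G)%N by apply: rank_mono.
  have rG : (r G <= rk M)%N by apply: rank_mono.
  rewrite coefXnM; have -> : (corank K - i < r G - r K)%N = ~~ (i <= corank G)%N.
    by move: ic; rewrite /corank; lia.
  rewrite if_neg; case: leqP => // h; congr (_`_ _).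
  by move: h ic; rewrite /corank; lia.
have sG : G \subset ground M by case/fixed_flatsP: LG => /flats_ground.
have rKG : (r K <= r G)%N by apply: rank_mono.
have rG : (r G <= rk M)%N by apply: rank_mono.
have -> : (corank K <= i + corank G)%N = (corank K - i <= corank G)%N by lia.
rewrite coef_poly_rev -/(corank G); case: leqP => // h; congr (_`_ _); lia.
Qed.

End Flats.

Lemma KL_at_flat0 (gT : finGroupType) (W : {group gT}) (I : finType)
    (M : eqMatroid W I) g (Wg : g \in W) : loopless M ->
  KL_at M g = KL_flat (cycle_matroid M Wg) g set0.
Proof.
move=> lM; apply/esym; apply: KL_at_ext => //=.
- rewrite inE cycle_id /= inE cycle_id inE; apply/subsetP=> x; by rewrite inE.
- exact: setD0.
apply/setP=> A; rewrite !inE setD0 setU0.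
have -> : rank M set0 = 0%N by apply/eqP; rewrite rank_loopless ?sub0set.
rewrite addn0 -indep_rankE; case: (boolP (A \in indep M)) => [/indep_sub->|] //.
by rewrite andbF.
Qed.

End Kazhdan_Lusztig.

(** * Braid matroids *)

Section BraidFlats.
Variable n : nat.
Implicit Types (x y z : 'I_n) (A B F : {set {set 'I_n}}) (l : 'I_n -> nat).

(* The edges inside the blocks of the partition of [n] into the fibres of l. *)
Definition partition_flat l : {set {set 'I_n}} :=
  [set e in edges n | [forall x in e, forall y in e, l x == l y]].

Lemma mem_partition_flat l x y :
  ([set x; y] \in partition_flat l) = (x != y) && (l x == l y).
Proof.
rewrite !inE cards2; case: (eqVneq x y) => //= _; apply/forall_inP/eqP => [h|e u].
  by apply/eqP; move: (h x (set21 _ _)) => /forall_inP; apply; apply: set22.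
by case/set2P=> ->; apply/forall_inP=> v /set2P[]->; rewrite ?e.
Qed.

Lemma edgesP e : reflect (exists x y, x != y /\ e = [set x; y]) (e \in edges n).
Proof.
by rewrite inE; apply: cards2P.
Qed.

Lemma partition_flat_edges l : partition_flat l \subset edges n.
Proof. by apply/subsetP=> e /[!inE] /andP[]. Qed.

Lemma edges_sub A B : A \subset edges n ->
  reflect (forall x y, [set x; y] \in A -> [set x; y] \in B) (A \subset B).
Proof.
move=> sA; apply: (iffP subsetP) => [h x y|h e eA]; first exact: h.
by have /edgesP[x [y [_ ee]]] := subsetP sA e eA; rewrite ee in eA *; apply: h.
Qed.

Lemma partition_flat_sub l l' :
  reflect (forall x y, l x = l y -> l' x = l' y)
          (partition_flat l \subset partition_flat l').
Proof.
apply: (iffP (edges_sub _ (partition_flat_edges l))) => h x y.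
  have [->//|xy e] := eqVneq x y; have := h x y.
  by rewrite !mem_partition_flat xy e eqxx => /(_ isT)/eqP.
by rewrite !mem_partition_flat => /andP[-> /eqP/h->] /=.
Qed.

Lemma connect_partition_flat l A x y : A \subset partition_flat l ->
  connect (adj A) x y -> l x = l y.
Proof.
move=> sA /connectP[p]; elim: p x => [|z p IHp] x /= => [_ ->//|/andP[xz pz] yE].
have := subsetP sA _ xz; rewrite mem_partition_flat => /andP[_ /eqP->].
exact: IHp.
Qed.

(** * Star forests and the rank of a partition *)

Section StarForest.
Variable l : 'I_n -> nat.

(** The pick depends only on the label of [x], hence is common to the block. The default never
    occurs, as [x] satisfies the predicate itself. *)
Definition block_root x := odflt x [pick y | l y == l x].

Lemma l_block_root x : l (block_root x) = l x.
Proof. by rewrite /block_root; case: pickP => [y /eqP|]. Qed.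

Lemma eq_block_root x y : l x = l y -> block_root x = block_root y.
Proof.
move=> e; rewrite /block_root e; case: pickP => [//|/(_ y)].
by rewrite eqxx.
Qed.

Lemma block_rootK x : block_root (block_root x) = block_root x.
Proof. exact/eq_block_root/l_block_root. Qed.

(** Join each vertex to the root of its block. A new non-root [x] is isolated in the forest built so
    far, so its edge closes no cycle. *)
Lemma star_forest (s : seq 'I_n) : uniq s -> exists A,
  [/\ A \in forests n, #|A| = count (fun x => block_root x != x) s,
      {in s, forall x, connect (adj A) x (block_root x)} &
      forall e, e \in A -> exists x, [/\ x \in s, block_root x != x & e = [set x; block_root x]]].
Proof.
elim: s => [_|x s IHs /= /andP[xs /IHs[A [fA cA conA eA]]]].
  by exists set0; split; rewrite ?cards0 ?forest_set0 // => e; rewrite inE.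
have [rx|rx] := eqVneq (block_root x) x; rewrite /= ?add0n.
  exists A; split=> // [y|e /eA[y [ys ry ->]]].
    by rewrite inE => /orP[/eqP->|/conA]; rewrite // rx connect0.
  by exists y; rewrite inE ys orbT.
have nadj z : ~~ adj A x z.
  apply/negP=> /eA[y [ys ry /set2_eq[[e1 _]|[e1 e2]]]].
    by move: xs; rewrite e1 ys.
  by move: rx; rewrite e1 block_rootK eqxx.
have ncon z : connect (adj A) x z -> x = z.
  by case/connectP=> -[|t p] /= => [_ ->//|/andP[xt]]; move: (nadj t); rewrite xt.
exists ([set x; block_root x] |: A); split.
- by apply: forestU => //; apply: contra rx => /ncon {2}->.
- by rewrite cardsU1 cA (negPf (nadj _ : _ \notin A)).
- move=> y; rewrite inE => /orP[/eqP->|/conA]; first by apply: connect1; apply: setU11.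
  by apply: connect_sub => u v uv; apply: connect1; apply: setU1r.
move=> e /setU1P[->|/eA[y [ys ry ->]]]; first by exists x; rewrite mem_head.
by exists y; rewrite inE ys orbT.
Qed.

Lemma star_forest_spans : exists A,
  [/\ A \in forests n, A \subset partition_flat l,
      #|A| = #|[set x | block_root x != x]| &
      forall x y, l x = l y -> connect (adj A) x y].
Proof.
have [A [fA cA conA eA]] := star_forest (enum_uniq 'I_n).
have con x : connect (adj A) x (block_root x) by apply: conA; rewrite mem_enum.
exists A; split=> //.
- apply/subsetP=> e /eA[x [_ rx ->]].
  by rewrite mem_partition_flat eq_sym rx l_block_root eqxx.
- rewrite cA cardE -size_filter; apply/perm_size/uniq_perm=> [||x].
  + exact/filter_uniq/enum_uniq.
  + exact: enum_uniq.
  by rewrite mem_filter !mem_enum !inE andbT.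
move=> x y /eq_block_root e; apply: connect_trans (con x) _.
by rewrite e sym_connect_sym //; apply: adj_sym.
Qed.

Lemma rank_partition_flat_roots :
  rank (braid_matroid n) (partition_flat l) = #|[set x | block_root x != x]|.
Proof.
have [A [fA sA cA conA]] := star_forest_spans.
apply/eqP; rewrite eqn_leq -cA [X in _ && X]rank_leq // andbT.
have [B [fB sB <-]] := rank_basis (braid_matroid n) (partition_flat l).
apply: forest_leq => // x y /(subsetP sB).
by rewrite mem_partition_flat => /andP[_ /eqP/conA].
Qed.

Lemma rank_partition_flat k : (forall x, l x < k)%N ->
  (forall a, (a < k)%N -> exists x, l x = a) ->
  (rank (braid_matroid n) (partition_flat l) + k)%N = n.
Proof.
move=> lk kl; rewrite rank_partition_flat_roots.
suff -> : k = #|[set x | block_root x == x]|.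
  rewrite -[RHS]card_ord -(cardsC [set x | block_root x != x]).
  by congr (_ + #|pred_of_set _|)%N; apply/setP=> x; rewrite !inE negbK.
pose R := [set x | block_root x == x].
have -> : #|R| = size [seq l x | x <- enum R] by rewrite size_map cardE.
rewrite -(size_iota 0 k); apply/perm_size/uniq_perm; first exact: iota_uniq.
  rewrite map_inj_in_uniq ?enum_uniq // => x y.
  by rewrite !mem_enum !inE => /eqP rx /eqP ry /eq_block_root; rewrite rx ry.
move=> a; rewrite mem_iota add0n /=; apply/idP/mapP => [ak|[x _ ->//]].
have [x <-] := kl a ak; exists (block_root x); last by rewrite l_block_root.
by rewrite mem_enum inE block_rootK.
Qed.

Lemma partition_flat_flat : partition_flat l \in flats (braid_matroid n).
Proof.
rewrite inE partition_flat_edges; apply/forall_inP=> e /setDP[/edgesP[x [y [xy ->]]]].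
rewrite mem_partition_flat xy /= => lxy.
have [A [fA sA cA conA]] := star_forest_spans.
have ncA : ~~ connect (adj A) x y.
  by apply: contra lxy => /(connect_partition_flat sA)->.
rewrite rank_partition_flat_roots -cA.
have <- : #|[set x; y] |: A| = #|A|.+1.
  by rewrite cardsU1 (contra _ ncA) // => h; apply: connect1.
by apply: rank_leq; rewrite ?setUS //; apply: forestU.
Qed.

End StarForest.

(** The blocks are the connected components. A basis of [F] already connects the ends of any edge
    inside a component, so adding that edge cannot raise the rank. *)
Lemma flat_partition F : F \in flats (braid_matroid n) ->
  exists l, F = partition_flat l.
Proof.
move=> fF; have sF := flats_ground fF.
exists (fun x => enum_rank (fingraph.root (adj F) x) : nat).
have symF : connect_sym (adj F) by apply/sym_connect_sym/adj_sym.
have [A [fA sA cA]] := rank_basis (braid_matroid n) F.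
have conA u v : [set u; v] \in F -> connect (adj A) u v.
  move=> uvF; apply: contraT => ncA; have fA' := forestU fA ncA.
  have : (#|[set u; v] |: A| <= rank (braid_matroid n) F)%N.
    by apply: rank_leq => //; rewrite subUset sub1set uvF.
  rewrite cardsU1 (contra _ ncA) ?cA ?ltnn // => h; exact: connect1.
apply/eqP; rewrite eqEsubset; apply/andP; split.
  apply/(edges_sub _ sF) => x y xyF; rewrite mem_partition_flat; apply/andP; split.
    by have := subsetP sF _ xyF; rewrite inE cards2; case: (x != y).
  by apply/eqP; congr (nat_of_ord (enum_rank _)); apply/eqP; rewrite root_connect // connect1.
apply/(edges_sub _ (partition_flat_edges _)) => x y.
rewrite mem_partition_flat => /andP[xy /eqP/val_inj/enum_rank_inj/eqP].
rewrite root_connect // => cxy; apply: contraT => xyF.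
have := fF; rewrite inE => /andP[_ /forall_inP/(_ [set x; y])].
rewrite !inE xyF cards2 xy => /(_ isT).
have [B [fB sB <-]] := rank_basis (braid_matroid n) ([set x; y] |: F).
rewrite -cA ltnNge forest_leq // => u v /(subsetP sB) /setU1P[e|/conA //].
have cA' : connect (adj A) x y by apply: connect_sub cxy => a b; apply: conA.
have [[-> ->]|[-> ->]] := set2_eq e; first exact: cA'.
by rewrite sym_connect_sym //; apply: adj_sym.
Qed.

Lemma partition_flat_act l (g : 'S_n) :
  ((braid_act n)^*)%act (partition_flat l) g = partition_flat (l \o g^-1%g).
Proof.
apply/eqP; rewrite eqEsubset; apply/andP; split; apply/subsetP=> e.
  case/imsetP=> e0 /[dup] + + ->; rewrite {1}inE => /andP[/edgesP[x [y [xy ->]]] _].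
  rewrite braid_actE !mem_partition_flat /= !permK => /andP[_ ->].
  by rewrite (inj_eq perm_inj) xy.
move=> /[dup]; rewrite {1}inE => /andP[/edgesP[x [y [xy ->]]] _].
rewrite mem_partition_flat => /andP[_ /= lxy]; apply/imsetP.
exists [set g^-1%g x; g^-1%g y]; last by rewrite braid_actE !permKV.
by rewrite mem_partition_flat (inj_eq perm_inj) xy.
Qed.

Lemma partition_flat_fixed l (g : 'S_n) :
  reflect (forall x y, l x = l y -> l (g x) = l (g y))
          (((braid_act n)^*)%act (partition_flat l) g == partition_flat l).
Proof.
(* The image under [g] has the same number of edges, so one inclusion is enough. *)
have -> : (((braid_act n)^*)%act (partition_flat l) g == partition_flat l) =
   (partition_flat l \subset partition_flat (l \o g)).
  have card_eq : #|partition_flat (l \o g^-1%g)| = #|partition_flat l|.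
    by rewrite -partition_flat_act card_setact.
  rewrite partition_flat_act eqEcard card_eq leqnn andbT.
  apply/partition_flat_sub/partition_flat_sub => h x y e /=.
    by apply: h; rewrite /= !permK.
  by have := h (g^-1%g x) (g^-1%g y); rewrite /= !permKV; apply.
exact: partition_flat_sub.
Qed.

Lemma loopless_braid : loopless (braid_matroid n).
Proof.
move=> e /edgesP[x [y [xy ->]]]; rewrite -[[set _]]setU0 forestU ?forest_set0 //.
apply: contra xy => /connectP[[|z p]] /= => [_ ->//|/andP[]].
by rewrite /adj inE.
Qed.

End BraidFlats.

(** * Binary integers as algebraic numbers *)

Section Zalg.
Implicit Types a b : Z.

Definition Zalg a : algC := (int_of_Z a)%:~R.

Lemma ZalgD a b : Zalg (Z.add a b) = Zalg a + Zalg b.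
Proof. by rewrite /Zalg -intrD -rmorphD. Qed.

Lemma ZalgM a b : Zalg (Z.mul a b) = Zalg a * Zalg b.
Proof. by rewrite /Zalg -intrM -rmorphM. Qed.

Lemma ZalgN a : Zalg (Z.opp a) = - Zalg a.
Proof. by rewrite /Zalg -mulrNz -rmorphN. Qed.

Lemma ZalgB a b : Zalg (Z.sub a b) = Zalg a - Zalg b.
Proof. by rewrite /Z.sub ZalgD ZalgN. Qed.

Lemma Zalg_nat (m : nat) : Zalg (Z.of_nat m) = m%:R.
Proof. by rewrite /Zalg [RHS]pmulrn; congr (_ *~ _); lia. Qed.

Lemma Zalg_inj : injective Zalg.
Proof. by move=> a b /intr_inj /(can_inj int_of_ZK). Qed.

End Zalg.

(** * Enumeration of stable set partitions *)

Section Growth.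
Open Scope nat_scope.
Implicit Types (s t p : seq nat) (a b x y i j k : nat).

Fixpoint nblocks s : nat := if s is a :: s' then maxn a.+1 (nblocks s') else 0.

(* Restricted growth words read from the right: they index the set partitions *)
(* of their positions.                                                        *)
Fixpoint growth_word s : bool :=
  if s is a :: s' then (a <= nblocks s') && growth_word s' else true.

(* For a word s labelling the last positions of a permutation p of
   [0, size p), the pairs (label of x, label of p x). *)
Definition label_pairs p s : seq (nat * nat) :=
  let x0 := size p - size s in
  [seq (q.1, nth 0 s (q.2 - x0)) | q <- zip s (drop x0 p) & x0 <= q.2].

Definition image_label (ps : seq (nat * nat)) a : nat :=
  nth 0 (unzip2 ps) (index a (unzip1 ps)).

Definition stable_word p s : bool :=
  let ps := label_pairs p s in all (fun q => image_label ps q.1 == q.2) ps.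

Definition induced_perm p s : seq nat :=
  let ps := label_pairs p s in [seq image_label ps a | a <- iota 0 (nblocks s)].

Fixpoint stable_growth_words p j : seq (seq nat) :=
  if j is j'.+1 then
    [seq s <- [seq a :: s | s <- stable_growth_words p j', a <- iota 0 (nblocks s).+1]
       | stable_word p s]
  else [:: [::]].

(* The value at a permutation p of the coefficient of t^i in the equivariant
   Kazhdan-Lusztig polynomial of a braid matroid. *)
Fixpoint braid_coef (fuel i : nat) p : Z :=
  let k := size p in
  if k <= (2 * i).+1 then (if (k == 1) && (i == 0) then Z.one else Z0)
  else if fuel is fuel'.+1 then
    foldr (fun (c : seq nat * nat) acc =>
        let r := c.1 in let m := size r in
        let up := if i <= m.-1 then braid_coef fuel' (m.-1 - i) r else Z0 in
        let dn := if k.-1 <= i + m.-1 then braid_coef fuel' (i + m.-1 - k.-1) r else Z0 in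
        Z.add (Z.mul (Z.of_nat c.2) (Z.sub up dn)) acc) Z0
      (tally [seq induced_perm p s | s <- stable_growth_words p k & nblocks s < k])
  else Z0.

Lemma nblocks_mem s : growth_word s -> forall a, (a < nblocks s) = (a \in s).
Proof.
elim: s => [|b s IHs] //= /andP[bs /IHs{}IHs] a.
rewrite in_cons -(IHs a) leq_max ltnS.
by case: (ltngtP a b) => //= ab; rewrite (leq_trans ab bs).
Qed.

Lemma nblocks_size s : growth_word s -> nblocks s <= size s.
Proof.
by elim: s => //= a s IHs /andP[h1 /IHs h2]; rewrite geq_max !ltnS (leq_trans h1 h2) leqW.
Qed.

Lemma nth_lt_nblocks s i : growth_word s -> i < size s -> nth 0 s i < nblocks s.
Proof. by move=> gs si; rewrite nblocks_mem // mem_nth. Qed.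

Lemma growth_word_inj s t : growth_word s -> growth_word t -> size s = size t ->
  (forall i j, i < size s -> j < size s ->
     (nth 0 s i == nth 0 s j) = (nth 0 t i == nth 0 t j)) -> s = t.
Proof.
elim: s t => [|a s IHs] [|b t] //= /andP[as_ gs] /andP[bt gt] [st] h.
have est : s = t by apply: IHs => // i j i1 j1; apply: (h i.+1 j.+1).
rewrite -est in bt gt st h *; congr (_ :: _).
have mem c d : (forall j, j < size s -> (c == nth 0 s j) = (d == nth 0 s j)) ->
    c < nblocks s -> c = d.
  by move=> e; rewrite nblocks_mem // => /(nthP 0)[j js ec]; apply/esym/eqP; rewrite -ec -e // ec.
have e j : j < size s -> (a == nth 0 s j) = (b == nth 0 s j) by move=> js; apply: (h 0 j.+1).
case: (ltngtP a (nblocks s)) as_ => // [lt|ea] _; first exact: (mem a b e lt).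
case: (ltngtP b (nblocks s)) bt => // [lt|eb] _; last by rewrite ea eb.
by apply/esym/(mem b a) => // j js; rewrite e.
Qed.

Lemma growth_word_exists (T : eqType) (z : T) (f : seq T) : exists s,
  [/\ growth_word s, size s = size f &
   forall i j, i < size f -> j < size f -> (nth 0 s i == nth 0 s j) = (nth z f i == nth z f j)].
Proof.
elim: f => [|b f [s [gs sf h]]]; first by exists [::].
have [bf|bf] := boolP (b \in f).
  have bi : index b f < size f by rewrite index_mem.
  exists (nth 0 s (index b f) :: s); split=> /=; last 1 first.
  - case=> [|i] [|j] //=; rewrite ?ltnS ?eqxx // => i1 j1; rewrite ?h ?nth_index //.
  - by rewrite ltnW ?nth_lt_nblocks ?sf.
  by rewrite sf.
exists (nblocks s :: s); split=> /=; [by rewrite leqnn | by rewrite sf|].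
have new i : i < size f -> (nblocks s == nth 0 s i) = false.
  by move=> si; rewrite gtn_eqF // nth_lt_nblocks ?sf.
have newf i : i < size f -> (b == nth z f i) = false.
  by move=> si; apply: contraNF bf => /eqP->; apply: mem_nth.
case=> [|i] [|j] //=; rewrite ?ltnS ?eqxx // => i1 j1; rewrite ?h //.
  by rewrite new ?newf.
by rewrite ![_ == nblocks s]eq_sym ![_ == b]eq_sym new ?newf.
Qed.

Lemma image_labelP (ps : seq (nat * nat)) :
  reflect (forall q r, q \in ps -> r \in ps -> q.1 = r.1 -> q.2 = r.2)
          (all (fun q => image_label ps q.1 == q.2) ps).
Proof.
apply: (iffP allP) => [h q r qp rp e|h q qp].
  by rewrite -(eqP (h q qp)) e; apply/eqP/h.
have i1 : index q.1 (unzip1 ps) < size (unzip1 ps) by rewrite index_mem map_f.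
have i2 : index q.1 (unzip1 ps) < size ps by rewrite size_map in i1.
rewrite /image_label (nth_map (0, 0)) //; apply/eqP; apply: h => //.
  exact: mem_nth.
by rewrite -(nth_map (0, 0) 0 fst) // nth_index // map_f.
Qed.

(** Extending a word only adds pairs, so an inconsistency persists and pruning at every length loses
    no stable word. *)
Lemma label_pairs_cons p a s : size s < size p ->
  {subset label_pairs p s <= label_pairs p (a :: s)}.
Proof.
move=> sp q /mapP[r]; rewrite mem_filter => /andP[x0 rz] ->.
have e : size p - size s = (size p - (size s).+1).+1 by lia.
rewrite /label_pairs /=; apply/mapP; exists r.
  rewrite mem_filter; apply/andP; split; first by rewrite (leq_trans _ x0) // e.
  rewrite (drop_nth 0) /=; last by lia.
  by rewrite inE -e rz orbT.
have shift (v : nat) : size p - size s <= v ->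
    v - (size p - (size s).+1) = (v - (size p - size s)).+1 by lia.
by congr pair; rewrite (shift r.2 x0).
Qed.

Lemma stable_growth_wordsS p j : stable_growth_words p j.+1 =
  [seq s <- [seq a :: s | s <- stable_growth_words p j, a <- iota 0 (nblocks s).+1]
     | stable_word p s].
Proof. by []. Qed.

Lemma mem_stable_growth_words p j s : j <= size p ->
  (s \in stable_growth_words p j) = [&& growth_word s, size s == j & stable_word p s].
Proof.
elim: j s => [|j IHj] s jp.
  rewrite inE; case: s => [|a s]; last by rewrite andbF.
  by rewrite eqxx; apply/esym; rewrite /stable_word /label_pairs subn0 drop_size.
rewrite stable_growth_wordsS mem_filter; apply/andP/and3P => [[ss /allpairsPdep[s' [a [s'j aj e]]]]|].
  move: s'j aj ss; rewrite IHj 1?ltnW // mem_iota add0n ltnS e /= => /and3P[-> /eqP-> _] -> ->.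
  by rewrite eqxx.
case: s => [[] //|a s [gas /eqP[sj] ss]]; split=> //.
have [an gs] : a <= nblocks s /\ growth_word s by apply/andP.
apply/allpairsPdep; exists s, a; split=> //; last by rewrite mem_iota add0n ltnS.
rewrite (IHj s (ltnW jp)) gs sj eqxx /=; apply/image_labelP => q r qs rs.
by have /image_labelP := ss; apply; apply: label_pairs_cons; rewrite ?sj.
Qed.

Lemma stable_growth_words_uniq p j : uniq (stable_growth_words p j).
Proof.
elim: j => // j IHj; rewrite stable_growth_wordsS; apply: filter_uniq; apply: allpairs_uniq_dep => //.
  by move=> s _; apply: iota_uniq.
by move=> [s a] [t b] _ _ /= [-> ->].
Qed.

Lemma label_pairs_full p s : size s = size p ->
  label_pairs p s = [seq (nth 0 s x, nth 0 s (nth 0 p x)) | x <- iota 0 (size p)].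
Proof.
move=> sp; rewrite /label_pairs sp subnn drop0 (eq_filter (a2 := predT)) // filter_predT.
have szip : size (zip s p) = size p by rewrite size_zip sp minnn.
apply: (@eq_from_nth _ (0, 0)) => [|x]; first by rewrite !size_map size_iota.
rewrite size_map szip => xp; rewrite (nth_map (0, 0)) ?szip // nth_zip //=.
by rewrite (nth_map 0) ?size_iota // nth_iota // subn0.
Qed.

Lemma stable_wordP p s : size s = size p ->
  reflect (forall x y, x < size p -> y < size p -> nth 0 s x = nth 0 s y ->
             nth 0 s (nth 0 p x) = nth 0 s (nth 0 p y))
          (stable_word p s).
Proof.
move=> sp; rewrite /stable_word label_pairs_full //.
apply: (iffP (image_labelP _)) => [h x y xp yp e|h q r /mapP[x + ->] /mapP[y + ->]].
  have mem z : z < size p -> (nth 0 s z, nth 0 s (nth 0 p z)) \in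
      [seq (nth 0 s x, nth 0 s (nth 0 p x)) | x <- iota 0 (size p)].
    by move=> zp; apply/mapP; exists z; rewrite ?mem_iota.
  exact: (h _ _ (mem x xp) (mem y yp)).
rewrite !mem_iota !add0n /=; exact: h.
Qed.

Lemma induced_permE p s x : growth_word s -> size s = size p -> stable_word p s ->
  x < size p -> nth 0 (induced_perm p s) (nth 0 s x) = nth 0 s (nth 0 p x).
Proof.
move=> gs sp ss xp; have sx : nth 0 s x < nblocks s by rewrite nth_lt_nblocks ?sp.
rewrite /induced_perm (nth_map 0) ?size_iota // nth_iota // add0n.
have /allP/(_ (nth 0 s x, nth 0 s (nth 0 p x))) := ss.
rewrite label_pairs_full //= => h; apply/eqP/h.
by apply/mapP; exists x; rewrite ?mem_iota.
Qed.

Lemma size_induced_perm p s : size (induced_perm p s) = nblocks s.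
Proof. by rewrite size_map size_iota. Qed.

End Growth.

(** Equal induced permutations are grouped, so that the recursion evaluates each of them once, with
    its multiplicity. *)
Lemma big_tally (T : eqType) (s : seq T) (R : nmodType) (f : T -> R) :
  \sum_(x <- s) f x = \sum_(c <- tally s) f c.1 *+ c.2.
Proof.
rewrite -(perm_big _ (tallyK s)) /tally_seq big_flatten big_map.
by apply: eq_bigr => c _; rewrite big_nseq iter_addr_0.
Qed.

(** * The recursion for braid matroids *)

Section BraidKL.
Variables (P : kl_assignment) (hP : is_equivariant_KL P).
Variables (n : nat) (g : 'S_n).
Hypothesis n_gt0 : (0 < n)%N.
Implicit Types (x y : 'I_n) (l : 'I_n -> nat) (p s : seq nat).

Let M := cycle_matroid (braid n) (in_setT g).
Let Wg : <[g]> = <[g]> :> {set 'S_n}. Proof. by []. Qed.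
Let lM : loopless M. Proof. exact: loopless_braid. Qed.

(* l numbers the blocks of a partition by [0, size p), and g permutes these
   blocks as p. *)
Definition block_labelling l p :=
  [/\ forall x, (l x < size p)%N, forall a, (a < size p)%N -> exists x, l x = a &
      forall x, l (g x) = nth 0%N p (l x)].

Lemma rk_braid : (rk M).+1 = n.
Proof.
have -> : rk M = rank (braid_matroid n) (partition_flat (fun _ : 'I_n => 0%N)).
  rewrite /rk; congr (rank _ _); apply/eqP; rewrite eqEsubset partition_flat_edges andbT.
  by apply/subsetP=> e /edgesP[x [y [xy ->]]]; rewrite mem_partition_flat xy eqxx.
rewrite -[RHS](rank_partition_flat (l := fun _ : 'I_n => 0%N) (k := 1)) ?addn1 //.
by case=> // _; exists (Ordinal n_gt0).
Qed.

Lemma corank_block l p : block_labelling l p ->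
  corank M (partition_flat l) = (size p).-1.
Proof.
case=> lk kl _; have := rank_partition_flat lk kl; have := rk_braid.
rewrite /corank -[rank M _]/(rank (braid_matroid n) _); lia.
Qed.

Lemma block_labelling_fixed l p : block_labelling l p ->
  partition_flat l \in fixed_flats M g.
Proof.
case=> lk kl lg; apply/fixed_flatsP; split; first exact: partition_flat_flat.
by apply/eqP/partition_flat_fixed => x y e; rewrite !lg e.
Qed.

Lemma block_labelling_coarsen l p s : block_labelling l p -> growth_word s ->
  size s = size p -> stable_word p s ->
  block_labelling (fun x => nth 0%N s (l x)) (induced_perm p s).
Proof.
case=> lk kl lg gs sp ss; split=> [x|a|x]; rewrite ?size_induced_perm.
- by rewrite nth_lt_nblocks ?sp.
- rewrite nblocks_mem // => /(nthP 0%N)[i]; rewrite sp => /kl[x <-] <-.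
  by exists x.
by rewrite lg induced_permE.
Qed.

(** A coarser partition is a set partition of the blocks of [l], hence a unique growth word; it is
    fixed by [g] exactly when the word is stable under [p]. *)
Lemma coarsenings l p : block_labelling l p ->
  perm_eq (enum [set G in fixed_flats M g | partition_flat l \proper G])
    [seq partition_flat (fun x => nth 0%N s (l x))
       | s <- stable_growth_words p (size p) & (nblocks s < size p)%N].
Proof.
move=> lP; have [lk kl lg] := lP.
have mem s : s \in [seq s <- stable_growth_words p (size p) | (nblocks s < size p)%N] =
    [&& growth_word s, size s == size p, stable_word p s & (nblocks s < size p)%N].
  by rewrite mem_filter mem_stable_growth_words // andbC -!andbA.
apply: uniq_perm; first exact: enum_uniq.
  rewrite map_inj_in_uniq ?filter_uniq ?stable_growth_words_uniq // => s t.
  rewrite !mem => /and4P[gs /eqP sp _ _] /and4P[gt /eqP tp _ _] /eqP.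
  rewrite eqEsubset => /andP[/partition_flat_sub h1 /partition_flat_sub h2].
  apply: growth_word_inj; rewrite ?sp ?tp // => i j /kl[x <-] /kl[y <-].
  by apply/eqP/eqP => [/h1|/h2].
move=> G; rewrite mem_enum inE; apply/andP/mapP => [[LG pG]|[s]]; last first.
  rewrite mem => /and4P[gs /eqP sp ss nb] ->.
  have lP' := block_labelling_coarsen lP gs sp ss; split.
    exact: block_labelling_fixed lP'.
  rewrite properEneq; apply/andP; split; last by apply/partition_flat_sub => x y ->.
  apply: contraTneq nb => e; have := rank_partition_flat lk kl.
  have [lk' kl' _] := lP'; have := rank_partition_flat lk' kl'.
  by rewrite -e size_induced_perm -leqNgt; lia.
have [f eG] : exists f, G = partition_flat f.
  by case/fixed_flatsP: LG => /flat_partition.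
have cf x y : l x = l y -> f x = f y.
  by move=> e; have := proper_sub pG; rewrite eG => /partition_flat_sub; apply.
(* [t] lists the value of [f] on each block, read at any of its vertices. *)
pose t := [seq omap f [pick x | l x == a] | a <- iota 0 (size p)].
have tE x : nth None t (l x) = Some (f x).
  rewrite (nth_map 0%N) ?size_iota // nth_iota // add0n.
  by case: pickP => [y /eqP/cf/= ->|/(_ x)]; rewrite ?eqxx.
have [s [gs st eqs]] := growth_word_exists None t.
have sp : size s = size p by rewrite st size_map size_iota.
have es x y : (nth 0%N s (l x) == nth 0%N s (l y)) = (f x == f y).
  by rewrite eqs ?tE // size_map size_iota.
have {}eG : G = partition_flat (fun x => nth 0%N s (l x)).
  rewrite eG; apply/eqP; rewrite eqEsubset.
  by apply/andP; split; apply/partition_flat_sub => x y /eqP e; apply/eqP; move: e; rewrite es.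
have ss : stable_word p s.
  apply/stable_wordP => // i j /kl[x <-] /kl[y <-] e; rewrite -!lg.
  case/fixed_flatsP: LG => _ /eqP; rewrite eG => /partition_flat_fixed; exact.
exists s => //; rewrite mem gs sp eqxx ss /= ltn_neqAle -[X in _ && (_ <= X)%N]sp nblocks_size // andbT.
(* With equally many blocks the two flats would have the same rank, and nested flats of equal rank
   coincide. *)
have sKG := proper_sub pG; apply: contraTneq pG => e; have r1 := rank_partition_flat lk kl.
have [lk' kl' _] := block_labelling_coarsen lP gs sp ss.
have := rank_partition_flat lk' kl'; rewrite size_induced_perm e -eG => r2.
have r : rank (braid_matroid n) (partition_flat l) = rank (braid_matroid n) G by lia.
rewrite properEneq negb_and negbK; apply/orP; left; apply/eqP.
have fG : G \in flats (braid_matroid n) by rewrite eG partition_flat_flat.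
have fK := partition_flat_flat l.
rewrite [RHS](span_uniq fG sKG r).
by apply: span_uniq.
Qed.

(** The fuel bounds the number of blocks, which drops strictly in a proper coarsening. *)
Lemma braid_coef_flat fuel i l p : (size p <= fuel)%N -> block_labelling l p ->
  (KL_flat P M g (partition_flat l))`_i = Zalg (braid_coef fuel i p).
Proof.
elim: fuel i l p => [|fuel IH] i l p pf lP.
  have [lk _ _] := lP; have := lk (Ordinal n_gt0).
  by move: pf; rewrite leqn0 => /eqP->.
have LK := block_labelling_fixed lP; have cK := corank_block lP.
have p_gt0 : (0 < size p)%N by have [lk _ _] := lP; apply: leq_ltn_trans (lk (Ordinal n_gt0)).
rewrite [braid_coef _ _ _]/=; case: leqP => pi.
  rewrite KL_flat_degree //; last by rewrite cK; lia.
  rewrite cK (_ : ((size p).-1 == 0)%N = (size p == 1)%N); last by apply/eqP/eqP; lia.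
  by case: (_ && _).
rewrite KL_flat_coef //; last by rewrite cK; lia.
set F := fun r : seq nat =>
  Zalg (if (i <= (size r).-1)%N then braid_coef fuel ((size r).-1 - i) r else Z0) -
  Zalg (if ((size p).-1 <= i + (size r).-1)%N
        then braid_coef fuel (i + (size r).-1 - (size p).-1) r else Z0).
transitivity (\sum_(r <- [seq induced_perm p s | s <- stable_growth_words p (size p) & (nblocks s < size p)%N]) F r).
  rewrite (eq_bigl (mem [set G in fixed_flats M g | partition_flat l \proper G])); last first.
    by move=> G; rewrite /= [in RHS]in_set.
  rewrite -big_enum.
  rewrite (perm_big _ (coarsenings lP)) !big_map big_seq [RHS]big_seq.
  apply: eq_bigr => s; rewrite mem_filter mem_stable_growth_words //.
  case/and4P=> nb gs /eqP sp ss; have lP' := block_labelling_coarsen lP gs sp ss.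
  have pf' : (size (induced_perm p s) <= fuel)%N by rewrite size_induced_perm; lia.
  rewrite /F cK (corank_block lP'); congr (_ - _).
    by case: ifP => // _; rewrite (IH _ _ _ pf' lP').
  by case: ifP => // _; rewrite (IH _ _ _ pf' lP').
rewrite big_tally; elim: (tally _) => [|c s IHs]; first by rewrite big_nil.
by rewrite big_cons IHs /= ZalgD ZalgM ZalgB Zalg_nat mulr_natl.
Qed.

Lemma braid_coefP i p : size p = n -> (forall x, nth 0%N p x = g x) ->
  KL_braid_coef P n i g = Zalg (braid_coef n i p).
Proof.
move=> sp pg; have lP : block_labelling (fun x => x : nat) p.
  split=> [x|a|x]; rewrite ?sp ?pg // => an; by exists (Ordinal an).
rewrite -(braid_coef_flat i _ lP) ?sp //.
(* The partition into singletons is the empty flat, whose contraction is the braid matroid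
   itself. *)
have -> : partition_flat (fun x : 'I_n => x : nat) = set0.
  apply/eqP; rewrite -subset0; apply/(edges_sub _ (partition_flat_edges _)) => x y.
  by rewrite mem_partition_flat => /andP[/negPf xy]; rewrite val_eqE xy.
rewrite /KL_braid_coef -coef_poly_at -(KL_at_flat0 hP (in_setT g)) //.
Qed.

End BraidKL.

(** * Integer partitions and standard permutations *)

Section Partitions.
Open Scope nat_scope.
Implicit Types (t : seq nat) (a i j k m n : nat).

(** Trying the largest part first lists partitions in decreasing lexicographic order, which makes
    the table of permutation characters lower triangular. *)
Fixpoint partitions_upto fuel m n : seq (seq nat) :=
  if n is 0 then [:: [::]] else
  if fuel is fuel'.+1 then
    [seq a :: t | a <- rev (iota 1 (minn m n)), t <- partitions_upto fuel' a (n - a)]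
  else [::].

Definition partitions n := partitions_upto n n n.

Lemma partitions_uptoP fuel m n t : n <= fuel -> sorted geq t -> all (leq 1) t ->
  sumn t = n -> all (geq m) t -> t \in partitions_upto fuel m n.
Proof.
elim: t fuel m n => [|a t IHt] fuel m n /= nf st pt sn mt.
  by rewrite -sn; case: fuel nf.
have /andP[a0 t0] := pt; have /andP[am tm] := mt.
case: n => [|n] in nf sn *; first by move: a0 sn; case: (a).
case: fuel nf => //= fuel nf; apply/allpairsPdep; exists a, t; split=> //.
  rewrite mem_rev mem_iota a0 /= add1n ltnS leq_min am -sn leq_addr //.
move: st; rewrite path_sortedE; last by move=> x y z /= h1 h2; apply: leq_trans h2 h1.
case/andP=> ta st; apply: IHt => //; lia.
Qed.

Lemma partitions_upto_sum fuel m n t : t \in partitions_upto fuel m n ->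
  all (leq 1) t /\ sumn t = n.
Proof.
elim: fuel m n t => [|fuel IH] m [|n] t /=; rewrite ?inE //; try by move/eqP->.
case/allpairsPdep=> a [s [+ /IH[ps ss] ->]].
rewrite mem_rev mem_iota /= => /andP[a0 ha]; rewrite a0 ps ss; split=> //; lia.
Qed.

(* The permutation whose cycles are runs of consecutive integers of the
   lengths listed in t. *)
Fixpoint standard_perm t : seq nat :=
  if t is a :: t' then rcons (iota 1 a.-1) 0 ++ [seq a + x | x <- standard_perm t'] else [::].

Lemma size_standard_perm t : all (leq 1) t -> size (standard_perm t) = sumn t.
Proof.
elim: t => //= a t IHt /andP[a0 /IHt h]; rewrite size_cat size_rcons size_map size_iota h.
by rewrite prednK.
Qed.

Lemma nth_standard_perm_head a t i : i < a ->
  nth 0 (standard_perm (a :: t)) i = if i.+1 < a then i.+1 else 0.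
Proof.
move=> ia /=; have a0 : 0 < a by apply: leq_ltn_trans ia.
rewrite nth_cat size_rcons size_iota prednK // ia nth_rcons size_iota.
case: ltngtP => h; case: ltngtP => h' //; try lia.
by rewrite nth_iota // add1n.
Qed.

Lemma nth_standard_perm_tail a t i : 0 < a -> all (leq 1) t -> a <= i < a + sumn t ->
  nth 0 (standard_perm (a :: t)) i = a + nth 0 (standard_perm t) (i - a).
Proof.
move=> a0 pt /andP[ai it] /=.
rewrite nth_cat size_rcons size_iota prednK // ltnNge ai /= (nth_map 0) //.
by rewrite size_standard_perm //; lia.
Qed.

End Partitions.

(** * Cycle types *)

Section CycleType.
Variables (n : nat) (g : 'S_n).
Implicit Types (x y : 'I_n) (s : seq 'I_n).

Let orbit_word x := traject g x #|porbit g x|.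

(** The concatenated orbits provide the relabelling that makes [g] standard; sorting turns the list
    of cycle lengths into a partition. *)
Fact cycle_reps_exist : exists s, 
  [/\ sorted geq [seq #|porbit g x| | x <- s],
      size s = #|porbits g|, uniq (flatten (map orbit_word s)) &
      flatten (map orbit_word s) =i predT].
Proof.
pose rep (X : {set 'I_n}) := [pick x in X].
pose s0 := pmap rep (enum (porbits g)).
have repE X : X \in porbits g -> exists2 x, rep X = Some x & X = porbit g x.
  case/imsetP=> y _ ->; rewrite /rep; case: pickP => [x xy|/(_ y)]; last by rewrite porbit_id.
  by exists x => //; apply/eqP; rewrite eq_sym eq_porbit_mem.
have s0E : map (porbit g) s0 = enum (porbits g).
  rewrite /s0; have : all [in porbits g] (enum (porbits g)) by apply/allP=> X; rewrite mem_enum.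
  elim: (enum _) => //= X e IHe /andP[/repE[x ex eX] /IHe].
  by rewrite ex /= -eX => ->.
pose s := sort (fun x y => #|porbit g y| <= #|porbit g x|)%N s0.
have ps : perm_eq s s0 by rewrite perm_sort.
have us : uniq (map (porbit g) s) by rewrite (perm_uniq (perm_map _ ps)) s0E enum_uniq.
exists s; split.
- by rewrite sorted_map; apply: sort_sorted => x y; apply: leq_total.
- by rewrite (perm_size ps) -(size_map (porbit g)) s0E cardE.
- elim: s us {ps} => //= x s IHs /andP[xs us].
  rewrite cat_uniq uniq_traject_porbit IHs // andbT; apply/hasPn=> y /flatten_mapP[z zs].
  rewrite /= -!porbit_traject -!eq_porbit_mem => /eqP ->; apply: contra xs => /eqP<-.
  exact: map_f.
move=> y; rewrite inE; apply/flatten_mapP.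
have : porbit g y \in map (porbit g) s by rewrite (perm_mem (perm_map _ ps)) s0E mem_enum imset_f.
case/mapP=> x xs e; exists x => //; by rewrite -porbit_traject -eq_porbit_mem e.
Qed.

Lemma step_orbit_words s x0 i (w := flatten (map orbit_word s)) : (i < size w)%N ->
  let j := nth 0%N (standard_perm [seq #|porbit g x| | x <- s]) i in
  (j < size w)%N /\ g (nth x0 w i) = nth x0 w j.
Proof.
rewrite {}/w; elim: s i => [|x s IHs] i //; rewrite [flatten _]/= [map _ (x :: s)]/=.
set w := flatten _ in IHs *; set t := map _ s in IHs *; set a := #|_|.
have a0 : (0 < a)%N by rewrite lt0n card_porbit_neq0.
have pt : all (leq 1) t by apply/allP=> b /mapP[y _ ->]; rewrite lt0n card_porbit_neq0.
have sw : size w = sumn t.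
  rewrite size_flatten /shape -map_comp; congr sumn; apply: eq_map => y /=.
  exact: size_traject.
rewrite [orbit_word x]/orbit_word -/a size_cat size_traject; case: (ltnP i a) => ia iw.
  have nthE k : (k < a)%N -> nth x0 (traject g x a) k = iter k g x.
    by move=> ka; rewrite (set_nth_default x) ?size_traject // nth_traject.
  rewrite nth_standard_perm_head // !nth_cat size_traject ia nthE //.
  case: (ltnP i.+1 a) => h; first by rewrite h nthE // ltn_addr.
  rewrite a0 ltn_addr // nthE //=; split=> //.
  have -> : g (iter i g x) = iter a g x by rewrite (_ : a = i.+1) //; lia.
  exact: iter_porbit.
rewrite nth_standard_perm_tail ?ia -?sw //.
have [|jw e] := IHs (i - a)%N; first by rewrite ltn_subLR.
by rewrite ltn_add2l !nth_cat size_traject [(i < a)%N]ltnNge ia [(a + _ < a)%N]ltnNge leq_addr addKn.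
Qed.

Definition is_cycle_type (t : seq nat) :=
  exists k : 'S_n, forall x, (g ^ k)%g x = nth 0%N (standard_perm t) x :> nat.

Lemma cycle_type_exists : exists t,
  [/\ t \in partitions n, is_cycle_type t & odd_perm g = odd n (+) odd (size t)].
Proof.
have [s [ss cs us es]] := cycle_reps_exist.
set w := flatten _ in us es; set t := map _ s in ss.
have pt : all (leq 1) t by apply/allP=> a /mapP[x _ ->]; rewrite lt0n card_porbit_neq0.
have sw : size w = sumn t.
  rewrite size_flatten /shape -map_comp; congr sumn; apply: eq_map => x /=.
  exact: size_traject.
have sn : size w = n.
  by rewrite -[RHS]card_ord -(card_uniqP us); apply: eq_card => x; rewrite es.
have f_inj : injective (fun i : 'I_n => nth i w i).
  move=> i j /= e; apply/val_inj/eqP; rewrite -(nth_uniq i _ _ us) ?sn ?ltn_ord //.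
  by rewrite [X in _ == X](set_nth_default j) ?sn ?ltn_ord // e.
(* [h] sends a position to the point listed there, so conjugating by its inverse expresses [g] as a
   permutation of positions. *)
pose h := perm f_inj; exists t; split.
- apply: partitions_uptoP => //; first by rewrite -sw sn.
  apply/allP=> a ta /=; rewrite -[X in (_ <= X)%N]sn sw.
  elim: (t) ta => //= b t' IHt; rewrite inE => /orP[/eqP->|/IHt]; first exact: leq_addr.
  by move/leq_trans; apply; apply: leq_addl.
- exists h^-1%g => x; rewrite conjgE invgK !permM.
  have xw : (x < size w)%N by rewrite sn.
  have [jw e] := step_orbit_words x xw; rewrite -/w -/t ?sn in jw e.
  pose j := Ordinal jw; have hj : h j = nth x w j.
    by rewrite permE (set_nth_default x) ?sn.
  by rewrite [h x]permE e -[nth _ w _]hj permK.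
by rewrite /odd_perm card_ord size_map cs.
Qed.

End CycleType.

Import Num.Theory.

(** * Specht characters *)

Section Submodules.
Variables (gT : finGroupType) (G : {group gT}) (n : nat).
Variable rG : mx_representation algC G n.

Lemma cfRepr_sub_char (U V : 'M[algC]_n) (modU : mxmodule rG U) (modV : mxmodule rG V) :
  (U <= V)%MS ->
  cfRepr (submod_repr modV) - cfRepr (submod_repr modU) \is a character.
Proof.
move=> sUV; have [modU' sim] := mx_rsim_in_submod modU modV sUV.
rewrite (cfRepr_sim sim); suff -> : cfRepr (submod_repr modV) - cfRepr (submod_repr modU') =
  cfRepr (factmod_repr modU') by apply: cfRepr_char.
apply/cfunP=> x; rewrite !cfunE; case: (boolP (x \in G)) => Gx; last by rewrite subrr.
by rewrite !mulr1n -(mxtrace_sub_fact_mod modU') addrC addKr.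
Qed.

Lemma quot_trace_zero m (A : 'M[algC]_m) : quot_trace 0 A = \tr A.
Proof.
rewrite -[in RHS](add_sub_fact_mod 0 A) linearD /= (_ : val_submod _ = 0).
  by rewrite mxtrace0 add0r /quot_trace /quot_mx /in_factmod /val_factmod /= mul1mx -mulmxA mxtrace_mulC.
by apply/eqP; rewrite -submx0 val_submodP.
Qed.

(** The difference is the character of the kernel of [f] on [V], as [V] modulo this kernel is
    isomorphic to the image. *)
Lemma cfRepr_image_char (V f U : 'M[algC]_n) (modV : mxmodule rG V) (modU : mxmodule rG U) :
  centgmx rG f -> (U :=: V *m f)%MS ->
  cfRepr (submod_repr modV) - cfRepr (submod_repr modU) \is a character.
Proof.
move=> /centgmxP cf eU; pose X := in_submod U (val_submod (U := V) 1%:M *m f).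
have sV : (val_submod (U := V) 1%:M *m f <= U)%MS by rewrite eU submxMr ?val_submod1.
have XU x : x \in G -> submod_repr modV x *m X = X *m submod_repr modU x.
  move=> Gx; rewrite -(in_submodJ modU x sV) -mulmxA cf // [in RHS]mulmxA.
  have := val_submodJ modV 1%:M Gx; rewrite mul1mx => <-.
  rewrite [in RHS]val_submodE -[in RHS]mulmxA [in RHS]in_submodE -[in RHS]mulmxA.
  by rewrite -in_submodE.
have XE : X *m val_submod (U := U) 1%:M = val_submod (U := V) 1%:M *m f.
  by rewrite -val_submodE in_submodK.
have Xfull : row_full X.
  have sU : (val_submod (U := U) 1%:M <= X *m val_submod (U := U) 1%:M)%MS.
    by rewrite XE val_submod1 eU submxMr // val_submod1.
  rewrite -sub1mx; move: sU; rewrite -!val_submodE => sU.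
  by rewrite -val_submodS.
have modK : mxmodule (submod_repr modV) (kermx X).
  apply/mxmoduleP=> x Gx; apply/sub_kermxP.
  by rewrite -mulmxA XU // mulmxA mulmx_ker mul0mx.
suff -> : cfRepr (submod_repr modV) - cfRepr (submod_repr modU) =
  cfRepr (submod_repr modK) by apply: cfRepr_char.
apply/cfunP=> x; rewrite !cfunE; case: (boolP (x \in G)) => Gx; last by rewrite subrr.
rewrite !mulr1n -(mxtrace_sub_fact_mod modK) -addrA; apply/eqP.
rewrite eq_sym -subr_eq0 opprD addNKr oppr_eq0 subr_eq0; apply/eqP.
pose Y := pinvmx X; have YX : Y *m X = 1%:M by apply: mulVpmx.
rewrite -[LHS]/(quot_trace (kermx X) (submod_repr modV x)).
(* The image is viewed as a quotient by 0, so that [quot_traceC] carries the trace on [V] modulo the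
   kernel to a trace on [U]. *)
pose O : 'M[algC]_(\rank U) := 0.
have kY : (O *m (Y *m submod_repr modV x) <= kermx X)%MS by rewrite mul0mx sub0mx.
have kX : (kermx X *m X <= O)%MS by rewrite mulmx_ker sub0mx.
rewrite (quot_trace_mod (B := X *m (Y *m submod_repr modV x))).
  by rewrite (quot_traceC kX kY) quot_trace_zero -mulmxA XU // mulmxA YX mul1mx.
apply/sub_kermxP; have := XU x Gx; move: (submod_repr modV x) => R XR.
clearbody Y; clear -YX XR; move: (submod_repr modU x) XR => R'; clearbody X => XR.
by rewrite mulmxBl -!mulmxA XR (mulmxA Y) YX mul1mx subrr.
Qed.

End Submodules.

(** * Common constituents of two characters *)

Section CommonConstituent.
Variables (gT : finGroupType) (G : {group gT}).
Implicit Types phi psi theta chi : 'CF(G).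

(** The products of the multiplicities in [phi] and [psi] sum to 1, so exactly one irreducible
    occurs in both, once in each, and [theta] can only be it. Norm 1 makes [chi] an irreducible up
    to sign; the positive products fix the sign and the irreducible. *)
Lemma common_constituent phi psi theta chi :
  phi - theta \is a character -> psi - theta \is a character ->
  theta \is a character -> theta != 0 -> '[phi, psi] = 1 ->
  phi \is a character -> psi \is a character ->
  chi \in 'Z[irr G] -> '[chi] = 1 -> 0 < '[chi, phi] -> 0 < '[chi, psi] ->
  theta = chi.
Proof.
move=> Ca Cb Ct nt e1 Cphi Cpsi Zchi n1 ca cb.
have mult f : f \is a character -> exists m : Iirr G -> nat, forall k, '[f, 'chi_k] = (m k)%:R.
  move=> Cf; exists (fun k => Num.truncn '[f, 'chi_k]) => k.
  by rewrite truncnK // Cnat_cfdot_char_irr.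
have [a aE] := mult _ Cphi; have [b bE] := mult _ Cpsi; have [t tE] := mult _ Ct.
have ta k : (t k <= a k)%N.
  by have := Cnat_cfdot_char_irr k Ca; rewrite cfdotBl aE tE => /natr_ge0; rewrite subr_ge0 ler_nat.
have tb k : (t k <= b k)%N.
  by have := Cnat_cfdot_char_irr k Cb; rewrite cfdotBl bE tE => /natr_ge0; rewrite subr_ge0 ler_nat.
have ab : (\sum_k a k * b k = 1)%N.
  apply/eqP; rewrite -(eqr_nat algC); apply/eqP; apply: etrans e1.
  rewrite natr_sum cfdot_char_r //.
  by apply: eq_bigr => k _; rewrite natrM aE bE.
have [eps [i eC]] := vchar_norm1P Zchi n1.
have pos f m : (forall k, '[f, 'chi_k] = (m k)%:R) -> 0 < '[chi, f] -> ~~ eps /\ (0 < m i)%N.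
  move=> mE; rewrite eC cfdotZl cfdotC mE conjC_nat.
  case: eps {eC}; last by rewrite mul1r ltr0n.
  by rewrite expr1 mulN1r oppr_gt0 ltrn0.
have [] := pos _ _ aE ca; have [] := pos _ _ bE cb.
case: eps eC {pos} => // -> _ bi _ ai; rewrite expr0 scale1r.
move: ab; rewrite (bigD1 i) //=; set rest := (\sum_(_ | _) _)%N => ab.
have abi : (0 < a i * b i)%N by rewrite muln_gt0 ai.
have {ab} [/eqP ab1 rest0] : (a i * b i = 1 /\ rest = 0)%N by clear -ab abi; lia.
have t0 k : k != i -> t k = 0%N.
  move=> ki; move/eqP: rest0; rewrite sum_nat_eq0 => /forallP/(_ k); rewrite ki muln_eq0.
  by case/orP=> /eqP h; apply/eqP; rewrite -leqn0 -h.
have ti : (t i <= 1)%N by apply: leq_trans (ta i) _; move: ab1; rewrite muln_eq1 => /andP[/eqP->].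
have eT : theta = (t i)%:R *: 'chi_i.
  rewrite [LHS]cfun_sum_cfdot (bigD1 i) //= big1 ?addr0 ?tE // => k ki.
  by rewrite tE t0 // scale0r.
case: (t i) ti eT => [|[|//]] _ eT; last by rewrite eT scale1r.
by move: nt; rewrite eT scale0r eqxx.
Qed.

End CommonConstituent.

(** * Symmetrisers in the group algebra *)

Section GroupAlgebra.
Variables (n : nat).
Notation G := [set: 'S_n]%G.
Notation rho := (regular_repr algC G).
Implicit Types (x y h : 'S_n) (H : {group 'S_n}).

Definition gvec x : 'rV[algC]_#|G| := delta_mx 0 (gring_index G x).

Lemma gvecJ x g : gvec x *m rho g = gvec (x * g)%g.
Proof. by rewrite /gvec -rowE rowK gring_indexK ?inE. Qed.

Lemma gvec_eq k (A B : 'M[algC]_(#|G|, k)) : (forall x, gvec x *m A = gvec x *m B) -> A = B.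
Proof.
by move=> h; apply/row_matrixP=> i; have := h (enum_val i); rewrite /gvec gring_valK -!rowE.
Qed.

(** [regular_repr] multiplies on the right, so left multiplications are its endomorphisms. *)
Definition left_mx h : 'M[algC]_#|G| := \matrix_i gvec (h * enum_val i)%g.

Lemma left_mxE x h : gvec x *m left_mx h = gvec (h * x)%g.
Proof. by rewrite {1}/gvec -rowE rowK gring_indexK ?inE. Qed.

Definition sgn (eps : bool) h : algC := (-1) ^+ (eps && odd_perm h).

Lemma sgnM eps x y : sgn eps (x * y)%g = sgn eps x * sgn eps y.
Proof. by rewrite /sgn odd_permM andb_addr signr_addb. Qed.

Lemma sgnJ eps x y : sgn eps (x ^ y)%g = sgn eps x.
Proof. by rewrite /sgn odd_permJ. Qed.

Lemma sgnV eps x : sgn eps x^-1%g = sgn eps x.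
Proof. by rewrite /sgn odd_permV. Qed.

Definition sym_mx eps H : 'M[algC]_#|G| := \sum_(h in H) sgn eps h *: left_mx h.

Lemma sym_mxE eps H x : gvec x *m sym_mx eps H = \sum_(h in H) sgn eps h *: gvec (h * x)%g.
Proof.
by rewrite mulmx_sumr; apply: eq_bigr => h _; rewrite -scalemxAr left_mxE.
Qed.

Lemma sym_mx_cent eps H : centgmx rho (sym_mx eps H).
Proof.
apply/centgmxP=> g _; apply: gvec_eq => x; rewrite !mulmxA gvecJ !sym_mxE mulmx_suml.
by apply: eq_bigr => h _; rewrite -scalemxAl gvecJ mulgA.
Qed.

Lemma sym_mx_idem eps H : sym_mx eps H *m sym_mx eps H = #|H|%:R *: sym_mx eps H.
Proof.
apply: gvec_eq => x; rewrite mulmxA {1}sym_mxE mulmx_suml -scalemxAr sym_mxE.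
rewrite scaler_nat -sumr_const; apply: eq_bigr => h Hh.
rewrite -scalemxAl sym_mxE scaler_sumr (reindex_inj (mulIg h^-1%g)) /=.
apply: eq_big => k; first by rewrite groupMr ?groupV.
by move=> _; rewrite scalerA mulrC -sgnM -!mulgA mulVg mulg1 mulKg.
Qed.

Lemma trace_left h g : \tr (left_mx h *m rho g) = #|[set x | (h * x * g)%g == x]|%:R.
Proof.
rewrite /mxtrace -[in RHS]sum1_card natr_sum [RHS]big_mkcond (reindex (gring_index G)) /=; last first.
  by exists enum_val => i _; rewrite ?gring_valK ?gring_indexK ?inE.
apply: eq_bigr => x _; rewrite inE.
have -> : (left_mx h *m rho g) (gring_index G x) (gring_index G x) =
    (gvec x *m (left_mx h *m rho g)) 0 (gring_index G x) by rewrite /gvec -rowE !mxE.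
rewrite mulmxA left_mxE gvecJ mxE eqxx /= eq_sym.
have -> : (gring_index G (h * x * g)%g == gring_index G x) = ((h * x * g)%g == x).
  apply/eqP/eqP => [e|->//].
  by rewrite -[LHS](@gring_indexK _ G _ (in_setT _)) e gring_indexK ?inE.
by case: (_ == x).
Qed.

Lemma sym_mx_module eps H : mxmodule rho (sym_mx eps H).
Proof.
apply/mxmoduleP=> g _; have /centgmxP c := sym_mx_cent eps H.
by rewrite c ?inE // submxMl.
Qed.

(** Up to the factor [c], [E] is an equivariant projection onto its image, so a trace on the image
    can be taken on the whole space. *)
Lemma trace_quasi_idem N (rG : mx_representation algC G N) (E : 'M[algC]_N)
    (modE : mxmodule rG E) (c : algC) g :
  centgmx rG E -> E *m E = c *: E ->
  c * \tr (submod_repr modE g) = \tr (E *m rG g).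
Proof.
move=> /centgmxP cE EE; set B := val_submod (U := E) 1%:M.
have BE : B *m E = c *: B.
  have /submxP[D eB] : (B <= E)%MS by rewrite val_submod1.
  by rewrite eB -mulmxA EE scalemxAr.
have BrE : c *: in_submod E (B *m rG g) = B *m rG g *m in_submod E E.
  have -> : c *: in_submod E (B *m rG g) = in_submod E (B *m E *m rG g).
    by rewrite BE -scalemxAl linearZ.
  by rewrite -(mulmxA B) cE ?inE // mulmxA; apply/esym/mulmxA.
rewrite -mxtraceZ [X in \tr X]BrE mxtrace_mulC mulmxA -val_submodE in_submodK //.
Qed.

(** The trace counts solutions of [h x g = x]. Such an [h] is conjugate to the inverse of [g], so
    its sign is that of [g] and factors out, leaving the formula for an induced character. *)
Lemma cfRepr_sym_mx eps H g :
  cfRepr (submod_repr (sym_mx_module eps H)) g = sgn eps g * 'Ind[G, H] 1 g.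
Proof.
have H0 : #|H|%:R != 0 :> algC by apply: neq0CG.
rewrite cfunE inE mulr1n; apply: (mulfI H0).
rewrite (trace_quasi_idem _ _ (sym_mx_cent eps H) (sym_mx_idem eps H)).
rewrite cfIndE ?subsetT // mulrCA mulVKf // mulmx_suml raddf_sum /=.
under eq_bigr => h Hh do rewrite -scalemxAl mxtraceZ trace_left -sum1_card natr_sum mulr_sumr.
under eq_bigr => h Hh do under eq_bigl => x do rewrite inE.
rewrite (exchange_big_dep predT) //= mulr_sumr (reindex_inj invg_inj) /=.
apply: eq_big => [x|x _]; first by rewrite inE.
have e h : (h * x^-1 * g == x^-1)%g = (h == (g^-1) ^ x)%g.
  apply/eqP/eqP => [hx|->]; last by rewrite conjgE !mulgA mulgK mulgKV.
  by rewrite conjgE mulgA -{1}hx mulgK mulgKV.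
under eq_bigl => h do rewrite e; rewrite cfun1E.
have -> : (g ^ x \in H)%g = (g^-1 ^ x \in H)%g by rewrite conjVg groupV.
case: (boolP (g^-1 ^ x \in H)%g) => kH; last first.
  rewrite mulr0 big1 // => h /andP[hH /eqP eh]; by move: kH; rewrite -eh hH.
rewrite (big_pred1 (g^-1 ^ x)%g) => [|h]; first by rewrite sgnJ sgnV.
by rewrite /= andbC; case: eqP => // ->.
Qed.

(** * Row and column modules *)

Section SpechtSub.
Variable la : seq nat.

Definition index_stab (kappa : nat -> nat) : {set 'S_n} :=
  [set s : 'S_n | [forall i, kappa (s i) == kappa i]].

Fact index_stab_group_set kappa : group_set (index_stab kappa).
Proof.
apply/group_setP; split=> [|s t]; first by rewrite inE; apply/forallP=> i; rewrite perm1.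
rewrite !inE => /forallP hs /forallP ht; apply/forallP=> i.
by rewrite permM (eqP (ht _)) hs.
Qed.

Canonical index_stab_group kappa := group (index_stab_group_set kappa).

Let R := index_stab_group (reshape_index la).
Let C := index_stab_group (reshape_offset la).

(** Operators act on row vectors from the right, each by a left multiplication, so the column factor
    comes first although the terms are [r * c]. *)
Lemma young_symmetrizerE :
  young_symmetrizer n la = gvec 1%g *m sym_mx true C *m sym_mx false R.
Proof.
rewrite sym_mxE mulmx_suml /young_symmetrizer exchange_big; apply: eq_bigr => c _ /=.
rewrite -scalemxAl sym_mxE scaler_sumr; apply: eq_bigr => r _.
by rewrite mulg1 /sgn /= expr0 scale1r.
Qed.

Lemma row_col_disjoint s : s \in R -> s \in C -> s = 1%g.
Proof.
rewrite !inE => /forallP hr /forallP hc; apply/permP=> i; rewrite perm1; apply: val_inj.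
by rewrite /= -(reshape_indexK la (s i)) (eqP (hr i)) (eqP (hc i)) reshape_indexK.
Qed.

(** The coefficient of the identity is 1, since [r * c = 1] forces both factors to preserve rows and
    columns. *)
Lemma young_symmetrizer_neq0 : young_symmetrizer n la != 0.
Proof.
have gvec1 x : gvec x 0 (gring_index G 1%g) = (x == 1%g)%:R.
  rewrite mxE eqxx /= eq_sym; congr (nat_of_bool _)%:R.
  apply/eqP/eqP => [e|->//].
  by rewrite -[LHS](@gring_indexK _ G _ (in_setT _)) e gring_indexK ?inE.
suff y1 : young_symmetrizer n la 0 (gring_index G 1%g) = 1.
  by apply/eqP=> y0; have := oner_neq0 algC; rewrite -y1 y0 mxE eqxx.
rewrite /young_symmetrizer summxE (bigD1 1%g) ?(group1 R) //= summxE.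
rewrite (bigD1 1%g) ?(group1 C) //= mxE odd_perm1 expr0 mul1r mulg1 [delta_mx _ _ _ _]gvec1 eqxx.
rewrite big1 => [|c /andP[_ c1]]; last by rewrite mxE mul1g [delta_mx _ _ _ _]gvec1 (negPf c1) mulr0.
rewrite addr0 big1 ?addr0 // => r /andP[Rr r1]; rewrite summxE big1 // => c Cc.
rewrite mxE [delta_mx _ _ _ _]gvec1; case: eqP => [rc|_]; last by rewrite mulr0.
case/eqP: r1; apply: row_col_disjoint => //; rewrite -[r]invgK groupV.
by rewrite (mulg1_eq rc).
Qed.

Lemma gvec1_cyclic : (cyclic_mx rho (gvec 1%g) :=: 1%:M)%MS.
Proof.
apply/eqmxP; rewrite submx1 /=; apply/row_subP=> i; rewrite row1.
rewrite -[i]gring_valK -[delta_mx _ _]/(gvec _) -[enum_val i]mul1g -gvecJ.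
by apply: mxmodule_trans (cyclic_mx_module rho _) _ (cyclic_mx_id rho _); rewrite inE.
Qed.

(** Equivariant maps carry cyclic modules to cyclic modules, and the identity generates the regular
    module. *)
Lemma young_symmetrizer_cyclic :
  (cyclic_mx rho (young_symmetrizer n la) :=: sym_mx true C *m sym_mx false R)%MS.
Proof.
have hom eps H (v : 'rV_#|G|) : (v <= dom_hom_mx rho (sym_mx eps H))%MS.
  by apply/hom_mxP=> g Gg; have /centgmxP c := sym_mx_cent eps H; rewrite -!mulmxA c.
rewrite young_symmetrizerE; apply: eqmx_trans (eqmx_sym (hom_cyclic_mx (hom _ _ _))) _.
apply: eqmxMr; apply: eqmx_trans (eqmx_sym (hom_cyclic_mx (hom _ _ _))) _.
by apply: eqmx_trans (eqmxMr _ gvec1_cyclic) _; rewrite mul1mx.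
Qed.

Definition row_char : 'CF(G) := cfRepr (submod_repr (sym_mx_module false R)).
Definition col_char : 'CF(G) := cfRepr (submod_repr (sym_mx_module true C)).

(** The module lies inside the row module and is the image of the column module under the row
    symmetriser. *)
Lemma spechtP chi : chi \in 'Z[irr G] -> '[chi] = 1 -> '[row_char, col_char] = 1 ->
  0 < '[chi, row_char] -> 0 < '[chi, col_char] -> specht n la = chi.
Proof.
move=> Zchi n1 e1 cr cc; have eU := young_symmetrizer_cyclic.
apply: (common_constituent _ _ _ _ e1 _ _ Zchi n1 cr cc); rewrite ?cfRepr_char //.
- by apply: cfRepr_sub_char; rewrite eU submxMl.
- by apply: cfRepr_image_char (sym_mx_cent false R) eU.
apply/eqP=> /cfunP/(_ 1%g); rewrite cfRepr1 cfunE => /eqP; rewrite pnatr_eq0 mxrank_eq0.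
by rewrite cyclic_mx_eq0 (negPf young_symmetrizer_neq0).
Qed.

End SpechtSub.
End GroupAlgebra.

(** * Colourings constant on cycles *)

Section StandardColourings.
Open Scope nat_scope.
Implicit Types (t mu nu c : seq nat) (a j v : nat).

(* The colourings of [0, sumn t) with content mu (that is, using the colour j
   exactly nth 0 mu j times) that are constant on the cycles of
   standard_perm t. *)
Fixpoint colourings t mu : seq (seq nat) :=
  if t is a :: t' then
    [seq nseq a j ++ c | j <- [seq j <- iota 0 (size mu) | a <= nth 0 mu j],
                         c <- colourings t' (set_nth 0 mu j (nth 0 mu j - a))]
  else if all (pred1 0) mu then [:: [::]] else [::].

Lemma colourings_uniq t mu : all (leq 1) t -> uniq (colourings t mu).
Proof.
elim: t mu => [|a t IHt] mu /=; first by case: ifP.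
case/andP=> a0 pt; apply: allpairs_uniq_dep => [|j _|]; rewrite ?filter_uniq ?iota_uniq //.
  exact: IHt.
move=> [j c] [k d] _ _ /= /eqP; rewrite eqseq_cat ?size_nseq // => /andP[/eqP e /eqP->].
by case: a a0 e => // a _ [->].
Qed.

Lemma mem_colourings t mu c : all (leq 1) t ->
  reflect [/\ size c = sumn t, forall j, count_mem j c = nth 0 mu j &
              forall x, x < sumn t -> nth 0 c (nth 0 (standard_perm t) x) = nth 0 c x]
          (c \in colourings t mu).
Proof.
elim: t mu c => [|a t IHt] mu c.
  move=> _; apply: (iffP idP) => /= [|[/eqP/nilP-> h _]].
    case: ifP => // /allP h; rewrite inE => /eqP->; split=> // j; case: (ltnP j (size mu)) => jm.
      by apply/esym/eqP/h/mem_nth.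
    by rewrite nth_default.
  rewrite (_ : all _ mu) ?mem_seq1 ?eqxx //; apply/allP=> v /(nthP 0)[j _ <-] /=.
  by rewrite -h.
case/andP=> a0 pt; rewrite /=; apply: (iffP allpairsPdep).
  case=> j [d [+ /IHt[//|sd cd fd] ->]]; rewrite mem_filter mem_iota add0n /= => /andP[aj jm].
  split=> [|k|x xt]; first by rewrite size_cat size_nseq sd.
    by rewrite count_cat count_nseq cd nth_set_nth /= [j == k]eq_sym; case: eqP => [->|]; rewrite ?mul1n ?subnKC.
  rewrite -/(standard_perm (a :: t)); case: (ltnP x a) => xa.
    rewrite nth_standard_perm_head // !nth_cat !size_nseq xa !nth_nseq xa.
    by case: (ltnP x.+1 a) => h; rewrite ?h ?a0.
  rewrite nth_standard_perm_tail ?xa // !nth_cat size_nseq !ltnNge leq_addr xa /= addKn.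
  by apply: fd; rewrite ltn_subLR.
case=> sc cc fc; pose j := nth 0 c 0; have ac : a <= size c by rewrite sc leq_addr.
have hc : take a c = nseq a j.
  apply: (@eq_from_nth _ 0) => [|x]; rewrite ?size_takel ?size_nseq // => xa.
  rewrite nth_nseq nth_take xa //; elim: x xa => // x IHx xa; rewrite -[RHS]IHx 1?ltnW //.
  rewrite -[RHS]fc ?ltn_addr 1?ltnW // -/(standard_perm (a :: t)).
  by rewrite nth_standard_perm_head ?xa 1?ltnW.
have ec : c = nseq a j ++ drop a c by rewrite -hc cat_take_drop.
have ca k : nth 0 mu k = (j == k) * a + count_mem k (drop a c).
  by rewrite -cc {1}ec count_cat count_nseq.
exists j, (drop a c); split=> //.
  rewrite mem_filter mem_iota add0n ca eqxx mul1n leq_addr /= ltnNge.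
  by apply/negP=> h; have := ca j; rewrite nth_default // eqxx; lia.
apply/(IHt _ _ pt); split=> [|k|x xt]; first by rewrite size_drop sc addKn.
  by rewrite nth_set_nth /=; case: eqP => [->|kj]; rewrite !ca ?eqxx ?mul1n ?addKn //; case: eqP => // /esym.
rewrite !nth_drop -[RHS]fc ?ltn_add2l // -/(standard_perm (a :: t)).
by rewrite nth_standard_perm_tail ?leq_addr ?ltn_add2l // addKn.
Qed.

Lemma size_colourings_cons a t mu : size (colourings (a :: t) mu) =
  \sum_(j <- iota 0 (size mu) | a <= nth 0 mu j)
     size (colourings t (set_nth 0 mu j (nth 0 mu j - a))).
Proof. by rewrite size_allpairs_dep sumnE big_map big_filter. Qed.

Lemma perm_set_nth mu j v : j < size mu ->
  perm_eq (set_nth 0 mu j v) (v :: rem (nth 0 mu j) mu).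
Proof.
move=> jm; rewrite -(perm_cons (nth 0 mu j)).
apply: (@perm_trans _ (v :: mu)); last first.
  rewrite -[X in perm_eq _ X]cat1s perm_sym -[v :: rem _ _]cat1s perm_catCA /= perm_cons.
  by rewrite perm_sym perm_to_rem ?mem_nth.
rewrite set_nthE jm; have e := drop_nth 0 jm.
by apply/seq.permP => p /=; rewrite -[in RHS](cat_take_drop j mu) e !count_cat /=; lia.
Qed.

Lemma size_colourings_rem a t mu :
  (forall mu mu', perm_eq mu mu' -> size (colourings t mu) = size (colourings t mu')) ->
  size (colourings (a :: t) mu) =
  \sum_(v <- mu | a <= v) size (colourings t (v - a :: rem v mu)).
Proof.
move=> h; rewrite size_colourings_cons [RHS](big_nth 0) /index_iota subn0.
rewrite big_seq_cond [RHS]big_seq_cond; apply: eq_bigr => j /andP[+ _].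
by rewrite mem_iota /= => jm; apply/h/perm_set_nth.
Qed.

(** Only the multiset of remaining capacities matters, which justifies merging equal ones in
    [colouring_count]. *)
Lemma perm_size_colourings t mu mu' : perm_eq mu mu' ->
  size (colourings t mu) = size (colourings t mu').
Proof.
elim: t mu mu' => [|a t IHt] mu mu' e; first by rewrite /= (perm_all _ e).
rewrite !size_colourings_rem // (perm_big _ e) /=; apply: eq_bigr => v _.
apply: IHt; rewrite perm_cons; apply/seq.permP => p.
by rewrite !count_rem (perm_mem e) (seq.permP e).
Qed.

(* The value at cycle type t of the permutation character on the colourings
   with content mu. *)
Fixpoint colouring_count t mu : Z :=
  if t is a :: t' then
    foldr (fun (c : nat * nat) acc =>
        if a <= c.1 then
          Z.add (Z.mul (Z.of_nat c.2) (colouring_count t' (c.1 - a :: rem c.1 mu))) acc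
        else acc) Z0 (tally mu)
  else if all (pred1 0) mu then Z.one else Z0.

Lemma colouring_countP t mu :
  Zalg (colouring_count t mu) = (size (colourings t mu))%:R%R.
Proof.
have natM (x k : nat) : (x *+ k)%R = x * k by rewrite -mulr_natr natn.
elim: t mu => [|a t IHt] mu; first by rewrite /=; case: ifP.
rewrite size_colourings_rem; last exact: perm_size_colourings.
rewrite big_mkcond big_tally /=; elim: (tally mu) => [|c s IHs]; first by rewrite big_nil.
rewrite big_cons /=; case: ifP => _; last by rewrite mul0rn add0r.
by rewrite ZalgD ZalgM Zalg_nat IHs IHt natrD natM natrM mulrC.
Qed.

End StandardColourings.

(** * Permutation characters of Young subgroups *)

Section PermutationCharacter.
Variables (n : nat) (kappa : nat -> nat).
Notation G := [set: 'S_n]%G.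
Let H := index_stab_group n kappa.
Implicit Types (x y : 'I_n) (g p q : 'S_n).

(** Sending [p] to the colouring [col p] has cosets of [H] as fibres, and [g ^ p] lies in [H]
    exactly when that colouring is constant along [g]. The factor [#|H|] in the induction formula
    cancels the size of the fibres. *)
Lemma ind_stabE g (W : seq (seq nat)) : uniq W ->
  (forall c, reflect [/\ size c = n, perm_eq c [seq kappa i | i <- iota 0 n] &
                         forall x, nth 0%N c (g x) = nth 0%N c x] (c \in W)) ->
  'Ind[G, H] 1 g = (size W)%:R.
Proof.
move=> uW memW; pose col p := [seq kappa (p x) | x <- enum 'I_n].
have nth_col p x : nth 0%N (col p) x = kappa (p x).
  by rewrite (nth_map x) ?size_enum_ord // nth_ord_enum.
have size_col p : size (col p) = n by rewrite size_map size_enum_ord.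
pose tK := [tuple kappa i | i < n].
have permK' : [seq kappa i | i <- iota 0 n] = tK by rewrite -val_enum_ord -map_comp.
have colT p : [tuple tnth tK (p i) | i < n] = col p :> seq nat.
  by apply: eq_map => x; rewrite tnth_mktuple.
have colE p q : (col p == col q) = (p^-1 * q \in H)%g.
  rewrite inE; apply/eqP/forallP => [e x|e].
    by rewrite permM -!nth_col -e nth_col permKV.
  apply: (@eq_from_nth _ 0%N) => [|i]; rewrite ?size_col // => i_n.
  by rewrite !(nth_col _ (Ordinal i_n)) -[LHS](eqP (e _)) permM permK.
have colW p : (col p \in W) = (g ^ p \in H)%g.
  rewrite [_ \in H]inE; apply/idP/forallP => [/memW[_ _ e] x|e].
    rewrite conjgE !permM.
    by rewrite -nth_col e nth_col permKV.
  apply/memW; split=> // [|x]; last first.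
    by rewrite !nth_col -[in RHS](eqP (e _)) conjgE !permM permK.
  by rewrite permK'; apply/tuple_permP; exists p; rewrite colT.
have fibre c : c \in W -> #|[set p | col p == c]| = #|H|.
  case/memW=> _; rewrite permK' => /tuple_permP[p ep] _.
  rewrite -(card_lcoset H p); apply: eq_card => q; rewrite inE mem_lcoset -colE eq_sym.
  by rewrite ep colT.
rewrite cfIndE ?subsetT //; apply: (mulfI (neq0CG H)); rewrite mulVKf ?neq0CG //.
transitivity (\sum_(q : 'S_n) (col q \in W)%:R : algC).
  by apply: eq_big => [p|p _]; rewrite ?inE // cfun1E colW.
transitivity (\sum_(c <- W) \sum_(q : 'S_n) (col q == c)%:R : algC).
  rewrite exchange_big; apply: eq_bigr => q _ /=.
  by rewrite -count_uniq_mem // -sum1_count natr_sum big_mkcond; apply: eq_bigr => c _; rewrite /= eq_sym; case: eqP.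
rewrite -[in RHS]sum1_size natr_sum mulr_sumr; apply: eq_big_seq => c /fibre <-; rewrite mulr1.
by rewrite -sum1_card natr_sum [RHS]big_mkcond; apply: eq_bigr => q _; rewrite inE; case: eqP.
Qed.

(** The bounds by [n] reduce the comparison to colours below [n]: beyond them both counts are 0. *)
Definition has_content (mu : seq nat) := [&& (size mu <= n)%N,
  all (fun a => kappa a < n)%N (iota 0 n) &
  all (fun j => count (fun a => kappa a == j) (iota 0 n) == nth 0%N mu j) (iota 0 n)].

Lemma ind_stab_type g t mu : t \in partitions n -> is_cycle_type g t -> has_content mu ->
  'Ind[G, H] 1 g = Zalg (colouring_count t mu).
Proof.
move=> /partitions_upto_sum[pt st] [k kE] /and3P[szmu /allP kn /allP cmu].
have countE j : count_mem j [seq kappa i | i <- iota 0 n] = nth 0%N mu j.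
  rewrite count_map; case: (ltnP j n) => jn; first by apply/eqP/cmu; rewrite mem_iota.
  rewrite nth_default ?(leq_trans szmu) //; apply/eqP; rewrite -leqn0 leqNgt -has_count.
  by apply/hasPn=> x /kn /= h; rewrite neq_ltn (leq_trans h jn).
rewrite colouring_countP -[LHS](cfunJ _ _ (in_setT k)).
apply: ind_stabE => [|c]; first exact: colourings_uniq.
apply: (iffP (mem_colourings _ _ pt)); rewrite st => -[sc cc fc]; split=> //.
- by apply/allP=> j _ /=; rewrite cc countE.
- by move=> x; rewrite kE fc.
- by move=> j; rewrite -countE; apply/seq.permP.
by move=> x xn; have := fc (Ordinal xn); rewrite kE.
Qed.

End PermutationCharacter.

(** * Tables and certificates *)

Section CharacterTable.
Open Scope nat_scope.
Implicit Types (t mu la : seq nat) (i j n : nat) (r : seq nat * seq Z).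

(* A cycle type t together with the values at t of the permutation characters
   indexed by partitions n. *)
Definition table_row n t := (t, [seq colouring_count t mu | mu <- partitions n]).

Definition character_table n := [seq table_row n t | t <- partitions n].

Fixpoint factZ n : Z := if n is m.+1 then Z.mul (Z.of_nat n) (factZ m) else Z.one.

(* n! / (prod_a a^(m_a) m_a!), where m_a is the multiplicity of a in t *)
Definition class_weight t : Z :=
  Z.div (factZ (sumn t))
    (foldr (fun (c : nat * nat) acc =>
       Z.mul (Z.mul (Z.pow (Z.of_nat c.1) (Z.of_nat c.2)) (factZ c.2)) acc) Z.one (tally t)).

Definition class_sum (tab : seq (seq nat * seq Z)) (f : seq nat * seq Z -> Z) : Z :=
  foldr (fun r acc => Z.add (Z.mul (class_weight r.1) (f r)) acc) Z0 tab.

Definition lower_triangular (rows : seq (seq Z)) :=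
  all (fun i => let row := nth [::] rows i in
         ~~ Z.eqb (nth Z0 row i) Z0 && all (fun z => Z.eqb z Z0) (drop i.+1 row))
      (iota 0 (size rows)).

(** The last condition is that each permutation character has average 1 for the computed weights; by
    triangularity it certifies that these are the class sizes. *)
Definition class_check n tab :=
  [&& uniq (partitions n),
      all (fun mu => has_content n (reshape_index mu) mu) (partitions n),
      lower_triangular (unzip2 tab) &
      all (fun j => Z.eqb (class_sum tab (fun r => nth Z0 r.2 j)) (factZ n)) (iota 0 (size tab))].

(* The expansion of det (h_(la_a - a + b)), along the rows from the i-th on and
   the columns in cols. *)
Fixpoint jacobi_trudi i la (cols : seq nat) : seq (Z * seq nat) :=
  if la is a :: la' then
    flatten [seq [seq (if odd (index b cols) then Z.opp c.1 else c.1, 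
                       if a + b == i then c.2 else a + b - i :: c.2)
                    | c <- jacobi_trudi i.+1 la' (rem b cols)]
               | b <- cols & i <= a + b]
  else [:: (Z.one, [::])].

(** Candidate coefficients on the permutation characters, certified by [specht_check]. Sorting the
    factors of each product identifies it with a partition. *)
Definition specht_coefs n la : seq Z :=
  let s := [seq (c.1, sort geq c.2) | c <- jacobi_trudi 0 la (iota 0 (size la))] in
  [seq foldr (fun (c : Z * seq nat) acc => if c.2 == mu then Z.add c.1 acc else acc) Z0 s
     | mu <- partitions n].

Definition dotZ (k l : seq Z) : Z :=
  foldr (fun c acc => Z.add (Z.mul c.1 c.2) acc) Z0 (zip k l).

Definition sign_at n t : Z := if odd n (+) odd (size t) then Z.opp Z.one else Z.one.

Definition conjugate la := [seq count (ltn j) la | j <- iota 0 (head 0 la)].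

(** The hypotheses of [spechtP] for the candidate [chi], the row character [phi] and the column
    character [psi]. Sums over the group replace averages, hence [factZ n] in place of 1. *)
Definition specht_check n tab la :=
  let k := specht_coefs n la in
  let la' := conjugate la in
  let a := index la (partitions n) in
  let b := index la' (partitions n) in
  let chi r := dotZ k r.2 in
  let phi r := nth Z0 r.2 a in
  let psi r := Z.mul (sign_at n r.1) (nth Z0 r.2 b) in
  [&& a < size (partitions n), b < size (partitions n),
      has_content n (reshape_index la) la, has_content n (reshape_offset la) la',
      Z.eqb (class_sum tab (fun r => Z.mul (chi r) (chi r))) (factZ n),
      Z.ltb Z0 (class_sum tab (fun r => Z.mul (chi r) (phi r))),
      Z.ltb Z0 (class_sum tab (fun r => Z.mul (chi r) (psi r))) &
      Z.eqb (class_sum tab (fun r => Z.mul (phi r) (psi r))) (factZ n)].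

Definition multiplicity_check n i (tab : seq (seq nat * seq Z)) (ls : seq (seq nat * nat)) :=
  let ks := [seq (specht_coefs n l.1, Z.of_nat l.2) | l <- ls] in
  all (fun r => Z.eqb (braid_coef n i (standard_perm r.1))
         (foldr (fun c acc => Z.add (Z.mul c.2 (dotZ c.1 r.2)) acc) Z0 ks)) tab.

Definition braid_check n (ls : seq (seq nat * nat)) i :=
  let tab := character_table n in
  [&& class_check n tab, all (fun l => specht_check n tab l.1) ls & multiplicity_check n i tab ls].

End CharacterTable.

Lemma Zalg0 : Zalg Z0 = 0. Proof. by []. Qed.
Lemma Zalg_factZ n : Zalg (factZ n) = n`!%:R.
Proof. by elim: n => // n IHn; rewrite factS natrM -IHn -Zalg_nat -ZalgM. Qed.

Lemma Zalg_gt0 (z : Z) : (0 < Zalg z) = Z.ltb Z0 z.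
Proof. by rewrite /Zalg ltr0z; lia. Qed.

Lemma conj_Zalg (z : Z) : (Zalg z)^* = Zalg z.
Proof. by rewrite /Zalg rmorph_int. Qed.

Lemma class_sumE tab f :
  Zalg (class_sum tab f) = \sum_(r <- tab) Zalg (class_weight r.1) * Zalg (f r).
Proof.
elim: tab => [|r tab IH]; first by rewrite big_nil.
by rewrite big_cons /= ZalgD ZalgM IH.
Qed.

Lemma dotZE (k l : seq Z) : size k = size l ->
  Zalg (dotZ k l) = \sum_(0 <= j < size k) Zalg (nth Z0 k j) * Zalg (nth Z0 l j).
Proof.
elim: k l => [|a k IH] [|b l] // e; first by rewrite big_geq.
by rewrite [size _]/= big_nat_recl //= -IH 1?[size k](succn_inj e) // -ZalgM -ZalgD.
Qed.

(** Back substitution: the last column involves only the last unknown, so the induction runs on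
    [N - i]. *)
Lemma lower_triangular_inj (rows : seq (seq Z)) (x : nat -> algC) :
  lower_triangular rows ->
  (forall j, (j < size rows)%N ->
     \sum_(0 <= i < size rows) x i * Zalg (nth Z0 (nth [::] rows i) j) = 0) ->
  forall i, (i < size rows)%N -> x i = 0.
Proof.
set N := size rows; move=> /allP tri sys.
have {}tri i : (i < N)%N -> nth Z0 (nth [::] rows i) i <> Z0 /\
    forall j, (i < j)%N -> nth Z0 (nth [::] rows i) j = Z0.
  move=> iN; have /tri/andP[d0 z0] : i \in iota 0 N by rewrite mem_iota.
  split=> [e|j ij]; first by rewrite e in d0.
  rewrite -(subnKC ij) -nth_drop; apply/Z.eqb_eq; move: z0; set s := drop _ _ => /allP z0.
  case: (ltnP (j - i.+1) (size s)) => h; last by rewrite nth_default.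
  exact/z0/mem_nth.
suff x0 d i : (i < N)%N -> (N - i <= d)%N -> x i = 0 by move=> i iN; apply: (x0 (N - i)%N).
elim: d i => [|d IHd] i iN dN; first by move: dN; rewrite leqn0 subn_eq0 leqNgt iN.
have := sys i iN; rewrite (bigD1_seq i) ?mem_index_iota ?iota_uniq //= big_seq_cond big1.
  move/eqP; rewrite addr0 mulf_eq0 => /orP[/eqP//|/eqP h].
  by case: (tri i iN) => + _; case; apply: Zalg_inj.
move=> k /andP[]; rewrite mem_index_iota => /andP[_ kN] ki.
case: (ltngtP k i) ki => // ki _; last by rewrite IHd ?mul0r //; lia.
by have [_ ->] := tri k kN; rewrite ?Zalg0 ?mulr0.
Qed.

(** * Class functions on the symmetric group *)

Section ClassFunctions.
Variables (n : nat) (ty : 'S_n -> seq nat).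
Notation G := [set: 'S_n]%G.
Notation tab := (character_table n).
Hypothesis tyP : forall g, [/\ ty g \in partitions n, is_cycle_type g (ty g) &
                           odd_perm g = odd n (+) odd (size (ty g))].
Hypothesis check : class_check n tab.
Implicit Types (g : 'S_n) (f h : 'CF(G)) (F H : seq nat * seq Z -> Z).

Definition has_table_values f F := forall g, f g = Zalg (F (table_row n (ty g))).

Lemma ind_table_values (kappa : nat -> nat) mu : mu \in partitions n ->
  has_content n kappa mu ->
  has_table_values ('Ind[G, index_stab_group n kappa] 1)
    (fun r => nth Z0 r.2 (index mu (partitions n))).
Proof.
move=> mup cmu g; have [typ tyg _] := tyP g.
rewrite (ind_stab_type typ tyg cmu) /= (nth_map [::]) ?index_mem // nth_index //.
Qed.

Lemma sum_class F :
  \sum_(g : 'S_n) Zalg (F (table_row n (ty g))) = Zalg (class_sum tab F).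
Proof.
have /and4P[up /allP content tri /allP sums] := check.
pose N t : algC := #|[set g | ty g == t]|%:R.
have sumN (f : seq nat -> algC) : \sum_(g : 'S_n) f (ty g) = \sum_(t <- partitions n) N t * f t.
  transitivity (\sum_(t <- partitions n) \sum_(g : 'S_n) (ty g == t)%:R * f t).
    rewrite exchange_big; apply: eq_bigr => g _ /=; have [typ _ _] := tyP g.
    rewrite (bigD1_seq _ typ up) /= eqxx mul1r big1 ?addr0 // => t /negPf.
    by rewrite eq_sym => ->; rewrite mul0r.
  apply: eq_bigr => t _; rewrite -mulr_suml; congr (_ * _).
  by rewrite /N -sum1_card natr_sum [RHS]big_mkcond; apply: eq_bigr => g _; rewrite inE; case: eqP.
(* Class sizes and computed weights solve the same triangular system, one equation for each
   permutation character. *)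
have NE t : t \in partitions n -> N t = Zalg (class_weight t).
  move=> tp; pose ps := partitions n; pose x i := N (nth [::] ps i) - Zalg (class_weight (nth [::] ps i)).
  have sz : size (unzip2 tab) = size ps by rewrite !size_map.
  suff x0 i : (i < size ps)%N -> x i = 0.
    by apply/eqP; rewrite -subr_eq0 -(nth_index [::] tp); apply/eqP/x0; rewrite index_mem.
  move=> ips; apply: (lower_triangular_inj tri) => [j|]; last by rewrite sz.
  rewrite sz => jps.
  transitivity (\sum_(t <- ps) (N t - Zalg (class_weight t)) * Zalg (nth Z0 (table_row n t).2 j)).
    rewrite [RHS](big_nth [::]); apply: eq_big_nat => k /andP[_ kps].
    by rewrite (nth_map ([::], [::])) ?size_map // (nth_map [::]).
  under eq_bigr do rewrite mulrBl; rewrite sumrB -(sumN (fun t => Zalg (nth Z0 (table_row n t).2 j))).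
  have /sums/Z.eqb_eq e : j \in iota 0 (size tab) by rewrite mem_iota size_map.
  have := class_sumE tab (fun r => nth Z0 r.2 j); rewrite big_map => <-; rewrite e Zalg_factZ.
  set mu := nth [::] ps j; have mup : mu \in ps by apply: mem_nth.
  have val := ind_table_values mup (content mu mup).
  rewrite index_uniq // in val; apply/eqP; rewrite subr_eq0; apply/eqP.
  (* Frobenius reciprocity turns the average of the induced trivial character into the norm of the
     trivial character, which is 1. *)
  have := cfnorm1 (index_stab_group n (reshape_index mu)).
  rewrite -[in X in '[_, X]](cfRes_cfun1 _ G) Frobenius_reciprocity cfdotE cardsT card_Sn.
  move/(congr1 ( *%R n`!%:R)); rewrite mulr1 mulVKf; last by rewrite pnatr_eq0 -lt0n fact_gt0.
  move=> <-.
  by apply: eq_big => [g|g _]; rewrite ?inE // cfun1E inE conjC1 mulr1 val.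
rewrite class_sumE big_map (sumN (fun t => Zalg (F (table_row n t)))).
by apply: eq_big_seq => t tp; rewrite NE.
Qed.

Lemma cfdot_table f h F H : has_table_values f F -> has_table_values h H ->
  '[f, h] = Zalg (class_sum tab (fun r => Z.mul (F r) (H r))) / n`!%:R.
Proof.
move=> fF hH; rewrite cfdotE cardsT card_Sn mulrC -sum_class; congr (_ / _).
apply: eq_big => [g|g _]; first by rewrite inE.
by rewrite fF hH conj_Zalg ZalgM.
Qed.

Lemma cfdot_table1 f h F H : has_table_values f F -> has_table_values h H ->
  Z.eqb (class_sum tab (fun r => Z.mul (F r) (H r))) (factZ n) -> '[f, h] = 1.
Proof.
move=> fF hH /Z.eqb_eq e; rewrite (cfdot_table fF hH) e Zalg_factZ divff //.
by rewrite pnatr_eq0 -lt0n fact_gt0.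
Qed.

Lemma cfdot_table_gt0 f h F H : has_table_values f F -> has_table_values h H ->
  Z.ltb Z0 (class_sum tab (fun r => Z.mul (F r) (H r))) -> 0 < '[f, h].
Proof.
move=> fF hH e; rewrite (cfdot_table fF hH) divr_gt0 ?Zalg_gt0 //.
by rewrite ltr0n fact_gt0.
Qed.

Lemma specht_table_values la : specht_check n tab la ->
  has_table_values (specht n la) (fun r => dotZ (specht_coefs n la) r.2).
Proof.
rewrite /specht_check; set k := specht_coefs n la; set la' := conjugate la.
rewrite !index_mem => /andP[lap] /andP[lap'] /andP[cla] /andP[cla'].
move=> /andP[n1] /andP[pos_row] /andP[pos_col one].
have /and4P[up /allP content _ _] := check.
set ps := partitions n in up content lap lap'.
pose phi j := 'Ind[G, index_stab_group n (reshape_index (nth [::] ps j))] 1.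
pose X := \sum_(0 <= j < size ps) Zalg (nth Z0 k j) *: phi j.
have sk : size k = size ps by rewrite size_map.
have XE : has_table_values X (fun r => dotZ k r.2).
  move=> g; rewrite dotZE ?size_map ?sk // /X sum_cfunE; apply: eq_big_nat => j /andP[_ jps].
  have mup : nth [::] ps j \in ps by apply: mem_nth.
  by rewrite cfunE (ind_table_values mup (content _ mup)) index_uniq.
have ZX : X \in 'Z[irr G].
  apply: rpred_sum => j _; rewrite scaler_int rpredMz // char_vchar //.
  by rewrite cfInd_char ?cfun1_char.
have rowE : has_table_values (row_char n la) (fun r => nth Z0 r.2 (index la ps)).
  by move=> g; rewrite cfRepr_sym_mx mul1r (ind_table_values lap cla).
have colE : has_table_values (col_char n la)
    (fun r => Z.mul (sign_at n r.1) (nth Z0 r.2 (index la' ps))).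
  move=> g; rewrite cfRepr_sym_mx (ind_table_values lap' cla') ZalgM; congr (_ * _).
  by have [_ _ e] := tyP g; rewrite /sgn /= e /sign_at; case: (_ (+) _).
rewrite (_ : specht n la = X) //; apply: spechtP ZX _ _ _ _.
- exact: (cfdot_table1 XE XE n1).
- exact: (cfdot_table1 rowE colE one).
- exact: (cfdot_table_gt0 XE rowE pos_row).
exact: (cfdot_table_gt0 XE colE pos_col).
Qed.

End ClassFunctions.

(** Multiplicity 1 reduces to [x] itself, not [x *+ 1], so that the folded sums are convertible to
    those of the theorem. *)
Definition multiple (V : nmodType) (x : V) m := if eqn m 1 then x else x *+ m.

Lemma big_multiple (V : nmodType) (T : Type) (f : T -> V) l (ls : seq (T * nat)) :
  \sum_(c <- l :: ls) f c.1 *+ c.2 =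
  foldl (fun v c => v + multiple (f c.1) c.2) (multiple (f l.1) l.2) ls.
Proof.
have mulE x m : multiple x m = x *+ m :> V.
  by rewrite /multiple; case: eqnP => // ->; rewrite mulr1n.
rewrite big_cons mulE; elim: ls (_ *+ _) => [|c ls IH] v; first by rewrite big_nil addr0.
by rewrite big_cons addrA IH /= mulE.
Qed.

(** Both sides are class functions, so they need only be compared at the standard permutation of
    each cycle type. *)
Lemma braid_specht (P : kl_assignment) (hP : is_equivariant_KL P) n i l ls (cs := l :: ls) :
  braid_check n cs i -> (0 < n)%N ->
  KL_braid_coef P n i =
  foldl (fun v c => v + multiple (specht n c.1) c.2) (multiple (specht n l.1) l.2) ls.
Proof.
rewrite -big_multiple -/cs; move: cs => {l}ls /and3P[check /allP specht_ok /allP mult_ok] n_gt0.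
have [ty tyP] := fin_all_exists (@cycle_type_exists n).
apply/cfunP=> g; have [typ tyg _] := tyP g; have [k kE] := tyg.
have [pt st] := partitions_upto_sum typ.
rewrite -[LHS](cfunJ _ _ (in_setT k)).
rewrite (braid_coefP hP n_gt0 i (p := standard_perm (ty g))); last by move=> x; rewrite kE.
  have /mult_ok/Z.eqb_eq-> : table_row n (ty g) \in character_table n by apply: map_f.
  rewrite sum_cfunE; elim: ls specht_ok {mult_ok} => [|l ls IH] ok; first by rewrite big_nil.
  rewrite big_cons /= ZalgD ZalgM Zalg_nat IH => [|l' h]; last by apply: ok; rewrite inE h orbT.
  rewrite -[specht _ _ *+ _]scaler_nat cfunE (specht_table_values tyP check) //.
  by apply: ok; rewrite mem_head.
by rewrite size_standard_perm.
Qed.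

(** * Decompositions *)

Lemma braid_check_6_2 : braid_check 6
  [:: ([:: 2; 2; 2], 1);
      ([:: 4; 2], 1);
      ([:: 6], 1)]%N 2.
Proof. by vm_compute. Qed.

Lemma braid_check_7_2 : braid_check 7
  [:: ([:: 2; 2; 2; 1], 1);
      ([:: 3; 2; 2], 1);
      ([:: 4; 2; 1], 2);
      ([:: 4; 3], 2);
      ([:: 5; 2], 2);
      ([:: 6; 1], 2);
      ([:: 7], 2)]%N 2.
Proof. by vm_compute. Qed.

Lemma braid_check_8_2 : braid_check 8
  [:: ([:: 2; 2; 2; 2], 1);
      ([:: 3; 2; 2; 1], 1);
      ([:: 4; 2; 1; 1], 1);
      ([:: 4; 2; 2], 4);
      ([:: 4; 3; 1], 3);
      ([:: 4; 4], 4);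
      ([:: 5; 2; 1], 4);
      ([:: 5; 3], 4);
      ([:: 6; 1; 1], 1);
      ([:: 6; 2], 7);
      ([:: 7; 1], 4);
      ([:: 8], 4)]%N 2.
Proof. by vm_compute. Qed.

Lemma braid_check_9_2 : braid_check 9
  [:: ([:: 3; 2; 2; 2], 1);
      ([:: 4; 2; 2; 1], 3);
      ([:: 4; 3; 1; 1], 1);
      ([:: 4; 3; 2], 4);
      ([:: 4; 4; 1], 6);
      ([:: 5; 2; 1; 1], 2);
      ([:: 5; 2; 2], 7);
      ([:: 5; 3; 1], 7);
      ([:: 5; 4], 7);
      ([:: 6; 2; 1], 9);
      ([:: 6; 3], 12);
      ([:: 7; 1; 1], 3);
      ([:: 7; 2], 12);
      ([:: 8; 1], 8);
      ([:: 9], 6)]%N 2.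
Proof. by vm_compute. Qed.

Lemma braid_check_8_3 : braid_check 8
  [:: ([:: 2; 2; 2; 2], 1);
      ([:: 3; 2; 2; 1], 1);
      ([:: 3; 3; 1; 1], 1);
      ([:: 4; 1; 1; 1; 1], 1);
      ([:: 4; 2; 1; 1], 1);
      ([:: 4; 2; 2], 3);
      ([:: 4; 3; 1], 1);
      ([:: 4; 4], 2);
      ([:: 5; 2; 1], 2);
      ([:: 5; 3], 1);
      ([:: 6; 2], 2);
      ([:: 7; 1], 1);
      ([:: 8], 1)]%N 3.
Proof. by vm_compute. Qed.

Lemma braid_check_9_3 : braid_check 9
  [:: ([:: 2; 2; 2; 2; 1], 1);
      ([:: 3; 2; 2; 1; 1], 2);
      ([:: 3; 2; 2; 2], 4);
      ([:: 3; 3; 1; 1; 1], 2);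
      ([:: 3; 3; 2; 1], 4);
      ([:: 3; 3; 3], 2);
      ([:: 4; 1; 1; 1; 1; 1], 1);
      ([:: 4; 2; 1; 1; 1], 3);
      ([:: 4; 2; 2; 1], 10);
      ([:: 4; 3; 1; 1], 7);
      ([:: 4; 3; 2], 10);
      ([:: 4; 4; 1], 8);
      ([:: 5; 1; 1; 1; 1], 1);
      ([:: 5; 2; 1; 1], 8);
      ([:: 5; 2; 2], 12);
      ([:: 5; 3; 1], 13);
      ([:: 5; 4], 7);
      ([:: 6; 1; 1; 1], 2);
      ([:: 6; 2; 1], 12);
      ([:: 6; 3], 11);
      ([:: 7; 1; 1], 4);
      ([:: 7; 2], 9);
      ([:: 8; 1], 5);
      ([:: 9], 3)]%N 3.
Proof. by vm_compute. Qed.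

Theorem mainTheorem6 (P : kl_assignment) (hP : is_equivariant_KL P) :
  KL_braid_coef P 6 2 =
    specht 6 [:: 2; 2; 2]%N
    + specht 6 [:: 4; 2]%N
    + specht 6 [:: 6]%N /\
  KL_braid_coef P 7 2 =
    specht 7 [:: 2; 2; 2; 1]%N
    + specht 7 [:: 3; 2; 2]%N
    + specht 7 [:: 4; 2; 1]%N *+ 2
    + specht 7 [:: 4; 3]%N *+ 2
    + specht 7 [:: 5; 2]%N *+ 2
    + specht 7 [:: 6; 1]%N *+ 2
    + specht 7 [:: 7]%N *+ 2 /\
  KL_braid_coef P 8 2 =
    specht 8 [:: 2; 2; 2; 2]%N
    + specht 8 [:: 3; 2; 2; 1]%N
    + specht 8 [:: 4; 2; 1; 1]%N
    + specht 8 [:: 4; 2; 2]%N *+ 4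
    + specht 8 [:: 4; 3; 1]%N *+ 3
    + specht 8 [:: 4; 4]%N *+ 4
    + specht 8 [:: 5; 2; 1]%N *+ 4
    + specht 8 [:: 5; 3]%N *+ 4
    + specht 8 [:: 6; 1; 1]%N
    + specht 8 [:: 6; 2]%N *+ 7
    + specht 8 [:: 7; 1]%N *+ 4
    + specht 8 [:: 8]%N *+ 4 /\
  KL_braid_coef P 9 2 =
    specht 9 [:: 3; 2; 2; 2]%N
    + specht 9 [:: 4; 2; 2; 1]%N *+ 3
    + specht 9 [:: 4; 3; 1; 1]%N
    + specht 9 [:: 4; 3; 2]%N *+ 4
    + specht 9 [:: 4; 4; 1]%N *+ 6
    + specht 9 [:: 5; 2; 1; 1]%N *+ 2
    + specht 9 [:: 5; 2; 2]%N *+ 7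
    + specht 9 [:: 5; 3; 1]%N *+ 7
    + specht 9 [:: 5; 4]%N *+ 7
    + specht 9 [:: 6; 2; 1]%N *+ 9
    + specht 9 [:: 6; 3]%N *+ 12
    + specht 9 [:: 7; 1; 1]%N *+ 3
    + specht 9 [:: 7; 2]%N *+ 12
    + specht 9 [:: 8; 1]%N *+ 8
    + specht 9 [:: 9]%N *+ 6 /\
  KL_braid_coef P 8 3 =
    specht 8 [:: 2; 2; 2; 2]%N
    + specht 8 [:: 3; 2; 2; 1]%N
    + specht 8 [:: 3; 3; 1; 1]%N
    + specht 8 [:: 4; 1; 1; 1; 1]%N
    + specht 8 [:: 4; 2; 1; 1]%N
    + specht 8 [:: 4; 2; 2]%N *+ 3
    + specht 8 [:: 4; 3; 1]%N
    + specht 8 [:: 4; 4]%N *+ 2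
    + specht 8 [:: 5; 2; 1]%N *+ 2
    + specht 8 [:: 5; 3]%N
    + specht 8 [:: 6; 2]%N *+ 2
    + specht 8 [:: 7; 1]%N
    + specht 8 [:: 8]%N /\
  KL_braid_coef P 9 3 =
    specht 9 [:: 2; 2; 2; 2; 1]%N
    + specht 9 [:: 3; 2; 2; 1; 1]%N *+ 2
    + specht 9 [:: 3; 2; 2; 2]%N *+ 4
    + specht 9 [:: 3; 3; 1; 1; 1]%N *+ 2
    + specht 9 [:: 3; 3; 2; 1]%N *+ 4
    + specht 9 [:: 3; 3; 3]%N *+ 2
    + specht 9 [:: 4; 1; 1; 1; 1; 1]%N
    + specht 9 [:: 4; 2; 1; 1; 1]%N *+ 3
    + specht 9 [:: 4; 2; 2; 1]%N *+ 10
    + specht 9 [:: 4; 3; 1; 1]%N *+ 7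
    + specht 9 [:: 4; 3; 2]%N *+ 10
    + specht 9 [:: 4; 4; 1]%N *+ 8
    + specht 9 [:: 5; 1; 1; 1; 1]%N
    + specht 9 [:: 5; 2; 1; 1]%N *+ 8
    + specht 9 [:: 5; 2; 2]%N *+ 12
    + specht 9 [:: 5; 3; 1]%N *+ 13
    + specht 9 [:: 5; 4]%N *+ 7
    + specht 9 [:: 6; 1; 1; 1]%N *+ 2
    + specht 9 [:: 6; 2; 1]%N *+ 12
    + specht 9 [:: 6; 3]%N *+ 11
    + specht 9 [:: 7; 1; 1]%N *+ 4
    + specht 9 [:: 7; 2]%N *+ 9
    + specht 9 [:: 8; 1]%N *+ 5
    + specht 9 [:: 9]%N *+ 3.
Proof.
split; last split; last split; last split; last split.
exact: (braid_specht hP braid_check_6_2 isT).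
exact: (braid_specht hP braid_check_7_2 isT).
exact: (braid_specht hP braid_check_8_2 isT).
exact: (braid_specht hP braid_check_9_2 isT).
exact: (braid_specht hP braid_check_8_3 isT).
exact: (braid_specht hP braid_check_9_3 isT).
Qed.
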